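(* Let $n\ge 1$. The category $W(n,1)\text{-}\mathrm{gpmod}$ of finitely generated graded projective $W(n,1)$-modules is equivalent to the category ${}^{\emptyset}\mathcal{R}^{\hat 1}$ of singular Soergel bimodules.
   Context: $\Bbbk$ is an infinite field of characteristic not equal to $2$; $R=\Bbbk[x_1,\dots,x_n]$ is graded with $\deg x_i=2$. For a graded module $M$, $(M\langle r\rangle)_i=M_{i-r}$. Morphisms in categories of graded modules and bimodules are the degree-preserving homomorphisms. **The algebra $W(n,1)$.** It is the graded unital associative $\Bbbk$-algebra with generators $e_1,\dots,e_{n+1}$, $y_1,\dots,y_{n+1}$, $\psi_1,\dots,\psi_n$ of degrees $\deg e_i=0$, $\deg y_j=2$, $\deg\psi_j=1$, and relations: $e_ie_j=\delta_{ij}e_i$, $\sum_i e_i=1$; $y_je_i=e_iy_j$; $y_jy_l=y_ly_j$; $\psi_je_i=0$ if $i\notin\{j,j+1\}$; $\psi_je_j=e_{j+1}\psi_j$ and $\psi_je_{j+1}=e_j\psi_j$; $\psi_j\psi_l=\psi_l\psi_j$ if $|j-l|>1$; $\psi_jy_l=y_l\psi_j$ if $l\ne j,j+1$; $\psi_jy_j=y_{j+1}\psi_j$; $y_j\psi_j=\psi_jy_{j+1}$; $\psi_j^2e_j=(y_j-y_{j+1})e_j$; $\psi_j^2e_{j+1}=(y_{j+1}-y_j)e_{j+1}$; $\psi_j\psi_{j+1}\psi_j=\psi_{j+1}\psi_j\psi_{j+1}$; $e_1=0$. (Here $e_i$ corresponds to the sequence of $n$ letters $\mathfrak r$ and one letter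 $\mathfrak b$ with $\mathfrak b$ in position $i$.) **Singular Soergel bimodules.** For $I\subset\{1,\dots,n-1\}$ let $S_I\subset S_n$ be the subgroup generated by the simple transpositions $s_i=(i,i+1)$, $i\in I$, and let $R^I$ be the ring of $S_I$-invariants in $R$. The category ${}^I\mathcal{R}^J$ is the full subcategory of graded $(R^I,R^J)$-bimodules consisting of all objects isomorphic to finite direct sums of direct summands of grading shifts of bimodules $$R^{I_1}\otimes_{R^{J_1}}R^{I_2}\otimes_{R^{J_2}}\cdots\otimes_{R^{J_{m-1}}}R^{I_m},\qquad I=I_1\subset J_1\supset I_2\subset\cdots\subset J_{m-1}\supset I_m=J .$$ Finally $\hat 1=\{2,\dots,n-1\}$. *)

(* Defs.v *)
From HB Require Import structures.
From mathcomp Require Import all_boot all_order all_fingroup all_algebra.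
From mathcomp Require Import generic_quotient mpoly boolp.

Set Implicit Arguments.
Unset Strict Implicit.
Unset Printing Implicit Defensive.

Import GRing.Theory.

Local Open Scope ring_scope.
Local Open Scope quotient_scope.

Record category := Category {
  obj :> Type;
  hom : obj -> obj -> Type;
  idm : forall X, hom X X;
  cmp : forall X Y Z, hom Y Z -> hom X Y -> hom X Z;
  cmp1m : forall X Y (f : hom X Y), cmp (idm Y) f = f;
  cmpm1 : forall X Y (f : hom X Y), cmp f (idm X) = f;
  cmpA : forall X Y Z T (h : hom Z T) (g : hom Y Z) (f : hom X Y),
    cmp h (cmp g f) = cmp (cmp h g) f }.

Arguments idm {c} X.
Arguments cmp {c X Y Z} _ _.

Definition is_iso (C : category) (X Y : C) (f : hom X Y) : Prop :=
  exists g : hom Y X, cmp g f = idm X /\ cmp f g = idm Y.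

Definition isomorphic (C : category) (X Y : C) : Prop :=
  exists f : hom X Y, is_iso f.

Definition full_sub (C : category) (P : C -> Prop) : category :=
  @Category {X : C | P X} (fun X Y => hom (sval X) (sval Y))
    (fun X => idm (sval X)) (fun _ _ _ => cmp)
    (fun _ _ => @cmp1m C _ _) (fun _ _ => @cmpm1 C _ _)
    (fun _ _ _ _ => @cmpA C _ _ _ _).

Record functor (C D : category) := Functor {
  fobj :> C -> D;
  fmap : forall X Y, hom X Y -> hom (fobj X) (fobj Y);
  fmap1 : forall X, fmap (idm X) = idm (fobj X);
  fmapM : forall X Y Z (g : hom Y Z) (f : hom X Y),
    fmap (cmp g f) = cmp (fmap g) (fmap f) }.

Definition functor_id (C : category) : functor C C :=
  @Functor C C id (fun _ _ => id) (fun _ => erefl) (fun _ _ _ _ _ => erefl).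

Definition functor_comp (C D E : category) (G : functor D E) (F : functor C D) :
  functor C E.
Proof.
exists (fun X => G (F X)) (fun X Y f => fmap G (fmap F f)) => [X | X Y Z g f].
  by rewrite !fmap1.
by rewrite !fmapM.
Defined.

Definition nat_iso (C D : category) (F G : functor C D) : Prop :=
  exists eta : forall X, hom (F X) (G X),
    (forall X, is_iso (eta X)) /\
    (forall X Y (f : hom X Y), cmp (eta Y) (fmap F f) = cmp (fmap G f) (eta X)).

Definition equivalent (C D : category) : Prop :=
  exists (F : functor C D) (G : functor D C),
    nat_iso (functor_comp G F) (functor_id C) /\
    nat_iso (functor_comp F G) (functor_id D).

(** [g i] is the homogeneous component of degree [i]; the axioms say that [M]
    is the internal direct sum of these subgroups. *)
Record is_grading (M : zmodType) (g : int -> M -> Prop) : Prop := IsGrading {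
  grading0 : forall i, g i 0;
  gradingB : forall i x y, g i x -> g i y -> g i (x - y);
  grading_span : forall x, exists r : seq (int * M),
    (forall p, p \in r -> g p.1 p.2) /\ x = \sum_(p <- r) p.2;
  grading_indep : forall (s : seq int) (f : int -> M), uniq s ->
    (forall i, g i (f i)) -> \sum_(i <- s) f i = 0 ->
    forall i, i \in s -> f i = 0 }.

Lemma gradingN (M : zmodType) g i (x : M) : is_grading g -> g i x -> g i (- x).
Proof.
by move=> gg gx; rewrite -sub0r; apply: gradingB => //; apply: grading0.
Qed.

Lemma gradingD (M : zmodType) g i (x y : M) :
  is_grading g -> g i x -> g i y -> g i (x + y).
Proof.
move=> gg gx gy; rewrite -[y]opprK; apply: gradingB => //.
exact: gradingN.
Qed.

Lemma grading_sum (M : zmodType) g i (I : eqType) (r : seq I) (P : pred I)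
    (F : I -> M) : is_grading g ->
  (forall x, x \in r -> P x -> g i (F x)) -> g i (\sum_(x <- r | P x) F x).
Proof.
move=> gg gF; rewrite big_seq_cond.
apply: (big_ind (g i)); first exact: grading0.
  by move=> x y; apply: gradingD.
by move=> x /andP[]; apply: gF.
Qed.

Lemma grading_proj_indep (M : zmodType) (g : int -> M -> Prop)
    (D : int -> M -> M) :
  (forall d x y, D d (x + y) = D d x + D d y) ->
  (forall d x, g d x -> D d x = x) ->
  (forall d e x, g e x -> e <> d -> D d x = 0) ->
  forall (s : seq int) (f : int -> M), uniq s ->
    (forall i, g i (f i)) -> \sum_(i <- s) f i = 0 ->
    forall i, i \in s -> f i = 0.
Proof.
move=> DD Did Dne s f us gf s0 i si.
have D0 d : D d 0 = 0 by apply: (@addrI _ (D d 0)); rewrite -DD !addr0.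
have := congr1 (D i) s0; rewrite D0 (big_morph (D i) (DD i) (D0 i)) => <-.
rewrite (bigD1_seq i) //= Did // big1 ?addr0 // => j ji.
by apply: Dne (gf j) _ => /eqP; apply/negP.
Qed.

Lemma grading_proj (M : zmodType) (g : int -> M -> Prop) : is_grading g ->
  exists D : int -> M -> M,
  [/\ forall d x y, D d (x + y) = D d x + D d y,
      forall d x, g d (D d x),
      forall d x, g d x -> D d x = x,
      forall d e x, g e x -> e <> d -> D d x = 0 &
      forall x, exists r : seq int, [/\ uniq r,
        forall d, d \notin r -> D d x = 0 & \sum_(d <- r) D d x = x]].
Proof.
move=> gg; have [r r_P] := choice (grading_span gg).
pose part (l : seq (int * M)) d := \sum_(p <- l | p.1 == d) p.2.
pose hg (l : seq (int * M)) := forall p, p \in l -> g p.1 p.2.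
have ghom l d : hg l -> g d (part l d).
  by move=> hl; apply: grading_sum => // p pl /eqP <-; apply: hl.
have part_sum (l : seq (int * M)) (s : seq int) :
    uniq s -> {subset map fst l <= s} ->
    \sum_(d <- s) part l d = \sum_(p <- l) p.2.
  move=> us sub; rewrite /part (exchange_big_dep xpredT) //=.
  rewrite big_seq [RHS]big_seq; apply: eq_bigr => p pl.
  rewrite (eq_bigl (pred1 p.1)) => [|d]; last by rewrite /= eq_sym.
  rewrite -big_filter filter_pred1_uniq ?big_seq1 //.
  by apply: sub; apply: map_f.
have part0 l : hg l -> \sum_(p <- l) p.2 = 0 -> forall d, part l d = 0.
  move=> hl l0 d; have us := undup_uniq (map fst l).
  have := grading_indep gg us (fun i => ghom l i hl).
  rewrite part_sum //; last by move=> p; rewrite mem_undup.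
  move=> /(_ l0) H; have [/H //|nd] := boolP (d \in undup (map fst l)).
  rewrite /part big_seq_cond big_pred0 // => p; apply/negP => /andP[pl /eqP pd].
  by move: nd; rewrite mem_undup -pd map_f.
pose neg (l : seq (int * M)) := [seq (p.1, - p.2) | p <- l].
have hneg l : hg l -> hg (neg l).
  by move=> hl p /mapP[q ql ->] /=; apply: gradingN => //; apply: hl.
have hcat l l' : hg l -> hg l' -> hg (l ++ l').
  by move=> hl hl' p; rewrite mem_cat => /orP[]; [apply: hl | apply: hl'].
have part_cat l l' d : part (l ++ l') d = part l d + part l' d.
  by rewrite /part big_cat.
have part_neg l d : part (neg l) d = - part l d.
  by rewrite /part big_map sumrN.
have sum_neg l : \sum_(p <- neg l) p.2 = - \sum_(p <- l) p.2.
  by rewrite big_map sumrN.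
have D_eq x l d : hg l -> x = \sum_(p <- l) p.2 -> part (r x) d = part l d.
  move=> hl xl; apply/eqP; rewrite -subr_eq0 -part_neg -part_cat; apply/eqP.
  have [hr xr] := r_P x; apply: part0; first by apply/hcat/hneg.
  by rewrite big_cat /= sum_neg -xl -xr subrr.
have D_hom d e x : g e x -> part (r x) d = if e == d then x else 0.
  move=> gx; rewrite (D_eq _ [:: (e, x)]).
  - by rewrite /part big_mkcond big_seq1.
  - by move=> p /[!inE] /eqP->.
  - by rewrite big_seq1.
exists (fun d x => part (r x) d); split.
- move=> d x y; rewrite -part_cat; have [hx ex] := r_P x; have [hy ey] := r_P y.
  by apply: D_eq; [apply: hcat | rewrite big_cat -ex -ey].
- by move=> d x; apply: ghom; case: (r_P x).
- by move=> d x /(D_hom d) ->; rewrite eqxx.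
- by move=> d e x /(D_hom d) -> /eqP/negPf->.
- move=> x; have [hx ex] := r_P x.
  exists (undup (map fst (r x))); split; first exact: undup_uniq.
    move=> d; rewrite mem_undup => nd.
    rewrite /part big_seq_cond big_pred0 // => p.
    by apply/negP => /andP[pl /eqP pd]; move: nd; rewrite -pd map_f.
  by rewrite part_sum ?undup_uniq // => p; rewrite mem_undup.
Qed.

Lemma sval_inj (T : Type) (P : T -> Prop) (x y : {z : T | P z}) :
  sval x = sval y -> x = y.
Proof. by case: x y => x Px [y Py] /= xy; apply: eq_exist. Qed.

Record gring := GRingPack {
  gr_sort :> pzRingType;
  gr_deg : int -> gr_sort -> Prop;
  gr_grading : is_grading gr_deg;
  gr_deg1 : gr_deg 0 1;
  gr_degM : forall i j a b, gr_deg i a -> gr_deg j b -> gr_deg (i + j) (a * b) }.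

Arguments gr_deg {g} _ _.

Record gmod (A : gring) := GMod {
  gm_sort :> lmodType A;
  gm_deg : int -> gm_sort -> Prop;
  gm_grading : is_grading gm_deg;
  gm_degZ : forall i j (a : A) (x : gm_sort),
    gr_deg i a -> gm_deg j x -> gm_deg (i + j) (a *: x) }.

Arguments gm_deg {A g} _ _.

Definition gmod_hom (A : gring) (M N : gmod A) :=
  {f : M -> N | linear f /\ forall i x, gm_deg i x -> gm_deg i (f x)}.

Definition gmod_id (A : gring) (M : gmod A) : gmod_hom M M.
Proof. by exists id; split. Defined.

Definition gmod_cmp (A : gring) (M N P : gmod A)
  (g : gmod_hom N P) (f : gmod_hom M N) : gmod_hom M P.
Proof.
exists (sval g \o sval f); case: g f => g [lg dg] [f [lf df]]; split => /=.
  by move=> a x y /=; rewrite lf lg.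
by move=> i x /df /dg.
Defined.

Definition gmod_cat (A : gring) : category.
Proof.
by apply: (@Category (gmod A) (@gmod_hom A) (@gmod_id A) (@gmod_cmp A));
  intros; apply: sval_inj.
Defined.

Definition fin_gen (A : gring) (M : gmod A) : Prop :=
  exists (m : nat) (v : 'I_m -> M), forall x : M,
    exists a : 'I_m -> A, x = \sum_i a i *: v i.

Definition gproj (A : gring) (P : gmod A) : Prop :=
  forall (M N : gmod A) (p : gmod_hom M N) (f : gmod_hom P N),
    (forall y, exists x, sval p x = y) ->
    exists g : gmod_hom P M, gmod_cmp p g = f.

Definition gpmod (A : gring) : category :=
  @full_sub (gmod_cat A) (fun M : gmod A => fin_gen M /\ gproj M).

Record is_bimodule (A B : pzRingType) (M : zmodType)
    (l : A -> M -> M) (r : M -> B -> M) : Prop := IsBimodule {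
  lactDr : forall a x y, l a (x + y) = l a x + l a y;
  lactDl : forall a b x, l (a + b) x = l a x + l b x;
  lactM : forall a b x, l (a * b) x = l a (l b x);
  lact1 : forall x, l 1 x = x;
  ractDl : forall x y b, r (x + y) b = r x b + r y b;
  ractDr : forall x a b, r x (a + b) = r x a + r x b;
  ractM : forall x a b, r x (a * b) = r (r x a) b;
  ract1 : forall x, r x 1 = x;
  lractA : forall a x b, r (l a x) b = l a (r x b) }.

Record gbimod (A B : gring) := GBimod {
  bm_sort :> zmodType;
  lact : A -> bm_sort -> bm_sort;
  ract : bm_sort -> B -> bm_sort;
  bm_deg : int -> bm_sort -> Prop;
  bm_bimodule : is_bimodule lact ract;
  bm_grading : is_grading bm_deg;
  bm_degl : forall i j a x,
    gr_deg i a -> bm_deg j x -> bm_deg (i + j) (lact a x);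
  bm_degr : forall i j x b,
    bm_deg i x -> gr_deg j b -> bm_deg (i + j) (ract x b) }.

Arguments lact {A B g} _ _.
Arguments ract {A B g} _ _.
Arguments bm_deg {A B g} _ _.

Definition is_gbimod_hom (A B : gring) (M N : gbimod A B) (f : M -> N) : Prop :=
  [/\ forall x y, f (x + y) = f x + f y,
      forall a x, f (lact a x) = lact a (f x),
      forall x b, f (ract x b) = ract (f x) b &
      forall i x, bm_deg i x -> bm_deg i (f x)].

Definition gbimod_hom (A B : gring) (M N : gbimod A B) :=
  {f : M -> N | is_gbimod_hom f}.

Definition gbimod_id (A B : gring) (M : gbimod A B) : gbimod_hom M M.
Proof. by exists id; split. Defined.

Definition gbimod_cmp (A B : gring) (M N P : gbimod A B)
  (g : gbimod_hom N P) (f : gbimod_hom M N) : gbimod_hom M P.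
Proof.
exists (sval g \o sval f).
case: g f => g [g1 g2 g3 g4] [f [f1 f2 f3 f4]]; split => /=.
- by move=> x y; rewrite f1 g1.
- by move=> a x; rewrite f2 g2.
- by move=> x b; rewrite f3 g3.
- by move=> i x /f4 /g4.
Defined.

Definition gbimod_cat (A B : gring) : category.
Proof.
by apply: (@Category (gbimod A B) (@gbimod_hom A B) (@gbimod_id A B)
  (@gbimod_cmp A B)); intros; apply: sval_inj.
Defined.

Lemma shift_grading (M : zmodType) (g : int -> M -> Prop) (r : int) :
  is_grading g -> is_grading (fun i => g (i - r)).
Proof.
move=> gg; have [D [DD Dg Did Dne _]] := grading_proj gg; split.
- by move=> i; apply: grading0.
- by move=> i x y; apply: gradingB.
- move=> x; have [l [hl ->]] := grading_span gg x.
  exists [seq (p.1 + r, p.2) | p <- l]; split; last by rewrite big_map.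
  by move=> p /mapP[q /hl hq ->] /=; rewrite addrK.
- apply: (@grading_proj_indep M (fun i => g (i - r)) (fun d => D (d - r))).
    by move=> d; apply: DD.
    by move=> d x; apply: Did.
  by move=> d e x gx ed; apply: Dne gx _ => /addIr.
Qed.

(** The component of degree [i] of [shift r M] is that of degree [i - r] of
    [M]. *)
Definition shift (A B : gring) (r : int) (M : gbimod A B) : gbimod A B.
Proof.
exists M lact ract (fun i => bm_deg (i - r)).
- exact: bm_bimodule.
- exact/shift_grading/bm_grading.
- by move=> i j a x ga gx; rewrite -addrA; apply: bm_degl.
- by move=> i j x b gx gb; rewrite addrAC; apply: bm_degr.
Defined.

Lemma dsum_grading (M N : zmodType) (g : int -> M -> Prop)
    (h : int -> N -> Prop) : is_grading g -> is_grading h ->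
  is_grading (fun i (x : M * N) => g i x.1 /\ h i x.2).
Proof.
move=> gg hh; split.
- by move=> i; split; apply: grading0.
- by move=> i x y [? ?] [? ?]; split; apply: gradingB.
- move=> [x y]; have [r [hr ->]] := grading_span gg x.
  have [s [hs ->]] := grading_span hh y.
  exists ([seq (p.1, (p.2, 0)) | p <- r] ++ [seq (p.1, (0, p.2)) | p <- s]).
  split=> [p|].
    rewrite mem_cat => /orP[] /mapP[q qr ->] /=; split.
    + exact: hr.
    + exact: grading0.
    + exact: grading0.
    + exact: hs.
  rewrite big_cat !big_map /=; apply/esym.
  have fst_morph : {morph (@fst M N) : a b / a + b} by [].
  have snd_morph : {morph (@snd M N) : a b / a + b} by [].
  rewrite [LHS]surjective_pairing /=.
  rewrite !(big_morph _ fst_morph (erefl : (0 : M * N).1 = 0)).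
  rewrite !(big_morph _ snd_morph (erefl : (0 : M * N).2 = 0)) /=.
  by congr pair; rewrite big1_eq ?addr0 ?add0r.
- move=> s f us gf s0 i si.
  have e1 : \sum_(i <- s) (f i).1 = 0.
    by have := congr1 fst s0; rewrite (big_morph (@fst M N) (id1 := 0) (op1 := +%R)).
  have e2 : \sum_(i <- s) (f i).2 = 0.
    by have := congr1 snd s0; rewrite (big_morph (@snd M N) (id1 := 0) (op1 := +%R)).
  rewrite [f i]surjective_pairing.
  rewrite (grading_indep gg us (fun i => proj1 (gf i)) e1 si).
  by rewrite (grading_indep hh us (fun i => proj2 (gf i)) e2 si).
Qed.

Definition dsum (A B : gring) (M N : gbimod A B) : gbimod A B.
Proof.
exists (M * N)%type (fun a x => (lact a x.1, lact a x.2))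
  (fun x b => (ract x.1 b, ract x.2 b))
  (fun i x => bm_deg i x.1 /\ bm_deg i x.2).
- have [? ? ? ? ? ? ? ? ?] := @bm_bimodule _ _ M.
  have [? ? ? ? ? ? ? ? ?] := @bm_bimodule _ _ N.
  split=> *; apply/eqP; rewrite -pair_eqE /=; apply/andP; split; apply/eqP;
    solve [auto].
- by apply: dsum_grading; apply: bm_grading.
- by move=> i j a x ga [? ?]; split; apply: bm_degl.
- by move=> i j x b [? ?] gb; split; apply: bm_degr.
Defined.

Definition gbimod0 (A B : gring) : gbimod A B.
Proof.
exists 'rV[int]_0 (fun _ x => x) (fun x _ => x) (fun _ _ => True).
- by split=> *; rewrite [LHS]thinmx0 [RHS]thinmx0.
- split=> // [x|s f _ _ _ i _]; last exact: thinmx0.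
  by exists [::]; split=> //; rewrite [LHS]thinmx0 [RHS]thinmx0.
- by [].
- by [].
Defined.

Definition dsums (A B : gring) (s : seq (gbimod A B)) : gbimod A B :=
  foldr (@dsum A B) (gbimod0 A B) s.

Definition direct_summand (A B : gring) (X M : gbimod A B) : Prop :=
  exists Y : gbimod A B, @isomorphic (gbimod_cat A B) M (dsum X Y).

Definition is_gring_hom (A B : gring) (f : A -> B) : Prop :=
  [/\ forall a b, f (a + b) = f a + f b, forall a b, f (a * b) = f a * f b,
      f 1 = 1 & forall i a, gr_deg i a -> gr_deg i (f a)].

Definition gring_hom (A B : gring) := {f : A -> B | is_gring_hom f}.

Definition restrict (A B A' B' : gring) (f : gring_hom A' A)
  (g : gring_hom B' B) (M : gbimod A B) : gbimod A' B'.
Proof.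
exists M (fun a x => lact (sval f a) x) (fun x b => ract x (sval g b)) bm_deg.
- case: f g => f [fD fM f1 _] [g [gD gM g1 _]] /=.
  have [? ? ? ? ? ? ? ? ?] := @bm_bimodule _ _ M.
  by split=> *; rewrite ?fD ?fM ?f1 ?gD ?gM ?g1.
- exact: bm_grading.
- by case: f => f [_ _ _ fdeg] i j a x /= /fdeg; apply: bm_degl.
- by case: g => g [_ _ _ gdeg] i j x b /= ? /gdeg; apply: bm_degr.
Defined.

Definition gring_id (A : gring) : gring_hom A A.
Proof. by exists id; split. Defined.

Definition regular_gbimod (A : gring) : gbimod A A.
Proof.
exists A (fun a x => a * x) (fun x b => x * b) gr_deg.
- split=> *; rewrite ?mulrDl ?mulrDr ?mulrA ?mul1r ?mulr1 //.
- exact: gr_grading.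
- exact: gr_degM.
- exact: gr_degM.
Defined.

Section Tensor.
Variables (A B C : gring) (M : gbimod A B) (N : gbimod B C).

(** A sequence of pairs [(x, y)] stands for the sum of the tensors [x (x) y]. *)
Inductive tcong : seq (M * N) -> seq (M * N) -> Prop :=
| tcong_refl s : tcong s s
| tcong_sym s t : tcong s t -> tcong t s
| tcong_trans s t u : tcong s t -> tcong t u -> tcong s u
| tcong_cat s s' t t' : tcong s s' -> tcong t t' -> tcong (s ++ t) (s' ++ t')
| tcong_catC s t : tcong (s ++ t) (t ++ s)
| tcong_zero y : tcong [:: (0, y)] [::]
| tcong_addl x x' y : tcong [:: (x + x', y)] [:: (x, y); (x', y)]
| tcong_addr x y y' : tcong [:: (x, y + y')] [:: (x, y); (x, y')]
| tcong_bal x b y : tcong [:: (ract x b, y)] [:: (x, lact b y)].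

Definition tcongb (s t : seq (M * N)) : bool := `[< tcong s t >].

Lemma tcongb_refl : reflexive tcongb.
Proof. by move=> s; apply/asboolP/tcong_refl. Qed.

Lemma tcongb_sym : ssrbool.symmetric tcongb.
Proof. by move=> s t; apply/asboolP/asboolP; apply: tcong_sym. Qed.

Lemma tcongb_trans : transitive tcongb.
Proof.
by move=> s t u /asboolP ts /asboolP su; apply/asboolP/(tcong_trans ts).
Qed.

Canonical tcong_equiv := EquivRel tcongb tcongb_refl tcongb_sym tcongb_trans.

Definition tensor := {eq_quot tcong_equiv}.
HB.instance Definition _ := Choice.on tensor.
HB.instance Definition _ := Quotient.on tensor.
HB.instance Definition _ := EqQuotient.on tensor.

Definition tpi (s : seq (M * N)) : tensor := \pi_tensor s.

Lemma tpiP s t : tpi s = tpi t <-> tcong s t.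
Proof.
split=> [/eqmodP/asboolP //|st].
by apply/eqmodP/asboolP.
Qed.

Lemma tensorW (P : tensor -> Prop) : (forall s, P (tpi s)) -> forall x, P x.
Proof. by move=> H x; rewrite -[x]reprK; apply: H. Qed.

Definition tzero : tensor := tpi [::].
Definition tadd (x y : tensor) : tensor := tpi (repr x ++ repr y).
Definition tmap (f : M * N -> M * N) (x : tensor) : tensor :=
  tpi [seq f p | p <- repr x].
Definition topp : tensor -> tensor := tmap (fun p => (- p.1, p.2)).

Lemma tcong_repr s : tcong (repr (tpi s)) s.
Proof. by apply/tpiP; rewrite /tpi reprK. Qed.

Lemma tadd_pi s t : tadd (tpi s) (tpi t) = tpi (s ++ t).
Proof. by apply/tpiP; apply: tcong_cat; apply: tcong_repr. Qed.

Lemma tmap_pi f : (forall s t, tcong s t -> tcong (map f s) (map f t)) ->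
  forall s, tmap f (tpi s) = tpi (map f s).
Proof. by move=> fP s; apply/tpiP/fP/tcong_repr. Qed.

Lemma topp_pi s : topp (tpi s) = tpi [seq (- p.1, p.2) | p <- s].
Proof.
have [? ? ? ? rDl ? ? ? ?] := @bm_bimodule _ _ M.
apply: tmap_pi => {s} s t; elim=> {s t} /=.
- by move=> s; apply: tcong_refl.
- by move=> s t _; apply: tcong_sym.
- by move=> s t u _ st _; apply: tcong_trans.
- by move=> s s' t t' _ ss _ tt; rewrite !map_cat; apply: tcong_cat.
- by move=> s t; rewrite !map_cat; apply: tcong_catC.
- by move=> y; rewrite oppr0; apply: tcong_zero.
- by move=> x x' y; rewrite opprD; apply: tcong_addl.
- by move=> x y y'; apply: tcong_addr.
- move=> x b y; have -> : - ract x b = ract (- x) b; last exact: tcong_bal.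
  apply: (@addrI _ (ract x b)); rewrite -rDl !subrr.
  by apply: (@addrI _ (ract 0 b)); rewrite -rDl !addr0.
Qed.

Fact tadd_assoc : associative tadd.
Proof.
elim/tensorW=> s; elim/tensorW=> t; elim/tensorW=> u.
by rewrite !tadd_pi catA.
Qed.

Fact tadd_comm : commutative tadd.
Proof.
elim/tensorW=> s; elim/tensorW=> t.
by rewrite !tadd_pi; apply/tpiP/tcong_catC.
Qed.

Fact tadd_0 : left_id tzero tadd.
Proof. by elim/tensorW=> s; rewrite tadd_pi. Qed.

Fact tadd_N : left_inverse tzero topp tadd.
Proof.
elim/tensorW=> s; rewrite topp_pi tadd_pi; apply/tpiP.
elim: s => [|[x y] s IHs] /=; first exact: tcong_refl.
rewrite -cat1s -[(x, y) :: s]cat1s.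
apply: (tcong_trans (tcong_cat (tcong_refl _) (tcong_catC _ _))).
rewrite -catA catA.
apply: (tcong_trans (tcong_cat (tcong_refl _)
  (tcong_trans (tcong_catC _ _) IHs))).
rewrite cats0; apply: (tcong_trans (tcong_sym (tcong_addl _ _ _))).
by rewrite addNr; apply: tcong_zero.
Qed.

HB.instance Definition _ :=
  GRing.isZmodule.Build tensor tadd_assoc tadd_comm tadd_0 tadd_N.

Definition tens (x : M) (y : N) : tensor := tpi [:: (x, y)].

Lemma tpi_cat s t : tpi (s ++ t) = tpi s + tpi t.
Proof. by rewrite -tadd_pi. Qed.

Lemma tpi_sum s : tpi s = \sum_(p <- s) tens p.1 p.2.
Proof.
elim: s => [|[x y] s IHs]; first by rewrite big_nil.
by rewrite big_cons -IHs -tpi_cat.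
Qed.

Lemma tensDl x x' y : tens (x + x') y = tens x y + tens x' y.
Proof. by rewrite -tpi_cat; apply/tpiP/tcong_addl. Qed.

Lemma tensDr x y y' : tens x (y + y') = tens x y + tens x y'.
Proof. by rewrite -tpi_cat; apply/tpiP/tcong_addr. Qed.

Lemma tens_bal x b y : tens (ract x b) y = tens x (lact b y).
Proof. exact/tpiP/tcong_bal. Qed.

Lemma tens0l y : tens 0 y = 0.
Proof. exact/tpiP/tcong_zero. Qed.

Lemma tens0r x : tens x 0 = 0.
Proof. by apply: (@addrI _ (tens x 0)); rewrite -tensDr !addr0. Qed.

Lemma tens_suml (I : Type) (r : seq I) (F : I -> M) y :
  tens (\sum_(i <- r) F i) y = \sum_(i <- r) tens (F i) y.
Proof.
by rewrite (big_morph (tens^~ y) (fun x x' => tensDl x x' y) (tens0l y)).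
Qed.

Lemma tens_sumr (I : Type) (r : seq I) x (F : I -> N) :
  tens x (\sum_(i <- r) F i) = \sum_(i <- r) tens x (F i).
Proof. by rewrite (big_morph (tens x) (tensDr x) (tens0r x)). Qed.

Lemma tensor_lift (T : zmodType) (h : M -> N -> T) :
  (forall x x' y, h (x + x') y = h x y + h x' y) ->
  (forall x y y', h x (y + y') = h x y + h x y') ->
  (forall x b y, h (ract x b) y = h x (lact b y)) ->
  exists H : tensor -> T,
    (forall x y, H (x + y) = H x + H y) /\ (forall x y, H (tens x y) = h x y).
Proof.
move=> hDl hDr hb; pose E (s : seq (M * N)) := \sum_(p <- s) h p.1 p.2.
have EP s t : tcong s t -> E s = E t.
  elim=> {s t} // [s t u _ -> _ -> //|s s' t t' _ ss _ tt|s t|y|x x' y|x y y'|x b y].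
  - by rewrite /E !big_cat /= -/(E s) -/(E t) ss tt.
  - by rewrite /E !big_cat /= addrC.
  - rewrite /E big_seq1 big_nil /=.
    by apply: (@addrI _ (h 0 y)); rewrite -hDl !addr0.
  - by rewrite /E big_seq1 !big_cons big_nil /= addr0.
  - by rewrite /E big_seq1 !big_cons big_nil /= addr0.
  - by rewrite /E !big_seq1 /=.
have Epi s : E (repr (tpi s)) = E s by apply/EP/tcong_repr.
exists (fun x => E (repr x)); split=> [|x y]; last by rewrite Epi /E big_seq1.
elim/tensorW=> s; elim/tensorW=> t.
by rewrite -tpi_cat !Epi /E big_cat.
Qed.

Definition tlact (a : A) : tensor -> tensor := tmap (fun p => (lact a p.1, p.2)).
Definition tract (x : tensor) (c : C) : tensor :=
  tmap (fun p => (p.1, ract p.2 c)) x.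

Lemma tlact_pi a s : tlact a (tpi s) = tpi [seq (lact a p.1, p.2) | p <- s].
Proof.
have [lDr ? ? ? ? ? ? ? lrA] := @bm_bimodule _ _ M.
apply: tmap_pi => {s} s t; elim=> {s t} /=.
- by move=> s; apply: tcong_refl.
- by move=> s t _; apply: tcong_sym.
- by move=> s t u _ st _; apply: tcong_trans.
- by move=> s s' t t' _ ss _ tt; rewrite !map_cat; apply: tcong_cat.
- by move=> s t; rewrite !map_cat; apply: tcong_catC.
- move=> y; have -> : lact a (0 : M) = 0; last exact: tcong_zero.
  by apply: (@addrI _ (lact a (0 : M))); rewrite -lDr !addr0.
- by move=> x x' y; rewrite lDr; apply: tcong_addl.
- by move=> x y y'; apply: tcong_addr.
- by move=> x b y; rewrite -lrA; apply: tcong_bal.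
Qed.

Lemma tract_pi s c : tract (tpi s) c = tpi [seq (p.1, ract p.2 c) | p <- s].
Proof.
have [? ? ? ? rDl ? ? ? lrA] := @bm_bimodule _ _ N.
apply: tmap_pi => {s} s t; elim=> {s t} /=.
- by move=> s; apply: tcong_refl.
- by move=> s t _; apply: tcong_sym.
- by move=> s t u _ st _; apply: tcong_trans.
- by move=> s s' t t' _ ss _ tt; rewrite !map_cat; apply: tcong_cat.
- by move=> s t; rewrite !map_cat; apply: tcong_catC.
- by move=> y; apply: tcong_zero.
- by move=> x x' y; apply: tcong_addl.
- by move=> x y y'; rewrite rDl; apply: tcong_addr.
- by move=> x b y; rewrite lrA; apply: tcong_bal.
Qed.

Lemma tens_bimodule : is_bimodule tlact tract.
Proof.
have [lDr lDl lM l1 _ _ _ _ _] := @bm_bimodule _ _ M.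
have [_ _ _ _ rDl rDr rM r1 _] := @bm_bimodule _ _ N.
split.
- move=> a; elim/tensorW=> s; elim/tensorW=> t.
  by rewrite -tpi_cat !tlact_pi map_cat tpi_cat.
- move=> a b; elim/tensorW=> s; rewrite !tlact_pi !tpi_sum !big_map /=.
  by rewrite -big_split; apply: eq_bigr => p _ /=; rewrite lDl tensDl.
- move=> a b; elim/tensorW=> s; rewrite !tlact_pi -map_comp; congr tpi.
  by apply: eq_map => p /=; rewrite lM.
- elim/tensorW=> s; rewrite !tlact_pi; congr tpi.
  by rewrite -[RHS]map_id; apply: eq_map => -[x y] /=; rewrite l1.
- elim/tensorW=> s; elim/tensorW=> t c.
  by rewrite -tpi_cat !tract_pi map_cat tpi_cat.
- elim/tensorW=> s a b; rewrite !tract_pi !tpi_sum !big_map /=.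
  by rewrite -big_split; apply: eq_bigr => p _ /=; rewrite rDr tensDr.
- elim/tensorW=> s a b; rewrite !tract_pi -map_comp; congr tpi.
  by apply: eq_map => p /=; rewrite rM.
- elim/tensorW=> s; rewrite !tract_pi; congr tpi.
  by rewrite -[RHS]map_id; apply: eq_map => -[x y] /=; rewrite r1.
- move=> a; elim/tensorW=> s c; rewrite !(tract_pi, tlact_pi) -!map_comp.
  by congr tpi; apply: eq_map.
Qed.

(** The component of degree [d] consists of the sums of tensors [x (x) y] with
    [x], [y] homogeneous of degrees adding up to [d]. *)
Definition tdeg (d : int) (x : tensor) : Prop :=
  exists s : seq (M * N), x = tpi s /\ forall p, p \in s ->
    exists i j, [/\ i + j = d, bm_deg i p.1 & bm_deg j p.2].

Lemma tdeg_span (x : tensor) : exists r : seq (int * tensor),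
  (forall p, p \in r -> tdeg p.1 p.2) /\ x = \sum_(p <- r) p.2.
Proof.
elim/tensorW: x => s; elim: s => [|[x y] s [r [hr er]]].
  by exists [::]; rewrite big_nil.
have [u [hu eu]] := grading_span (@bm_grading _ _ M) x.
have [v [hv ev]] := grading_span (@bm_grading _ _ N) y.
exists ([seq (p.1 + q.1, tens p.2 q.2) | p <- u, q <- v] ++ r); split.
  move=> p; rewrite mem_cat => /orP[|/hr //].
  move=> /allpairsP[[a b] /= [/hu ha /hv hb ->]] /=.
  exists [:: (a.2, b.2)]; split=> // p' /[!inE] /eqP-> /=.
  by exists a.1, b.1.
rewrite big_cat /= -er -cat1s tpi_cat; congr (_ + _).
rewrite big_allpairs_dep /= -/(tens x y) eu tens_suml; apply: eq_bigr => p _.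
by rewrite [in LHS]ev tens_sumr.
Qed.

Lemma tdeg_proj : exists D : int -> tensor -> tensor,
  [/\ forall d x y, D d (x + y) = D d x + D d y,
      forall d x, tdeg d x -> D d x = x &
      forall d e x, tdeg e x -> e <> d -> D d x = 0].
Proof.
have [_ _ _ _ rDl rDr _ _ _] := @bm_bimodule _ _ M.
have [lDr lDl _ _ _ _ _ _ _] := @bm_bimodule _ _ N.
have [P [PD Pg Pid Pne Psum]] := grading_proj (@bm_grading _ _ M).
have [Q [QD Qg Qid Qne _]] := grading_proj (@bm_grading _ _ N).
have [supp supp_P] := choice Psum.
have P0 d : P d 0 = 0 by apply: Pid; apply: grading0 (@bm_grading _ _ M) d.
have Q0 d : Q d 0 = 0 by apply: Qid; apply: grading0 (@bm_grading _ _ N) d.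
pose h d x y := \sum_(i <- supp x) tens (P i x) (Q (d - i) y).
have hE d x y (r : seq int) : uniq r -> {subset supp x <= r} ->
    h d x y = \sum_(i <- r) tens (P i x) (Q (d - i) y).
  move=> ur sub; have [us s0 _] := supp_P x.
  rewrite [RHS](bigID (mem (supp x))) /= [X in _ + X]big1; last first.
    by move=> i /s0 ->; rewrite tens0l.
  rewrite addr0 -big_filter; apply: perm_big; apply: uniq_perm => //.
    exact: filter_uniq.
  by move=> i; rewrite mem_filter; case: (boolP (i \in supp x)) => // /sub.
have hDl d x x' y : h d (x + x') y = h d x y + h d x' y.
  pose r := undup (supp (x + x') ++ supp x ++ supp x').
  have ur : uniq r by apply: undup_uniq.
  rewrite !(hE d _ y r) // -?big_split /=; last first.
  - by move=> i ix; rewrite mem_undup !mem_cat ix.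
  - by move=> i ix; rewrite mem_undup !mem_cat ix !orbT.
  - by move=> i ix; rewrite mem_undup !mem_cat ix !orbT.
  by apply: eq_bigr => i _; rewrite PD tensDl.
have hDr d x y y' : h d x (y + y') = h d x y + h d x y'.
  by rewrite -big_split; apply: eq_bigr => i _ /=; rewrite QD tensDr.
have h0l d y : h d 0 y = 0.
  by apply: (@addrI _ (h d 0 y)); rewrite -hDl !addr0.
have h0r d x : h d x 0 = 0.
  by apply: (@addrI _ (h d x 0)); rewrite -hDr !addr0.
have hhom d x y i j : bm_deg i x -> bm_deg j y ->
    h d x y = if i + j == d then tens x y else 0.
  move=> xi yj; rewrite (hE d x y (undup (i :: supp x))) ?undup_uniq //; last first.
    by move=> k kx; rewrite mem_undup inE kx orbT.
  rewrite (bigD1_seq i) ?undup_uniq ?mem_undup ?mem_head //=.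
  rewrite Pid // big1 ?addr0 => [|k ki]; last first.
    by rewrite (Pne _ i) ?tens0l // => ik; rewrite ik eqxx in ki.
  case: eqP => [<-|ne]; first by rewrite addrC addKr Qid.
  by rewrite (Qne _ j) ?tens0r // => je; apply: ne; rewrite je addrC subrK.
have hsuml d (r : seq (int * M)) y :
    h d (\sum_(p <- r) p.2) y = \sum_(p <- r) h d p.2 y.
  by rewrite (big_morph (h d ^~ y) (fun x x' => hDl d x x' y) (h0l d y)).
have hsumr d x (r : seq (int * N)) :
    h d x (\sum_(p <- r) p.2) = \sum_(p <- r) h d x p.2.
  by rewrite (big_morph (h d x) (hDr d x) (h0r d x)).
have r0 (b : B) : ract (0 : M) b = 0.
  by apply: (@addrI _ (ract (0 : M) b)); rewrite -rDl !addr0.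
have r0' (x : M) : ract x (0 : B) = 0.
  by apply: (@addrI _ (ract x (0 : B))); rewrite -rDr !addr0.
have l0 (b : B) : lact b (0 : N) = 0.
  by apply: (@addrI _ (lact b (0 : N))); rewrite -lDr !addr0.
have l0' (y : N) : lact (0 : B) y = 0.
  by apply: (@addrI _ (lact (0 : B) y)); rewrite -lDl !addr0.
have hbal d x b y : h d (ract x b) y = h d x (lact b y).
  have [u [hu ->]] := grading_span (@gr_grading B) b.
  rewrite (big_morph (ract x) (rDr x) (r0' x)).
  rewrite (big_morph (fun b => lact b y) (fun a b => lDl a b y) (l0' y)).
  rewrite (big_morph (h d ^~ y) (fun x x' => hDl d x x' y) (h0l d y)).
  rewrite (big_morph (h d x) (hDr d x) (h0r d x)).
  rewrite big_seq [RHS]big_seq; apply: eq_bigr => e /hu he.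
  have [v [hv ->]] := grading_span (@bm_grading _ _ M) x.
  rewrite (big_morph (ract^~ e.2) (fun x x' => rDl x x' e.2) (r0 e.2)).
  rewrite (big_morph (h d ^~ y) (fun x x' => hDl d x x' y) (h0l d y)) hsuml.
  rewrite big_seq [RHS]big_seq; apply: eq_bigr => p /hv hp.
  have [w [hw ->]] := grading_span (@bm_grading _ _ N) y.
  rewrite (big_morph (lact e.2) (lDr e.2) (l0 e.2)) hsumr.
  rewrite (big_morph (h d p.2) (hDr d p.2) (h0r d p.2)).
  rewrite big_seq [RHS]big_seq; apply: eq_bigr => q /hw hq.
  rewrite (hhom _ _ _ (p.1 + e.1) q.1) //; last exact: bm_degr.
  rewrite (hhom _ _ _ p.1 (e.1 + q.1)) //; last exact: bm_degl.
  by rewrite addrA tens_bal.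
have [D D_P] := choice (fun d => tensor_lift (hDl d) (hDr d) (hbal d)).
have DD d : {morph D d : x y / x + y} by case: (D_P d).
have D0 d : D d 0 = 0 by apply: (@addrI _ (D d 0)); rewrite -DD !addr0.
have Dhom d e x : tdeg e x -> D d x = if e == d then x else 0.
  move=> [s [-> hs]]; rewrite tpi_sum (big_morph (D d) (DD d) (D0 d)).
  rewrite (_ : (if _ then _ else _) =
    \sum_(p <- s) if e == d then tens p.1 p.2 else 0); last first.
    by case: ifP; rewrite ?big1_eq.
  rewrite big_seq [RHS]big_seq; apply: eq_bigr => p /hs[i [j [<- hi hj]]].
  by case: (D_P d) => _ ->; apply: hhom.
exists D; split=> //.
  by move=> d x /(Dhom d) ->; rewrite eqxx.
by move=> d e x /(Dhom d) -> /eqP/negPf ->.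
Qed.

Lemma tdeg_grading : is_grading tdeg.
Proof.
have [D [DD Did Dne]] := tdeg_proj; split.
- by move=> i; exists [::].
- move=> i _ _ [s [-> hs]] [t [-> ht]].
  exists (s ++ [seq (- p.1, p.2) | p <- t]); split.
    by rewrite tpi_cat -topp_pi.
  move=> p; rewrite mem_cat => /orP[/hs //|/mapP[q /ht[j [k [jk qj qk]]] ->]].
  by exists j, k; split=> //=; apply: gradingN qj; apply: bm_grading.
- exact: tdeg_span.
- exact: grading_proj_indep DD Did Dne.
Qed.

Definition tensor_gbimod : gbimod A C.
Proof.
exists tensor tlact tract tdeg.
- exact: tens_bimodule.
- exact: tdeg_grading.
- move=> i j a _ ga [s [-> hs]].
  exists [seq (lact a p.1, p.2) | p <- s]; split; first exact: tlact_pi.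
  move=> _ /mapP[p /hs[k [l [kl pk pl]]] ->]; exists (i + k), l.
  by split=> //=; [rewrite -addrA kl | apply: bm_degl].
- move=> i j _ c [s [-> hs]] gc.
  exists [seq (p.1, ract p.2 c) | p <- s]; split; first exact: tract_pi.
  move=> _ /mapP[p /hs[k [l [kl pk pl]]] ->]; exists k, (l + j).
  by split=> //=; [rewrite addrA kl | apply: bm_degr].
Defined.

End Tensor.

Section Presentation.
Variables (k : fieldType) (G : Type) (deg : G -> int).

Inductive term : Type :=
| Cst of k
| Gen of G
| Add of term & term
| Mul of term & term.

HB.instance Definition _ := gen_eqMixin term.
HB.instance Definition _ := gen_choiceMixin term.

(** [homog_term d t]: [t] is a linear combination of words of degree [d]. *)
Inductive homog_term : int -> term -> Prop :=
| homog_zero d : homog_term d (Cst 0)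
| homog_cst c : homog_term 0 (Cst c)
| homog_gen g : homog_term (deg g) (Gen g)
| homog_add d t u : homog_term d t -> homog_term d u -> homog_term d (Add t u)
| homog_mul d e t u : homog_term d t -> homog_term e u -> homog_term (d + e) (Mul t u).

Lemma homog_mulE d e f t u : homog_term d t -> homog_term e u -> d + e = f ->
  homog_term f (Mul t u).
Proof. by move=> ht hu <-; apply: homog_mul. Qed.

Variable rel : term -> term -> Prop.

(** The congruence generated by [rel] and the axioms of unital associative
    [k]-algebras. *)
Inductive cong : term -> term -> Prop :=
| cong_rel t u : rel t u -> cong t u
| cong_refl t : cong t t
| cong_sym t u : cong t u -> cong u t
| cong_trans t u v : cong t u -> cong u v -> cong t v
| cong_add t t' u u' : cong t t' -> cong u u' -> cong (Add t u) (Add t' u')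
| cong_mul t t' u u' : cong t t' -> cong u u' -> cong (Mul t u) (Mul t' u')
| cong_addA t u v : cong (Add t (Add u v)) (Add (Add t u) v)
| cong_addC t u : cong (Add t u) (Add u t)
| cong_add0 t : cong (Add (Cst 0) t) t
| cong_mulA t u v : cong (Mul t (Mul u v)) (Mul (Mul t u) v)
| cong_mul1 t : cong (Mul (Cst 1) t) t
| cong_mul0 t : cong (Mul (Cst 0) t) (Cst 0)
| cong_mulDl t u v : cong (Mul (Add t u) v) (Add (Mul t v) (Mul u v))
| cong_mulDr t u v : cong (Mul t (Add u v)) (Add (Mul t u) (Mul t v))
| cong_cstD a b : cong (Cst (a + b)) (Add (Cst a) (Cst b))
| cong_cstM a b : cong (Cst (a * b)) (Mul (Cst a) (Cst b))
| cong_cstC a t : cong (Mul (Cst a) t) (Mul t (Cst a)).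

Definition congb (t u : term) : bool := `[< cong t u >].

Lemma congb_refl : reflexive congb.
Proof. by move=> t; apply/asboolP/cong_refl. Qed.

Lemma congb_sym : ssrbool.symmetric congb.
Proof. by move=> t u; apply/asboolP/asboolP; apply: cong_sym. Qed.

Lemma congb_trans : transitive congb.
Proof.
by move=> t u v /asboolP tu /asboolP uv; apply/asboolP/(cong_trans tu).
Qed.

Canonical cong_equiv := EquivRel congb congb_refl congb_sym congb_trans.

Definition presalg := {eq_quot cong_equiv}.
HB.instance Definition _ := Choice.on presalg.
HB.instance Definition _ := Quotient.on presalg.
HB.instance Definition _ := EqQuotient.on presalg.

Definition ppi (t : term) : presalg := \pi_presalg t.

Lemma ppiP t u : ppi t = ppi u <-> cong t u.
Proof.
split=> [/eqmodP/asboolP //|tu].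
by apply/eqmodP/asboolP.
Qed.

Lemma presalgW (P : presalg -> Prop) : (forall t, P (ppi t)) -> forall x, P x.
Proof. by move=> H x; rewrite -[x]reprK; apply: H. Qed.

Lemma cong_repr t : cong (repr (ppi t)) t.
Proof. by apply/ppiP; rewrite /ppi reprK. Qed.

Definition padd (x y : presalg) : presalg := ppi (Add (repr x) (repr y)).
Definition pmul (x y : presalg) : presalg := ppi (Mul (repr x) (repr y)).
Definition popp (x : presalg) : presalg := ppi (Mul (Cst (- 1)) (repr x)).

Lemma padd_pi t u : padd (ppi t) (ppi u) = ppi (Add t u).
Proof. by apply/ppiP; apply: cong_add; apply: cong_repr. Qed.

Lemma pmul_pi t u : pmul (ppi t) (ppi u) = ppi (Mul t u).
Proof. by apply/ppiP; apply: cong_mul; apply: cong_repr. Qed.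

Lemma popp_pi t : popp (ppi t) = ppi (Mul (Cst (- 1)) t).
Proof. by apply/ppiP/cong_mul/cong_repr/cong_refl. Qed.

Fact padd_assoc : associative padd.
Proof.
elim/presalgW=> t; elim/presalgW=> u; elim/presalgW=> v.
by rewrite !padd_pi; apply/ppiP/cong_addA.
Qed.

Fact padd_comm : commutative padd.
Proof.
elim/presalgW=> t; elim/presalgW=> u.
by rewrite !padd_pi; apply/ppiP/cong_addC.
Qed.

Fact padd_0 : left_id (ppi (Cst 0)) padd.
Proof. by elim/presalgW=> t; rewrite padd_pi; apply/ppiP/cong_add0. Qed.

Fact padd_N : left_inverse (ppi (Cst 0)) popp padd.
Proof.
elim/presalgW=> t; rewrite popp_pi padd_pi; apply/ppiP.
apply: cong_trans (cong_mul0 t).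
have -> : Cst 0 = Cst (- 1 + 1) by rewrite addNr.
apply: cong_trans (cong_add (cong_refl _) (cong_sym (cong_mul1 _))) _.
apply: cong_trans (cong_sym (cong_mulDl _ _ _)) _.
exact: cong_mul (cong_sym (cong_cstD _ _)) (cong_refl _).
Qed.

HB.instance Definition _ :=
  GRing.isZmodule.Build presalg padd_assoc padd_comm padd_0 padd_N.

Fact pmul_assoc : associative pmul.
Proof.
elim/presalgW=> t; elim/presalgW=> u; elim/presalgW=> v.
by rewrite !pmul_pi; apply/ppiP/cong_mulA.
Qed.

Fact pmul_1l : left_id (ppi (Cst 1)) pmul.
Proof. by elim/presalgW=> t; rewrite pmul_pi; apply/ppiP/cong_mul1. Qed.

Fact pmul_1r : right_id (ppi (Cst 1)) pmul.
Proof.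
elim/presalgW=> t; rewrite pmul_pi; apply/ppiP.
exact: cong_trans (cong_sym (cong_cstC _ _)) (cong_mul1 _).
Qed.

Fact pmulDl : left_distributive pmul +%R.
Proof.
elim/presalgW=> t; elim/presalgW=> u; elim/presalgW=> v.
by rewrite -![_ + _]/(padd _ _) !(pmul_pi, padd_pi); apply/ppiP/cong_mulDl.
Qed.

Fact pmulDr : right_distributive pmul +%R.
Proof.
elim/presalgW=> t; elim/presalgW=> u; elim/presalgW=> v.
by rewrite -![_ + _]/(padd _ _) !(pmul_pi, padd_pi); apply/ppiP/cong_mulDr.
Qed.

HB.instance Definition _ :=
  GRing.Zmodule_isPzRing.Build presalg pmul_assoc pmul_1l pmul_1r pmulDl pmulDr.

Lemma ppiD t u : ppi (Add t u) = ppi t + ppi u.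
Proof. by rewrite -padd_pi. Qed.

Lemma ppiM t u : ppi (Mul t u) = ppi t * ppi u.
Proof. by rewrite -pmul_pi. Qed.

Definition presalg_deg (d : int) (x : presalg) : Prop :=
  exists2 t, homog_term d t & x = ppi t.

Hypothesis rel_homog : forall t u, rel t u -> exists2 d, homog_term d t & homog_term d u.

(** The action of a term on sequences, [t] of degree [d] raising degrees by
    [d]; it separates the homogeneous components. *)
Fixpoint tact (t : term) (f : int -> presalg) : int -> presalg :=
  match t with
  | Cst c => fun i => ppi (Cst c) * f i
  | Gen g => fun i => ppi (Gen g) * f (i - deg g)
  | Add t u => fun i => tact t f i + tact u f i
  | Mul t u => tact t (tact u f)
  end.

Lemma tact_eq t f g : f =1 g -> tact t f =1 tact t g.
Proof.
elim: t f g => /= [c|x|t IHt u IHu|t IHt u IHu] f g fg i; rewrite ?fg //.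
  by rewrite (IHt _ _ fg) (IHu _ _ fg).
by apply: IHt; apply: IHu.
Qed.

Lemma tactD t f g i : tact t (fun i => f i + g i) i = tact t f i + tact t g i.
Proof.
elim: t f g i => /= [c|x|t IHt u IHu|t IHt u IHu] f g i; rewrite ?mulrDr //.
  by rewrite IHt IHu addrACA.
by rewrite -IHt; apply: tact_eq => j; apply: IHu.
Qed.

Lemma ppi0 : ppi (Cst 0) = 0. Proof. by []. Qed.
Lemma ppi1 : ppi (Cst 1) = 1. Proof. by []. Qed.

Lemma ppi_central a x : ppi (Cst a) * x = x * ppi (Cst a).
Proof.
by elim/presalgW: x => t; rewrite -!ppiM; apply/ppiP/cong_cstC.
Qed.

Lemma tact_cst a t f i :
  tact t (fun j => ppi (Cst a) * f j) i = ppi (Cst a) * tact t f i.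
Proof.
elim: t f i => /= [c|x|t IHt u IHu|t IHt u IHu] f i.
- by rewrite mulrA -ppi_central -mulrA.
- by rewrite mulrA -ppi_central -mulrA.
- by rewrite IHt IHu mulrDr.
- by rewrite -IHt; apply: tact_eq => j; apply: IHu.
Qed.

Lemma tact_homog d t : homog_term d t -> forall f i, tact t f i = ppi t * f (i - d).
Proof.
elim=> {d t} /= [d|c|g|d t u _ IHt _ IHu|d e t u _ IHt _ IHu] f i //.
- by rewrite ppi0 !mul0r.
- by rewrite subr0.
- by rewrite ppiD IHt IHu mulrDl.
- by rewrite IHt IHu ppiM mulrA opprD addrA.
Qed.

Lemma tact_cong t u : cong t u -> forall f, tact t f =1 tact u f.
Proof.
elim=> {t u} /=.
- move=> t u /[dup] /rel_homog[d ht hu] tu f i.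
  by rewrite !(tact_homog ht, tact_homog hu); congr (_ * _); apply/ppiP/cong_rel.
- by [].
- by move=> t u _ IH f i; rewrite IH.
- by move=> t u v _ IH1 _ IH2 f i; rewrite IH1 IH2.
- by move=> t t' u u' _ IH1 _ IH2 f i; rewrite IH1 IH2.
- by move=> t t' u u' _ IH1 _ IH2 f i; rewrite IH1; apply: tact_eq.
- by move=> t u v f i; rewrite addrA.
- by move=> t u f i; rewrite addrC.
- by move=> t f i; rewrite ppi0 mul0r add0r.
- by [].
- by move=> t f i; rewrite ppi1 mul1r.
- by move=> t f i; rewrite ppi0 !mul0r.
- by [].
- by move=> t u v f i; apply: tactD.
- by move=> a b f i; rewrite -mulrDl -ppiD; congr (_ * _); apply/ppiP/cong_cstD.
- by move=> a b f i; rewrite mulrA -ppiM; congr (_ * _); apply/ppiP/cong_cstM.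
- by move=> a t f i; rewrite tact_cst.
Qed.

Lemma presalg_grading : is_grading presalg_deg.
Proof.
split.
- by move=> i; exists (Cst 0); [apply: homog_zero|].
- move=> i _ _ [t ht ->] [u hu ->].
  exists (Add t (Mul (Cst (- 1)) u)); last by rewrite ppiD -popp_pi.
  by apply: homog_add => //; rewrite -[i]add0r; apply: homog_mul => //; constructor.
- elim/presalgW; elim=> [c|g|t [r [hr er]] u [s [hs es]]|t [r [hr er]] u [s [hs es]]].
  + exists [:: (0, ppi (Cst c))]; rewrite big_seq1; split=> // p /[!inE] /eqP->.
    by exists (Cst c) => //; constructor.
  + exists [:: (deg g, ppi (Gen g))]; rewrite big_seq1; split=> // p /[!inE] /eqP->.
    by exists (Gen g) => //; constructor.
  + exists (r ++ s); rewrite big_cat ppiD /= -er -es; split=> // p.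
    by rewrite mem_cat => /orP[/hr|/hs].
  + exists [seq (p.1 + q.1, p.2 * q.2) | p <- r, q <- s]; split.
      move=> p /allpairsP[[a b] /= [/hr[t' ht eqt] /hs[u' hu equ] ->]] /=.
      by exists (Mul t' u'); [constructor | rewrite eqt equ ppiM].
    by rewrite big_allpairs_dep ppiM er es mulr_suml; apply: eq_bigr => p _ /=;
       rewrite mulr_sumr.
- pose one (i : int) : presalg := if i == 0 then 1 else 0.
  pose D d (x : presalg) := tact (repr x) one d.
  have Dpi d t : D d (ppi t) = tact t one d by apply/tact_cong/cong_repr.
  have Dhom d e x : presalg_deg e x -> D d x = if e == d then x else 0.
    move=> [t ht ->]; rewrite Dpi (tact_homog ht) /one subr_eq0 eq_sym.
    by case: eqP => _; rewrite ?mulr1 ?mulr0.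
  apply: (@grading_proj_indep _ _ D).
  + by move=> d; elim/presalgW=> t; elim/presalgW=> u; rewrite -ppiD !Dpi.
  + by move=> d x /(Dhom d) ->; rewrite eqxx.
  + by move=> d e x /(Dhom d) -> /eqP/negPf ->.
Qed.

Definition presented : gring.
Proof.
exists presalg presalg_deg; first exact: presalg_grading.
- by exists (Cst 1) => //; constructor.
- move=> i j _ _ [t ht ->] [u hu ->].
  by exists (Mul t u); [constructor | rewrite ppiM].
Defined.

End Presentation.

(** [lo j] and [hi j] are the elements of ['I_n] with values [j] and [j+1]. *)

Definition lo (n : nat) (j : 'I_n.-1) : 'I_n := widen_ord (leq_pred n) j.

Lemma hi_subproof (n : nat) (j : 'I_n.-1) : (j.+1 < n)%N.
Proof. by rewrite -ltn_predRL. Qed.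

Definition hi (n : nat) (j : 'I_n.-1) : 'I_n := Ordinal (hi_subproof j).

(** Indices start at 0: [genE i], [genY i], [genPsi j] are e_(i+1), y_(i+1)
    and psi_(j+1). *)
Inductive Wgen (n : nat) : Type :=
| genE of 'I_n.+1
| genY of 'I_n.+1
| genPsi of 'I_n.

Definition Wdeg (n : nat) (g : Wgen n) : int :=
  match g with genE _ => 0 | genY _ => 2 | genPsi _ => 1 end.

Section WRelations.
Variables (k : fieldType) (n : nat).

Local Notation tm := (term k (Wgen n)).
Local Notation "0" := (Cst _ 0 : tm).
Local Notation "1" := (Cst _ 1 : tm).
Local Notation "t + u" := (Add t u).
Local Notation "t * u" := (Mul t u).
Local Notation "t - u" := (Add t (Mul (Cst _ (- 1)%R) u)).
Local Notation e i := (Gen k (genE i) : tm).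
Local Notation y i := (Gen k (genY i) : tm).
Local Notation psi j := (Gen k (genPsi j) : tm).
Local Notation lo j := (@lo n.+1 j).
Local Notation hi j := (@hi n.+1 j).

Inductive Wrel : tm -> tm -> Prop :=
| W_ee (i j : 'I_n.+1) : Wrel (e i * e j) (if i == j then e i else 0)
| W_e1 : Wrel (\big[@Add k (Wgen n)/0]_(i < n.+1) e i) 1
| W_ye (j i : 'I_n.+1) : Wrel (y j * e i) (e i * y j)
| W_yy (j l : 'I_n.+1) : Wrel (y j * y l) (y l * y j)
| W_psie0 (j : 'I_n) (i : 'I_n.+1) : i != lo j -> i != hi j ->
    Wrel (psi j * e i) 0
| W_psie_lo (j : 'I_n) : Wrel (psi j * e (lo j)) (e (hi j) * psi j)
| W_psie_hi (j : 'I_n) : Wrel (psi j * e (hi j)) (e (lo j) * psi j)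
| W_psipsi (j l : 'I_n) : (j.+1 < l)%N || (l.+1 < j)%N ->
    Wrel (psi j * psi l) (psi l * psi j)
| W_psiy (j : 'I_n) (l : 'I_n.+1) : l != lo j -> l != hi j ->
    Wrel (psi j * y l) (y l * psi j)
| W_psiy_lo (j : 'I_n) : Wrel (psi j * y (lo j)) (y (hi j) * psi j)
| W_ypsi_lo (j : 'I_n) : Wrel (y (lo j) * psi j) (psi j * y (hi j))
| W_psi2_lo (j : 'I_n) :
    Wrel (psi j * psi j * e (lo j)) ((y (lo j) - y (hi j)) * e (lo j))
| W_psi2_hi (j : 'I_n) :
    Wrel (psi j * psi j * e (hi j)) ((y (hi j) - y (lo j)) * e (hi j))
| W_braid (j l : 'I_n) : l = j.+1 :> nat ->
    Wrel (psi j * psi l * psi j) (psi l * psi j * psi l)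
| W_cyc : Wrel (e ord0) 0.

Lemma Wrel_homog (t u : tm) : Wrel t u ->
  exists2 d, homog_term (@Wdeg n) d t & homog_term (@Wdeg n) d u.
Proof.
have hE i : homog_term (@Wdeg n) (Posz 0) (e i) by apply: (homog_gen _ _ (genE i)).
have hY i : homog_term (@Wdeg n) (Posz 2) (y i) by apply: (homog_gen _ _ (genY i)).
have hP j : homog_term (@Wdeg n) (Posz 1) (psi j) by apply: (homog_gen _ _ (genPsi j)).
have hB a b : homog_term (@Wdeg n) (Posz 2) (y a - y b).
  apply: homog_add (hY _) _.
  exact: homog_mulE (homog_cst _ _) (hY _) erefl.
case=> {t u}.
- move=> i j; exists (Posz 0); first exact: homog_mulE (hE _) (hE _) erefl.
  by case: ifP => // _; constructor.
- exists (Posz 0); last by constructor.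
  by apply: big_ind => // *; constructor.
- move=> j i; exists (Posz 2); first exact: homog_mulE (hY _) (hE _) erefl.
  exact: homog_mulE (hE _) (hY _) erefl.
- by move=> j l; exists (Posz 4); apply: homog_mulE (hY _) (hY _) erefl.
- move=> j i _ _; exists (Posz 1); last by constructor.
  exact: homog_mulE (hP _) (hE _) erefl.
- move=> j; exists (Posz 1); first exact: homog_mulE (hP _) (hE _) erefl.
  exact: homog_mulE (hE _) (hP _) erefl.
- move=> j; exists (Posz 1); first exact: homog_mulE (hP _) (hE _) erefl.
  exact: homog_mulE (hE _) (hP _) erefl.
- by move=> j l _; exists (Posz 2); apply: homog_mulE (hP _) (hP _) erefl.
- move=> j l _ _; exists (Posz 3); first exact: homog_mulE (hP _) (hY _) erefl.
  exact: homog_mulE (hY _) (hP _) erefl.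
- move=> j; exists (Posz 3); first exact: homog_mulE (hP _) (hY _) erefl.
  exact: homog_mulE (hY _) (hP _) erefl.
- move=> j; exists (Posz 3); first exact: homog_mulE (hY _) (hP _) erefl.
  exact: homog_mulE (hP _) (hY _) erefl.
- move=> j; exists (Posz 2); last exact: homog_mulE (hB _ _) (hE _) erefl.
  exact: homog_mulE (homog_mulE (hP _) (hP _) erefl) (hE _) erefl.
- move=> j; exists (Posz 2); last exact: homog_mulE (hB _ _) (hE _) erefl.
  exact: homog_mulE (homog_mulE (hP _) (hP _) erefl) (hE _) erefl.
- move=> j l _; exists (Posz 3);
    exact: homog_mulE (homog_mulE (hP _) (hP _) erefl) (hP _) erefl.
- by exists (Posz 0) => //; constructor.
Qed.

Definition W : gring := presented Wrel_homog.

End WRelations.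

Section Soergel.
Variables (k : fieldType) (n : nat).

(** The element [i : 'I_n.-1] of [I] stands for the simple transposition
    s_(i+1) = (i+1, i+2). *)
Definition parabolic (I : {set 'I_n.-1}) : {set 'S_n} :=
  <<[set tperm (lo i) (hi i) | i in I]>>%g.

Definition invariant (I : {set 'I_n.-1}) : {pred {mpoly k[n]}} :=
  fun p => [forall (s | s \in parabolic I), msym s p == p].

Lemma invariantP I p :
  reflect (forall s, s \in parabolic I -> msym s p = p) (p \in invariant I).
Proof.
apply: (iffP forall_inP) => H s sI; first exact/eqP/H.
by apply/eqP/H.
Qed.

Lemma invariant_subring I : subring_closed (invariant I).
Proof.
split.
- by apply/invariantP => s _; rewrite msym1.
- move=> p q /invariantP pI /invariantP qI; apply/invariantP => s sI.
  by rewrite msymB pI // qI.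
- move=> p q /invariantP pI /invariantP qI; apply/invariantP => s sI.
  by rewrite msymM pI // qI.
Qed.

HB.instance Definition _ I :=
  GRing.isSubringClosed.Build {mpoly k[n]} (invariant I) (invariant_subring I).

Record invring (I : {set 'I_n.-1}) :=
  InvRing { inv_val :> {mpoly k[n]}; _ : inv_val \in invariant I }.

HB.instance Definition _ I := [isSub for @inv_val I].
HB.instance Definition _ I := [Choice of invring I by <:].
HB.instance Definition _ I := [SubChoice_isSubComNzRing of invring I by <:].

(** [p] is homogeneous of degree [i], the variables having degree 2. *)
Definition pdeg (i : int) (p : {mpoly k[n]}) : Prop :=
  forall m, m \in msupp p -> i = (2 * mdeg m)%:Z.

Lemma pdeg_homog (d : nat) p : p \is d.-homog -> pdeg (2 * d)%:Z p.
Proof. by move=> /dhomogP H m /H <-. Qed.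

Lemma pdegM i j p q : pdeg i p -> pdeg j q -> pdeg (i + j) (p * q).
Proof.
move=> hp hq m /msuppM_le/allpairsP[[m1 m2] /= [/hp -> /hq -> ->]].
by rewrite mdegD mulnDr.
Qed.

Lemma pdeg_pihomog d i p : pdeg i p ->
  pihomog mdeg d p = if i == (2 * d)%:Z then p else 0.
Proof.
move=> hp; rewrite pihomogE; case: eqP => [id|nid]; last first.
  rewrite big_seq_cond big_pred0 // => m; apply/negP => /andP[/hp mp /eqP md].
  by apply: nid; rewrite mp md.
rewrite [RHS](mpolyE p) big_seq_cond [RHS]big_seq; apply: eq_bigl => m.
case: (boolP (m \in msupp p)) => //= /hp; rewrite id => -[] /eqP.
by rewrite eqn_mul2l /= eq_sym => ->.
Qed.

Lemma pihomog_invariant I d p :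
  p \in invariant I -> pihomog mdeg d p \in invariant I.
Proof.
by move=> /invariantP H; apply/invariantP => s /H; rewrite msym_pihomog => ->.
Qed.

Definition inv_comp I d (p : invring I) : invring I :=
  InvRing (pihomog_invariant d (valP p)).

Lemma inv_grading I : is_grading (fun i (p : invring I) => pdeg i (val p)).
Proof.
have sumE (J : Type) (r : seq J) (F : J -> invring I) :
    val (\sum_(i <- r) F i) = \sum_(i <- r) val (F i) by apply: raddf_sum.
split.
- by move=> i m; rewrite msupp0.
- move=> i p q hp hq m /msuppB_le; rewrite mem_cat.
  by move=> /orP[/hp|/hq].
- move=> p; pose r := iota 0 (mmeasure mdeg (val p)).
  exists [seq ((2 * d)%:Z, inv_comp d p) | d <- r]; split.
    by move=> _ /mapP[d _ ->] /=; apply/pdeg_homog/pihomogP.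
  apply: val_inj; rewrite big_map sumE /=.
  rewrite [LHS](pihomog_partitionE (mf := mdeg) (leqnn _)).
  by rewrite -(big_mkord xpredT (fun d => pihomog mdeg d (val p))) /index_iota subn0.
- pose D (i : int) (p : invring I) : invring I :=
    if i is Posz m then if odd m then 0 else inv_comp m./2 p else 0.
  have Dhom d e (p : invring I) : pdeg e (val p) -> D d p = if e == d then p else 0.
    move=> hp; apply: val_inj; rewrite [RHS]fun_if.
    have p0 : (forall m : nat, e <> (2 * m)%:Z) -> val p = 0.
      move=> H; apply/eqP; rewrite -msupp_eq0; case E: (msupp _) => [//|m s].
      by case: (H (mdeg m)); apply: hp; rewrite E mem_head.
    case: d => [d|d] /=; last first.
      case: eqP => // ed; by rewrite p0 // => m; rewrite ed.
    have [od|ev] := boolP (odd d).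
      case: eqP => // ed; rewrite p0 // => m; rewrite ed => -[] dE.
      by move: od; rewrite dE oddM.
    by rewrite /= (pdeg_pihomog _ hp) mul2n even_halfK.
  apply: (@grading_proj_indep (invring I) (fun i p => pdeg i (val p)) D).
  + move=> [d|d] p q; rewrite /D ?addr0 //; case: ifP; rewrite ?addr0 // => _.
    by apply: val_inj; rewrite /= pihomogD.
  + by move=> d p /(Dhom d) ->; rewrite eqxx.
  + by move=> d e p /(Dhom d) -> /eqP/negPf ->.
Qed.

Definition RI (I : {set 'I_n.-1}) : gring.
Proof.
exists (invring I) (fun i p => pdeg i (val p)); first exact: inv_grading.
- by move=> m; rewrite msupp1 inE => /eqP->; rewrite mdeg0.
- by move=> i j a b; apply: pdegM.
Defined.

Lemma invariantS (I J : {set 'I_n.-1}) : I \subset J ->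
  {subset invariant J <= invariant I}.
Proof.
move=> IJ p /invariantP pJ; apply/invariantP => s sI; apply: pJ.
by apply: subsetP s sI; apply: genS; apply: imsetS.
Qed.

Definition RI_incl (I J : {set 'I_n.-1}) (IJ : I \subset J) :
  gring_hom (RI J) (RI I).
Proof.
exists (fun p : invring J => InvRing (invariantS IJ (valP p)) : invring I).
by split=> // *; apply: val_inj.
Defined.

(** [bott_samelson I M]: [M] is one of the (R^I, R^J)-bimodules
    R^I1 (x)_(R^J1) R^I2 (x)_(R^J2) ... R^Im, with I = I1 and J = Im. *)
Inductive bott_samelson (J : {set 'I_n.-1}) :
  forall I : {set 'I_n.-1}, gbimod (RI I) (RI J) -> Prop :=
| BS_one : bott_samelson (regular_gbimod (RI J))
| BS_cons (I K I' : {set 'I_n.-1}) (IK : I \subset K) (I'K : I' \subset K)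
    (M : gbimod (RI I') (RI J)) : bott_samelson M ->
    bott_samelson (tensor_gbimod
      (restrict (gring_id (RI I)) (RI_incl IK) (regular_gbimod (RI I)))
      (restrict (RI_incl I'K) (gring_id (RI J)) M)).

Definition is_soergel (I J : {set 'I_n.-1}) (X : gbimod (RI I) (RI J)) : Prop :=
  exists s : seq (gbimod (RI I) (RI J)),
    (forall i, (i < size s)%N -> exists (r : int) (M : gbimod (RI I) (RI J)),
      bott_samelson M /\
      direct_summand (nth (gbimod0 (RI I) (RI J)) s i) (shift r M)) /\
    @isomorphic (gbimod_cat (RI I) (RI J)) X (dsums s).

Definition soergel_cat (I J : {set 'I_n.-1}) : category :=
  @full_sub (gbimod_cat (RI I) (RI J)) (@is_soergel I J).

(** The element [i] stands for the index i+1, so this is {2, ..., n-1}. *)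
Definition hat1 : {set 'I_n.-1} := [set i : 'I_n.-1 | (0 < i)%N].

End Soergel.

(* Main.v *)
Require Import Defs.
From HB Require Import structures.
From mathcomp Require Import all_boot all_order all_fingroup all_algebra.
From mathcomp Require Import generic_quotient mpoly boolp ring zify.
Require Import Defs.

(** Number the vertices, strands and variables from 0, and let [f_j] be
    [prod_(l < j) (z - x_l)].

    The algebra [W] is an algebra over [R[z]]: the dot on the [l]th red strand
    defines a central element [x_l], and the dot on the blue strand a central
    element [z]. Its idempotents [e_0, ..., e_n] are the vertices of a line; [psi_i]
    connects [i] and [i+1] in both directions, and [psi_i^2 = z - x_i]. So [e_i W e_j]
    is a cyclic [R[z]]-module generated by the shortest path ([path_span]), and it is
    killed by [f_min(i,j)], because [e_0 = 0].

    On the other side, symmetric polynomials act in the same way from the left and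
    from the right on the bimodules in question. Such a central bimodule is the same
    as a module over [R[z]] killed by [f_n]: right multiplication by the first
    variable is [z], and [R^hat1] is generated by this variable over the symmetric
    polynomials ([ract_kappa]).

    The functors are explicit. One takes a module [M] to its last vertex [e_n M]
    ([phi_gbimod]). The other takes a bimodule [X] to the sum over [i] of the kernels
    of [f_i] on [X], where [psi_i] goes up by inclusion and down by multiplication by
    [z - x_i] ([psi_gmod]). The last vertex of the module attached to [X] is [X], and
    following the paths to the last vertex gives a natural map [eta] from [M] to the
    module attached to [e_n M].

    What remains is to match the two full subcategories, and sums of cyclic objects
    do this: sums of shifts of [R[z]/f_j] on one side ([based]), of [W e_j] on the
    other ([wbased]). The functors exchange them ([psi_wbased], [phi_based]), and
    [eta] is an isomorphism on the latter ([eta_bij]): both are determined by which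
    products [prod_(i <= l < j) (z - x_l)] divide the coefficients.

    Sums of modules [W e_j] are projective ([wb_gproj]), and every finitely generated
    graded projective module is one ([gproj_wbased]): [W] lives in nonnegative
    degrees, and its part of degree 0 is spanned by the [e_i], so that a minimal
    family of homogeneous generators is a basis.

    Each [R[z]/f_j] with [j > 0] is a Bott-Samelson bimodule ([cyclic_bott_samelson]).
    Conversely every Bott-Samelson bimodule is a summand of a sum of cyclic ones
    ([bott_samelson_summand]). Sums of cyclic bimodules are clearly preserved by
    induction ([based_tensor]). A restriction from [R] to [R^K] is a chain of
    restrictions that each add to the group one reflection, at the left end [a] of an
    orbit ([parabolic_ind]); in such a step the larger ring of invariants is free over
    the smaller one on powers of [x_a], by Newton interpolation ([interpolate]), and a
    cyclic module splits into cyclic modules ([gen_rel], [based_step]). A restriction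
    from [R^I] to [R^K] is a summand of one from [R], since [R^I] is a summand of [R]
    ([retract_restrict]). *)

Set Implicit Arguments.
Unset Strict Implicit.
Unset Printing Implicit Defensive.

Import GRing.Theory.

Local Open Scope ring_scope.


(** * Interpolation at the variables *)

Section Newton.
Variables (k : fieldType) (n : nat).
Local Notation R := {mpoly k[n]}.
Implicit Types (p q : R) (r s : 'I_n).

Definition subst r s (p : R) : R :=
  p \mPo [tuple if i == r then 'X_s else 'X_i | i < n].

HB.instance Definition _ r s := GRing.RMorphism.copy (subst r s)
  (comp_mpoly [tuple if i == r then 'X_s else 'X_i | i < n]).

Lemma substX r s i : subst r s 'X_i = if i == r then 'X_s else 'X_i.
Proof. by rewrite /subst comp_mpolyXU -tnth_nth tnth_mktuple. Qed.

Lemma mpoly_alg_ind (P : R -> Prop) :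
  (forall c, P c%:MP) -> (forall i, P 'X_i) ->
  (forall p q, P p -> P q -> P (p + q)) ->
  (forall p q, P p -> P q -> P (p * q)) -> forall p, P p.
Proof.
move=> PC PX PD PM; apply: mpolyind => [|c m p _ _ Pp].
  by rewrite -mpolyC0.
apply: PD => //; rewrite -mul_mpolyC; apply: (PM) => //.
rewrite mpolyXE_id; apply: (big_ind P) => [||i _]; [by rewrite -mpolyC1 | exact: PM |].
elim: (m i) => [|e Pe]; first by rewrite expr0 -mpolyC1.
by rewrite exprS; apply: PM.
Qed.

Lemma substC r s c : subst r s c%:MP = c%:MP.
Proof. by rewrite /subst comp_mpolyC. Qed.

Lemma subst_dvd r s p : exists q, p = subst r s p + ('X_r - 'X_s) * q.
Proof.
elim/mpoly_alg_ind: p => [c|i|p q [p' ep] [q' eq]|p q [p' ep] [q' eq]].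
- by exists 0; rewrite substC mulr0 addr0.
- rewrite substX; case: eqP => [->|_]; last by exists 0; rewrite mulr0 addr0.
  by exists 1; rewrite mulr1 addrC subrK.
- exists (p' + q'); rewrite rmorphD /= mulrDr addrACA; congr (_ + _) => //.
- exists (p' * subst r s q + subst r s p * q' + ('X_r - 'X_s) * (p' * q')).
  rewrite rmorphM /= {1}ep {1}eq; ring.
Qed.

Lemma mX_inj r s : 'X_r = 'X_s :> R -> r = s.
Proof.
move/(congr1 (fun p : R => p@_U_(r))); rewrite !mcoeffX eqxx.
have [/(congr1 (fun m : 'X_{1..n} => m r))|_ /eqP] := eqVneq U_(s)%MM U_(r)%MM.
  by rewrite !mnm1E eqxx; case: eqP.
by rewrite oner_eq0.
Qed.

Lemma mXB_neq0 r s : r != s -> 'X_r - 'X_s != 0 :> R.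
Proof. by apply: contraNneq => /eqP; rewrite subr_eq0 => /eqP/mX_inj->. Qed.

Lemma prod_dvd r (L : seq 'I_n) p : uniq L -> r \notin L ->
  (forall s, s \in L -> subst r s p = 0) ->
  exists q, p = (\prod_(s <- L) ('X_r - 'X_s)) * q.
Proof.
elim: L p => [|s L IH] p /=; first by exists p; rewrite big_nil mul1r.
move=> /andP[sL uL]; rewrite inE negb_or => /andP[rs rL] p0.
have [q eq] := subst_dvd r s p; rewrite p0 ?mem_head // add0r in eq.
have [t tL|q' eq'] := IH q uL rL; last first.
  by exists q'; rewrite eq eq' big_cons mulrA.
have := p0 t; rewrite inE tL orbT eq rmorphM rmorphB /= !substX eqxx => /(_ isT).
rewrite eq_sym (negPf rs) => /eqP; rewrite mulf_eq0 => /orP[|/eqP //].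
by rewrite (negPf (mXB_neq0 _)) //; apply: contraNneq sL => <-.
Qed.

Lemma horner_uniq (L : seq 'I_n) (P Q : {poly R}) : uniq L ->
  (size P <= size L)%N -> (size Q <= size L)%N ->
  (forall r, r \in L -> P.['X_r] = Q.['X_r]) -> P = Q.
Proof.
move=> uL sP sQ PQ; apply/eqP; rewrite -subr_eq0; apply/eqP/eqP.
apply: contraT => nz; have us : uniq [seq 'X_r : R | r <- L].
  by rewrite map_inj_uniq // => r s /mX_inj.
have sPQ : (size (P - Q)%R <= size L)%N.
  by apply: leq_trans (size_polyD _ _) _; rewrite size_polyN geq_max sP.
have /(max_poly_roots nz)/(_ us) : all (root (P - Q)) [seq 'X_r : R | r <- L].
  by apply/allP => _ /mapP[r rL ->]; rewrite rootE !hornerE PQ // subrr.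
by rewrite size_map ltnNge sPQ.
Qed.

(** Newton interpolation needs no denominators: the divided differences are
    polynomials because [v r] and [v s] agree modulo [x_r - x_s]. *)
Lemma newton (L : seq 'I_n) (v : 'I_n -> R) : uniq L ->
  (forall r s, r \in L -> s \in L -> subst r s (v r - v s) = 0) ->
  exists2 P : {poly R}, (size P <= size L)%N &
    forall r, r \in L -> P.['X_r] = v r.
Proof.
elim: L => [|r L IH] /=; first by exists 0; rewrite ?size_poly0.
move=> /andP[rL uL] hv; have [a b aL bL|P sP PE] := IH uL.
  by apply: hv; rewrite inE ?aL ?bL orbT.
have [s sL|c ec] := prod_dvd (p := v r - P.['X_r]) uL rL.
  have := hv r s; rewrite !inE eqxx sL orbT => /(_ isT isT) H.
  have -> : v r - P.['X_r] = (v r - v s) + (P.['X_s] - P.['X_r]).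
    by rewrite (PE s) // addrA subrK.
  rewrite rmorphD /= H add0r rmorphB /=.
  rewrite -!horner_map /= !substX eqxx; have := rL.
  by case: eqP => [sr|_ _]; rewrite ?subrr // -sr sL.
exists (P + c *: \prod_(s <- L) ('X - ('X_s)%:P)).
  apply: leq_trans (size_polyD _ _) _; rewrite geq_max (leq_trans sP) //=.
  by apply: leq_trans (size_scale_leq _ _) _; rewrite size_prod_XsubC.
move=> s; rewrite inE hornerD hornerZ horner_prod => /orP[/eqP->|sL].
  rewrite (eq_bigr (fun s => 'X_r - 'X_s)) => [|t _]; last by rewrite hornerXsubC.
  by rewrite mulrC -ec addrC subrK.
have -> : \prod_(t <- L) ('X - ('X_t)%:P : {poly R}).['X_s] = 0.
  by apply/eqP; rewrite prodf_seq_eq0; apply/hasP; exists s => //=;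
    rewrite hornerXsubC subrr.
by rewrite mulr0 addr0 PE.
Qed.

End Newton.

(** * Invariants of a parabolic subgroup and of the stabilizer of a point *)

Section Block.
Variables (k : fieldType) (n : nat).
Local Notation R := {mpoly k[n]}.
Implicit Types (K I : {set 'I_n.-1}) (p q : R).

Definition refl (j : 'I_n.-1) : 'S_n := tperm (lo j) (hi j).

Lemma invariant_refl K p :
  (forall j, j \in K -> msym (refl j) p = p) -> p \in Defs.invariant K.
Proof.
move=> pK; pose G := [set s : 'S_n | msym s p == p].
have gG : group_set G.
  apply/group_setP; split; first by rewrite inE msym1m.
  by move=> s t /[!inE] /eqP sp /eqP tp; rewrite msymMm sp tp.
apply/invariantP => s sK; suff : s \in Group gG by rewrite inE => /eqP.
apply: subsetP s sK; rewrite gen_subG; apply/subsetP => _ /imsetP[j jK ->].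
by rewrite inE; apply/eqP/pK.
Qed.

Lemma refl_invariant K p j : p \in Defs.invariant K -> j \in K -> msym (refl j) p = p.
Proof. by move=> /invariantP pK jK; apply: pK; apply/mem_gen/imset_f. Qed.

Lemma msymU (s : 'S_n) i : msym s 'X_i = 'X_(s i) :> R.
Proof. by rewrite /msym mmapX mmap1U. Qed.

(** A transposition of two points of an orbit is a conjugate, by the last simple
    reflection between them, of one of a closer pair. *)
Lemma tperm_invariant K p (u v : 'I_n) : p \in Defs.invariant K -> (u < v)%N ->
  (forall j : 'I_n.-1, (u <= j < v)%N -> j \in K) -> msym (tperm u v) p = p.
Proof.
move=> pK; have [m] := ubnP v; elim: m v => // m IH v vm uv uvK.
have vn : (v.-1 < n.-1)%N by have := ltn_ord v; lia.
pose j := Ordinal vn; have jv : hi j = v by apply: val_inj => /=; lia.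
have jK : j \in K by apply: uvK => /=; lia.
have [euv|nuv] := eqVneq u (lo j).
  by rewrite -jv euv; apply: (refl_invariant pK).
have ulj : (u < lo j)%N.
  by move: nuv; rewrite -(inj_eq val_inj) /=; lia.
have -> : tperm u v = (refl j * tperm u (lo j) * refl j)%g.
  have -> : (refl j * tperm u (lo j) * refl j = tperm u (lo j) ^ refl j)%g.
    by rewrite conjgE /refl tpermV mulgA.
  rewrite tpermJ tpermL jv tpermD //; first by rewrite eq_sym.
  by rewrite jv; apply: contraTneq uv => ->; rewrite ltnn.
rewrite !msymMm !(refl_invariant pK jK) IH ?(refl_invariant pK jK) //=; first lia.
by move=> i /andP[ui iv]; apply: uvK; lia.
Qed.

(** The points [a, ..., b] form an orbit of the parabolic subgroup of [K]. *)
Definition block K (a b : 'I_n) : Prop :=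
  [/\ (a <= b)%N, forall j : 'I_n.-1, (a <= j < b)%N -> j \in K &
      forall j : 'I_n.-1, j \in K -> (j != b :> nat) /\ (j.+1 != a :> nat)].

Definition pts (a b : 'I_n) : seq 'I_n := [seq r : 'I_n <- enum 'I_n | (a <= r <= b)%N].

Lemma mem_pts a b r : (r \in pts a b) = (a <= r <= b)%N.
Proof. by rewrite mem_filter mem_enum andbT. Qed.

Lemma uniq_pts a b : uniq (pts a b).
Proof. exact/filter_uniq/enum_uniq. Qed.

(** Removing [a] from [K] splits the point [a] off its orbit. *)
Definition split_off K (a : 'I_n) : {set 'I_n.-1} := [set j in K | j != a :> nat].

Lemma split_off_sub K a : split_off K a \subset K.
Proof. by apply/subsetP => j /[!inE] /andP[]. Qed.

Lemma refl_pts K a b j : block K a b -> j \in K ->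
  forall r, (refl j r \in pts a b) = (r \in pts a b).
Proof.
move=> [ab _ bK] /bK[/eqP jb /eqP ja] r; rewrite !mem_pts /refl.
by case: tpermP => [->|->|//] /=; lia.
Qed.

Lemma split_tperm K a b p (r s : 'I_n) : block K a b ->
  p \in Defs.invariant (split_off K a) -> r \in pts a b -> s \in pts a b ->
  r != a -> s != a -> msym (tperm r s) p = p.
Proof.
move=> [ab abK _] pK; rewrite !mem_pts => rab sab.
rewrite -!(inj_eq val_inj) /= => ra sa.
wlog rs : r s rab sab ra sa / (r < s)%N.
  move=> H; have [rs|sr|/val_inj->] := ltngtP r s; first exact: H.
    by rewrite tpermC; apply: H.
  by rewrite tperm1 msym1m.
apply: (tperm_invariant pK rs) => j rjs; rewrite inE abK; lia.
Qed.

(** The images of an invariant of [split_off K a] under the transpositions moving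
    [a] along its orbit are permuted by the reflections of [K]. *)
Lemma refl_tperm K a b p j (r : 'I_n) : block K a b ->
  p \in Defs.invariant (split_off K a) -> j \in K -> r \in pts a b ->
  msym (refl j) (msym (tperm a r) p) = msym (tperm a (refl j r)) p.
Proof.
move=> Kab pK jK rab; have [ab abK bK] := Kab; have [jb ja] := bK _ jK.
have rab' : refl j r \in pts a b by rewrite (refl_pts Kab).
have [ea|na] := eqVneq (j : nat) a; last first.
  have fa : refl j a = a.
    by rewrite /refl tpermD // -(inj_eq val_inj) /=; lia.
  rewrite -msymMm.
  have -> : (tperm a r * refl j = refl j * tperm a (refl j r))%g.
    by rewrite -{2}fa -tpermJ conjgE !mulgA mulgV mul1g.
  rewrite msymMm (refl_invariant pK) // inE jK; apply/eqP; lia.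
have la : lo j = a by apply: val_inj.
have [->|ra] := eqVneq r a.
  by rewrite tperm1 msym1m /refl la tpermL.
have [rh|rh] := eqVneq r (hi j).
  rewrite rh /refl la tpermR -la -msymMm.
  by rewrite tperm2 tperm1.
have fr : refl j r = r by rewrite /refl tpermD // eq_sym // la.
have hab : hi j \in pts a b.
  by rewrite mem_pts /=; move: rab ra; rewrite mem_pts -!(inj_eq val_inj) /=; lia.
rewrite fr /refl la -msymMm.
have -> : (tperm a r * tperm a (hi j) = tperm r (hi j) * tperm a r)%g.
  have -> : tperm r (hi j) = (tperm a (hi j) ^ tperm a r)%g.
    by rewrite tpermJ tpermL tpermD // -?(inj_eq val_inj) /= -?ea ?ltn_eqF // eq_sym.
  by rewrite conjgE tpermV !mulgA -[(_ * _ * tperm a r * tperm a r)%g]mulgA tperm2 mulg1.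
rewrite msymMm (split_tperm Kab pK rab hab ra) //.
Qed.

Definition evl K (l : 'I_n) (P : {poly invring k K}) : R :=
  (map_poly (@inv_val k n K) P).['X_l].

HB.instance Definition _ K := GRing.RMorphism.copy (@inv_val k n K)
   (\val : invring k K -> R).

Lemma evlD K l P Q : @evl K l (P + Q) = evl l P + evl l Q.
Proof. by rewrite /evl rmorphD hornerD. Qed.

Lemma evlM K l P Q : @evl K l (P * Q) = evl l P * evl l Q.
Proof. by rewrite /evl rmorphM hornerM. Qed.

Lemma evl0 K l : @evl K l 0 = 0.
Proof. by rewrite /evl rmorph0 horner0. Qed.

Lemma evl1 K l : @evl K l 1 = 1.
Proof. by rewrite /evl rmorph1 hornerC. Qed.

Lemma evlN K l P : @evl K l (- P) = - evl l P.
Proof. by rewrite /evl rmorphN hornerN. Qed.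

Lemma evlX K l : @evl K l 'X = 'X_l.
Proof. by rewrite /evl map_polyX hornerX. Qed.

Lemma evlC K l c : @evl K l c%:P = val c.
Proof. by rewrite /evl map_polyC hornerC. Qed.

Lemma evl_tperm K a b l r P : block K a b -> l \in pts a b -> r \in pts a b ->
  forall s, msym (tperm l r) (@evl K s P) = evl (tperm l r s) P.
Proof.
move=> [ab abK _]; rewrite !mem_pts.
move=> lab rab s; rewrite /evl -horner_map /= msymU; congr _.[_].
apply/polyP => i; rewrite !coef_map /=.
wlog lr : l r lab rab / (l < r)%N.
  move=> H; have [lr|rl|/val_inj->] := ltngtP l r; first exact: H.
    by rewrite tpermC; apply: H.
  by rewrite tperm1 msym1m.
apply: (tperm_invariant (valP _) lr) => j lj; apply: abK; lia.
Qed.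

(** The images of [p] under the transpositions moving [a] agree pairwise where two
    variables coincide, so they interpolate; the coefficients are invariant under [K]
    because the interpolating polynomial is unique. In particular [r = a] writes [p]
    as a polynomial in [x_a] over [R^K]. *)
Lemma interpolate K a b p : block K a b -> p \in Defs.invariant (split_off K a) ->
  exists2 P : {poly invring k K}, (size P <= size (pts a b))%N &
    forall r, r \in pts a b -> evl r P = msym (tperm a r) p.
Proof.
move=> Kab pK; pose v r := msym (tperm a r) p.
have vts r s : r \in pts a b -> s \in pts a b -> msym (tperm r s) (v s) = v r.
  move=> rab sab; rewrite /v -msymMm.
  have [->|rs] := eqVneq r s; first by rewrite tperm1 mulg1.
  have [->|sa] := eqVneq s a; first by rewrite tperm1 mul1g tpermC.
  have [->|ra] := eqVneq r a; first by rewrite tperm2 tperm1.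
  have -> : (tperm a s * tperm r s = tperm r s * tperm a r)%g.
    have -> : tperm a r = (tperm a s ^ tperm r s)%g.
      by rewrite tpermJ tpermR tpermD.
    by rewrite conjgE tpermV !mulgA tperm2 mul1g.
  by rewrite msymMm (split_tperm Kab pK rab sab).
have substt r s q : subst r s (msym (tperm r s) q) = subst r s q.
  elim/mpoly_alg_ind: q => [c|i|q q' e e'|q q' e e'].
  - by rewrite /msym mmapC.
  - rewrite msymU; case: tpermP => [->|->|//]; rewrite !substX ?eqxx //.
      by case: eqP.
    by case: eqP.
  - by rewrite !rmorphD /= e e'.
  - by rewrite !rmorphM /= e e'.
have [r s rab sab|P sP PE] := newton (uniq_pts a b) (v := v).
  by rewrite rmorphB /= -(vts r s) // substt subrr.
have PK i : P`_i \in Defs.invariant K.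
  apply: invariant_refl => j jK; have -> : msym (refl j) P`_i = P`_i; last by [].
  suff eP : map_poly (msym (refl j)) P = P by rewrite -{2}eP coef_map.
  apply: (horner_uniq (uniq_pts a b)) => // [|r rab].
    exact: leq_trans (size_poly _ _) sP.
  have -> : 'X_r = msym (refl j) 'X_(refl j r) :> R by rewrite msymU tpermK.
  rewrite horner_map /= PE ?(refl_pts Kab) // /v (refl_tperm Kab) ?(refl_pts Kab) //.
  by rewrite tpermK msymU tpermK PE.
exists (\poly_(i < size P) (InvRing (PK i) : invring k K)).
  exact: leq_trans (size_poly _ _) sP.
move=> r rab; rewrite /evl; set Q := map_poly _ _.
suff -> : Q = P by apply: PE.
apply/polyP => i; rewrite coef_map coef_poly; case: ltnP => //= sPi.
by rewrite nth_default.
Qed.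

(** The reflections of [K] carry an equality at [x_a] to the whole orbit; so the
    powers of [x_a] below the length of the orbit are independent over [R^K]. *)
Lemma evl_uniq K a b (P Q : {poly invring k K}) : block K a b ->
  (size P <= size (pts a b))%N -> (size Q <= size (pts a b))%N ->
  evl a P = evl a Q -> P = Q.
Proof.
move=> Kab sP sQ PQ; apply: (@map_inj_poly _ _ (@inv_val k n K)) => //.
- exact: val_inj.
have aab : a \in pts a b by rewrite mem_pts leqnn; case: Kab.
apply: (horner_uniq (uniq_pts a b)) => [||r rab].
- exact: leq_trans (size_poly _ _) sP.
- exact: leq_trans (size_poly _ _) sQ.
by have := congr1 (msym (tperm a r)) PQ; rewrite !(evl_tperm _ Kab) // tpermL.
Qed.

End Block.

Section Homogeneous.
Variables (k : fieldType) (n : nat).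
Local Notation R := {mpoly k[n]}.
Implicit Types (K I : {set 'I_n.-1}) (p q : R).

Lemma pihomogMX D (a : 'I_n) i p :
  pihomog mdeg D (p * 'X_a ^+ i) =
  if (i <= D)%N then pihomog mdeg (D - i) p * 'X_a ^+ i else 0.
Proof.
move: p; apply: mpolyind => [|c m p _ _ IH].
  by rewrite pihomog0 !mul0r pihomog0; case: ifP.
rewrite mulrDl !pihomogD IH -scalerAl !linearZ /= !pihomogX.
rewrite mpolyXn -mpolyXD. rewrite pihomogX /= mdegD mdegMn mdeg1 mul1n.
case: leqP => iD; last by rewrite addr0 [X in X == _]addnC gtn_eqF ?scaler0 // ltn_addr.
rewrite -(eqn_add2r i (mdeg m)) subnK // mulrDl -scalerAl; congr (_ *: _ + _).
by case: eqP => _; rewrite ?mul0r // mpolyXD.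
Qed.

(** Homogeneity of degree [e], the variable having degree 2. *)
Definition hpoly K (e : int) (P : {poly invring k K}) : Prop :=
  forall i, pdeg (e - (2 * i)%:Z) (val P`_i).

Lemma pdeg0 e : pdeg e (0 : R).
Proof. by move=> m; rewrite msupp0. Qed.

(** Uniqueness of the interpolating polynomial lets its homogeneous component be
    taken coefficientwise. *)
Lemma interpolate_homog K a b p e : block K a b ->
  p \in Defs.invariant (split_off K a) -> pdeg e p ->
  exists2 P : {poly invring k K}, (size P <= size (pts a b))%N /\ hpoly e P &
    forall r, r \in pts a b -> evl r P = msym (tperm a r) p.
Proof.
move=> Kab pK pe; have aab : a \in pts a b by rewrite mem_pts leqnn; case: Kab.
have [P sP PE] := interpolate Kab pK; exists P => //; split=> //.
have Pa : evl a P = p by rewrite PE // tperm1 msym1m.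
have [p0|] := eqVneq p 0.
  have -> : P = 0.
    by apply: (evl_uniq Kab); rewrite ?size_poly0 // Pa evl0.
  by move=> i; rewrite coef0; apply: pdeg0.
rewrite -msupp_eq0; case E: (msupp p) => [//|m s] _.
have {E} em : e = (2 * mdeg m)%:Z by apply: pe; rewrite E mem_head.
pose D := mdeg m; pose Q : {poly invring k K} :=
  \poly_(i < size P) if (i <= D)%N then inv_comp (D - i) P`_i else 0.
suff <- : Q = P.
  move=> i; rewrite coef_poly; case: ifP => _; last exact: pdeg0.
  case: leqP => iD; last exact: pdeg0.
  have -> : e - (2 * i)%:Z = (2 * (D - i))%:Z by rewrite em /D; lia.
  exact/pdeg_homog/pihomogP.
apply: (evl_uniq Kab) => //; first exact: leq_trans (size_poly _ _) sP.
rewrite Pa -[p](pihomog_dE (mf := mdeg) (d := D)); last first.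
  by apply/dhomogP => m' /pe; rewrite em => -[] /eqP; rewrite eqn_mul2l => /eqP.
rewrite -Pa /evl (horner_coef_wide _ (n := size P)); last first.
  by rewrite (leq_trans (size_poly _ _)) // size_poly.
rewrite (horner_coef_wide _ (n := size P)); last exact: size_poly.
rewrite linear_sum /=; apply: eq_bigr => i _.
rewrite pihomogMX !coef_map coef_poly ltn_ord /=.
by case: ifP; rewrite ?mul0r.
Qed.

End Homogeneous.

(** * Bimodules as modules over a polynomial ring *)

Section PolyAct.
Variables (A : comNzRingType) (V : zmodType) (la : A -> V -> V) (T : V -> V).
Hypothesis laDr : forall a x y, la a (x + y) = la a x + la a y.
Hypothesis laDl : forall a b x, la (a + b) x = la a x + la b x.
Hypothesis laM : forall a b x, la (a * b) x = la a (la b x).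
Hypothesis la1 : forall x, la 1 x = x.
Hypothesis TD : forall x y, T (x + y) = T x + T y.
Hypothesis laT : forall a x, la a (T x) = T (la a x).

(** The variable acts by [T], which commutes with the scalars. *)
Definition pact (p : {poly A}) (v : V) : V :=
  \sum_(i < size p) la p`_i (iter i T v).

Let la0r a : la a 0 = 0.
Proof. by apply: (@addrI _ (la a 0)); rewrite -laDr !addr0. Qed.

Let la0l v : la 0 v = 0.
Proof. by apply: (@addrI _ (la 0 v)); rewrite -laDl !addr0. Qed.

Let T0 : T 0 = 0.
Proof. by apply: (@addrI _ (T 0)); rewrite -TD !addr0. Qed.

Let iterD i x y : iter i T (x + y) = iter i T x + iter i T y.
Proof. by elim: i => //= i ->. Qed.

Implicit Type p : {poly A}.

Lemma pact_wide n p v : (size p <= n)%N ->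
  pact p v = \sum_(i < n) la p`_i (iter i T v).
Proof.
move=> sn; rewrite /pact (big_ord_widen n (fun i => la p`_i (iter i T v))) //.
rewrite big_mkcond; apply: eq_bigr => i _; case: ltnP => // si.
by rewrite nth_default ?la0l.
Qed.

Lemma pactDr p x y : pact p (x + y) = pact p x + pact p y.
Proof.
by rewrite -big_split; apply: eq_bigr => i _; rewrite iterD laDr.
Qed.

Lemma pactDl v p q : pact (p + q) v = pact p v + pact q v.
Proof.
rewrite !(@pact_wide (maxn (size p) (size q))) ?leq_maxl ?leq_maxr ?size_polyD //.
by rewrite -big_split; apply: eq_bigr => i _; rewrite coefD laDl.
Qed.

Lemma pactC a v : pact a%:P v = la a v.
Proof.
rewrite (@pact_wide 1) ?size_polyC ?leq_b1 //.
by rewrite big_ord1 coefC.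
Qed.

Lemma pactMX p v : pact (p * 'X) v = T (pact p v).
Proof.
rewrite (@pact_wide (size p).+1); last first.
  by apply: leq_trans (size_polyMleq _ _) _; rewrite size_polyX addn2.
rewrite big_ord_recl coefMX la0l add0r /pact.
rewrite (big_morph T TD T0); apply: eq_bigr => i _.
by rewrite coefMX /= laT.
Qed.

Lemma pactCM a p v : pact (a%:P * p) v = la a (pact p v).
Proof.
rewrite (@pact_wide (size p)); last first.
  by rewrite mul_polyC size_scale_leq.
rewrite /pact (big_morph (la a) (laDr a) (la0r a)); apply: eq_bigr => i _.
by rewrite coefCM laM.
Qed.

Lemma pactM p q v : pact p (pact q v) = pact (p * q) v.
Proof.
elim/poly_ind: p => [|p c IH]; first by rewrite mul0r /pact size_poly0 !big_ord0.
by rewrite mulrDl !pactDl mulrAC !pactMX IH pactC pactCM.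
Qed.

Lemma pact1 : left_id 1 pact.
Proof. by move=> v; rewrite pactC la1. Qed.

End PolyAct.

Section Bimodules.
Variables (k : fieldType) (n : nat).
Local Notation N := n.+1.
Local Notation R := {mpoly k[N]}.
Local Notation hat := (hat1 N).
Local Notation bimod I := (gbimod (RI k I) (RI k hat)).
Implicit Types (I K : {set 'I_N.-1}).

Lemma X0_hat : 'X_(ord0 : 'I_N) \in Defs.invariant (k := k) hat.
Proof.
apply: invariant_refl => j; rewrite inE => j0; rewrite msymU /refl tpermD //.
by rewrite -(inj_eq val_inj) /= -lt0n.
Qed.

Definition x0 : invring k hat := InvRing X0_hat.

(** The polynomial ring [R^I[z]] acts on an [(R^I, R^hat1)]-bimodule, [z]
    acting as right multiplication by the first variable. *)
Definition zm I (M : bimod I) : Type := M.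

Section ZAct.
Variables (I : {set 'I_N.-1}) (M : bimod I).

HB.instance Definition _ := GRing.Zmodule.on (zm M).

(* The action is sealed: unification must not unfold it. *)
Fact zact_subproof : {f : {poly invring k I} -> zm M -> zm M |
  f = pact (fun a => @lact (RI k I) (RI k hat) M a) (fun x => ract x x0)}.
Proof. by eexists. Qed.

Definition zact := sval zact_subproof.

Let zactE : zact = pact (fun a => @lact (RI k I) (RI k hat) M a) (fun x => ract x x0).
Proof. exact: (svalP zact_subproof). Qed.

Let bm := @bm_bimodule _ _ M.

Local Ltac bimod := move=> *; first [exact: (lactDl bm) | exact: (lactDr bm)
  | exact: (lactM bm) | exact: (lact1 bm) | exact: (ractDl bm)
  | by rewrite (lractA bm)].

Fact zact_assoc p q x : zact p (zact q x) = zact (p * q) x.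
Proof. by rewrite zactE; apply: pactM; bimod. Qed.

Fact zact_1 : left_id 1 zact.
Proof. by rewrite zactE; apply: pact1; bimod. Qed.

Fact zact_Dr : right_distributive zact +%R.
Proof. by rewrite zactE => p x y; apply: pactDr; bimod. Qed.

Fact zact_Dl x : {morph zact^~ x : p q / p + q}.
Proof. by rewrite zactE => p q; apply: pactDl; bimod. Qed.

HB.instance Definition _ := GRing.Zmodule_isLmodule.Build {poly invring k I}
  (zm M) zact_assoc zact_1 zact_Dr zact_Dl.

Lemma zscaleC (a : invring k I) (x : zm M) :
  a%:P *: x = (lact (a : RI k I) (x : M) : zm M).
Proof. by rewrite /GRing.scale /= zactE; apply: pactC; bimod. Qed.

Lemma zscaleX (x : zm M) : 'X *: x = (ract (x : M) (x0 : RI k hat) : zm M).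
Proof.
rewrite -['X]mul1r; apply: etrans (_ : ract (zact 1 x : M) x0 = _).
  by rewrite /GRing.scale /= zactE; apply: pactMX; bimod.
by rewrite zact_1.
Qed.

End ZAct.


Definition iincl I K (IK : I \subset K) : invring k K -> invring k I :=
  sval (RI_incl k IK).

Lemma val_iincl I K (IK : I \subset K) c : val (iincl IK c) = val c.
Proof. by []. Qed.

Fact iincl_zmod I K (IK : I \subset K) : zmod_morphism (iincl IK).
Proof. by move=> x y; apply: val_inj. Qed.
HB.instance Definition _ I K (IK : I \subset K) :=
  GRing.isZmodMorphism.Build _ _ (iincl IK) (iincl_zmod IK).

Fact iincl_monoid I K (IK : I \subset K) : monoid_morphism (iincl IK).
Proof. by split=> [|x y]; apply: val_inj. Qed.
HB.instance Definition _ I K (IK : I \subset K) :=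
  GRing.isMonoidMorphism.Build _ _ (iincl IK) (iincl_monoid IK).

Lemma evl_iincl I K (IK : I \subset K) l P : evl l (map_poly (iincl IK) P) = evl l P.
Proof.
rewrite /evl -map_poly_comp_id0 ?rmorph0 //; congr _.[_].
Qed.

Lemma evl_sum I l (J : Type) (r : seq J) (Q : pred J) (F : J -> {poly invring k I}) :
  evl l (\sum_(i <- r | Q i) F i) = \sum_(i <- r | Q i) evl l (F i).
Proof. by apply: (big_morph (@evl _ _ _ l) (@evlD _ _ _ l)); apply: evl0. Qed.

Lemma zscale_restrict I K (IK : I \subset K) (M : bimod I)
    P (x : M) :
  P *: (x : zm (restrict (RI_incl k IK) (gring_id _) M)) =
  map_poly (iincl IK) P *: (x : zm M) :> M.
Proof.
elim/poly_ind: P x => [|P c IH] x; first by rewrite rmorph0 !scale0r.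
rewrite rmorphD rmorphM /= map_polyX map_polyC !scalerDl -!scalerA.
by congr (_ + _); rewrite ?zscaleC // IH !zscaleX.
Qed.

Lemma hom_zscale I (M M' : bimod I) (f : gbimod_hom M M')
    P (x : zm M) : sval f (P *: x) = P *: (sval f x : zm M').
Proof.
have [fD fl fr _] := svalP f.
have f0 : sval f 0 = 0 by apply: (@addrI _ (sval f 0)); rewrite -fD !addr0.
elim/poly_ind: P x => [|P c IH] x; first by rewrite !scale0r.
by rewrite !scalerDl -!scalerA fD IH !zscaleC fl !zscaleX fr.
Qed.

(** The bimodule is a module over the tensor product of [R^I] and [R^hat1] over
    the symmetric polynomials in all the variables. *)
Definition central I (M : bimod I) : Prop :=
  forall (c : invring k [set: 'I_N.-1]) (x : M),
    lact (iincl (subsetT I) c : RI k I) x = ract x (iincl (subsetT hat) c : RI k hat).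

Lemma central_ract I (M : bimod I) P (x : zm M) : central M ->
  map_poly (iincl (subsetT I)) P *: x =
  ract (x : M) ((map_poly (iincl (subsetT hat)) P).[x0] : RI k hat) :> M.
Proof.
have bm := @bm_bimodule _ _ M; move=> cM.
have r0 (y : M) : ract y (0 : RI k hat) = 0.
  by apply: (@addrI _ (ract y (0 : RI k hat))); rewrite -(ractDr bm) !addr0.
elim/poly_ind: P x => [|P c IH] x; first by rewrite !rmorph0 horner0 scale0r r0.
rewrite !rmorphD !rmorphM /= !map_polyX !map_polyC scalerDl -scalerA IH zscaleX.
by rewrite zscaleC /= cM -(ractM bm) -(ractDr bm) !hornerE mulrC.
Qed.

Lemma block_setT : block [set: 'I_N.-1] ord0 ord_max.
Proof.
split=> // [j _|j _]; [by rewrite inE | split=> //=; have := ltn_ord j => /=; lia].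
Qed.

Lemma hat_split : hat = split_off [set: 'I_N.-1] (ord0 : 'I_N).
Proof. by apply/setP => j; rewrite !inE lt0n. Qed.

Lemma kappa_subproof (q : invring k hat) : exists P : {poly invring k [set: 'I_N.-1]},
  (forall l, evl l P = msym (tperm ord0 l) (val q)) /\
  (forall e, pdeg e (val q) -> hpoly e P).
Proof.
have qs : val q \in Defs.invariant (split_off [set: 'I_N.-1] (ord0 : 'I_N)).
  by rewrite -hat_split; apply: valP.
have [P sP PE] := interpolate block_setT qs.
exists P; split=> [l|e eq]; first by apply: PE; rewrite mem_pts leq_ord.
have [Q [sQ hQ] QE] := interpolate_homog block_setT qs eq.
suff -> : P = Q by [].
by apply: (evl_uniq block_setT) => //; rewrite PE ?QE // mem_pts.
Qed.

(** The polynomial in [z] by which [q] acts from the right. *)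
Definition kappa q := projT1 (cid (kappa_subproof q)).

Lemma evl_kappa q l : evl l (kappa q) = msym (tperm ord0 l) (val q).
Proof. by rewrite /kappa; case: cid => P []. Qed.

Lemma hpoly_kappa q e : pdeg e (val q) -> hpoly e (kappa q).
Proof. by rewrite /kappa; case: cid => P [_ H] /=; apply: H. Qed.

Lemma kappa_x0 q : (map_poly (iincl (subsetT hat)) (kappa q)).[x0] = q.
Proof.
apply: val_inj; rewrite -horner_map /=.
have := evl_kappa q ord0; rewrite tperm1 msym1m => <-.
exact: (evl_iincl (subsetT hat)).
Qed.

(** [R^hat1] is generated by the first variable over the symmetric polynomials, so
    on a central bimodule the right action factors through the left one and [z]. *)
Lemma ract_kappa I (M : bimod I) (x : zm M) (q : invring k hat) :
  central M ->
  ract (x : M) (q : RI k hat) = map_poly (iincl (subsetT I)) (kappa q) *: x :> M.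
Proof. by move=> cM; rewrite central_ract // kappa_x0. Qed.

End Bimodules.

(** * Sums of cyclic bimodules *)

Section Based.
Variables (k : fieldType) (n : nat).
Local Notation N := n.+1.
Local Notation R := {mpoly k[N]}.
Local Notation hat := (hat1 N).
Local Notation bimod I := (gbimod (RI k I) (RI k hat)).
Implicit Types (I K : {set 'I_N.-1}).

(** [j] does not separate two points of an orbit of the parabolic subgroup
    of [I]. *)
Definition bdry I (j : nat) : Prop := forall i : 'I_N.-1, i \in I -> i.+1 != j :> nat.

Lemma bdry_sub I K j : I \subset K -> bdry K j -> bdry I j.
Proof. by move=> /subsetP IK Kj i /IK/Kj. Qed.

Lemma monic_eq0 I (p F : {poly invring k I}) (L : seq 'I_N) : uniq L ->
  F \is monic -> size F = (size L).+1 -> (forall l, l \in L -> evl l F = 0) ->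
  (forall l, l \in L -> evl l p = 0) -> exists q, p = q * F.
Proof.
move=> uL mF sF F0 p0; exists (Pdiv.Ring.rdivp p F).
have ep := Pdiv.RingMonic.rdivp_eq mF p; rewrite {1}ep.
suff -> : Pdiv.Ring.rmodp p F = 0 by rewrite addr0.
apply: (@map_inj_poly _ _ (@inv_val k N I)) => //; first exact: val_inj.
rewrite rmorph0; apply: (horner_uniq uL); rewrite ?size_poly0 //.
  have : (size (Pdiv.Ring.rmodp p F) < size F)%N.
    by rewrite Pdiv.Ring.ltn_rmodp monic_neq0.
  by rewrite sF ltnS => s; apply: leq_trans (size_poly _ _) s.
move=> l lL; rewrite horner0.
have := p0 l lL; rewrite {1}ep evlD evlM F0 // mulr0 add0r; exact.
Qed.

(** Take [prod_(l < j) (z - x_l)]: the group of [K] permutes the first [j]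
    variables, so the coefficients lie in [R^K]. *)
Lemma vanishing_poly K j : bdry K j -> exists F : {poly invring k K},
  (forall l : 'I_N, (l < j)%N -> evl l F = 0) /\
  forall I (IK : I \subset K) (p : {poly invring k I}),
    (forall l : 'I_N, (l < j)%N -> evl l p = 0) ->
    exists q, p = q * map_poly (iincl IK) F.
Proof.
move=> Kj; pose L := [seq l : 'I_N <- enum 'I_N | (l < j)%N].
have memL l : (l \in L) = (l < j)%N by rewrite mem_filter mem_enum andbT.
pose G : {poly R} := \prod_(l <- L) ('X - ('X_l)%:P).
have GE : G = \prod_(l : 'I_N | (l < j)%N) ('X - ('X_l)%:P).
  by rewrite /G big_filter big_enum_cond.
have GK i : G`_i \in Defs.invariant K.
  apply: invariant_refl => r rK; have -> : msym (refl r) G`_i = G`_i; last by [].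
  suff eG : map_poly (msym (refl r)) G = G by rewrite -{2}eG coef_map.
  rewrite GE rmorph_prod [RHS](reindex_inj (@perm_inj _ (refl r))) /=.
  apply: eq_big => [l|l _]; last by rewrite map_polyXsubC /= msymU.
  by rewrite /refl; case: tpermP => [->|->|//]; have := Kj r rK; rewrite /=; lia.
pose F : {poly invring k K} := \poly_(i < size G) (InvRing (GK i) : invring k K).
have FG : map_poly (@inv_val k N K) F = G.
  apply/polyP => i; rewrite coef_map coef_poly; case: ltnP => //= sGi.
  by rewrite nth_default.
have F0 l : l \in L -> evl l F = 0.
  move=> lL; rewrite /evl FG /G horner_prod; apply/eqP; rewrite prodf_seq_eq0.
  by apply/hasP; exists l => //=; rewrite hornerXsubC subrr.
have sG : size G = (size L).+1 by rewrite size_prod_XsubC.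
have sF : size F = (size L).+1.
  rewrite -sG -FG size_map_inj_poly //; [exact: val_inj].
have mF : F \is monic.
  have mG : G \is monic by apply: monic_prod => l _; apply: monicXsubC.
  apply/monicP/val_inj; rewrite /= -(monicP mG) -FG.
  by rewrite lead_coef_map_inj //; [exact: val_inj].
exists F; split=> [l lj|I IK p p0]; first by apply: F0; rewrite memL.
apply: (@monic_eq0 _ _ _ L) => //.
- exact/filter_uniq/enum_uniq.
- exact: monic_map.
- by rewrite size_map_poly_id0 ?sF // (monicP mF) rmorph1 oner_neq0.
- by move=> l /F0 lF; rewrite evl_iincl.
- by move=> l; rewrite memL; apply: p0.
Qed.

(** [M] is the direct sum of the cyclic modules [R^I[z] v_t], the annihilator
    of [v_t] being generated by [prod_(l < j_t) (z - x_l)]. *)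
Record based I (M : bimod I) (T : finType) (j : T -> nat)
    (d : T -> int) (v : T -> zm M) : Prop := Based {
  based_bdry : forall t, bdry I (j t);
  based_le : forall t, (j t <= N)%N;
  based_deg : forall t, bm_deg (d t) (v t : M);
  based_span : forall x : zm M, exists P : T -> {poly invring k I},
    x = \sum_t P t *: v t;
  based_rel : forall P : T -> {poly invring k I}, \sum_t P t *: v t = 0 <->
    forall t (l : 'I_N), (l < j t)%N -> evl l (P t) = 0 }.

Lemma based_kill I (M : bimod I) (T : finType) (j : T -> nat)
    d (v : T -> zm M) : based j d v -> forall t P,
  (forall l : 'I_N, (l < j t)%N -> evl l P = 0) -> P *: v t = 0.
Proof.
move=> bM t P P0; have := based_rel bM (fun s => if s == t then P else 0).
rewrite (bigD1 t) //= eqxx big1 ?addr0 => [->|s /negPf->]; last by rewrite scale0r.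
by move=> s l; case: eqP => [->|_] ls; rewrite ?evl0 ?P0.
Qed.

Lemma based_coord I (M : bimod I) (T : finType) (j : T -> nat)
    d (v : T -> zm M) : based j d v -> forall t P,
  P *: v t = 0 -> forall l : 'I_N, (l < j t)%N -> evl l P = 0.
Proof.
move=> bM t P P0 l lt; have [+ _] := based_rel bM (fun s => if s == t then P else 0).
rewrite (bigD1 t) //= eqxx P0 add0r big1 => [|s /negPf->]; last by rewrite scale0r.
by move=> /(_ erefl t l lt); rewrite eqxx.
Qed.

Section Induction.
Variables (I K : {set 'I_N.-1}) (IK : I \subset K).
Variables (M : bimod K) (T : finType) (j : T -> nat).
Variables (d : T -> int) (v : T -> zm M).
Hypothesis bM : based j d v.

Let RIK := restrict (gring_id (RI k I)) (RI_incl k IK) (regular_gbimod (RI k I)).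
Let MI := tensor_gbimod RIK M.

Lemma tens_scale (r : invring k I) P (x : zm M) :
  (r%:P * map_poly (iincl IK) P) *: (tens (1 : RIK) (x : M) : zm MI) =
  tens (r : RIK) (P *: x : M) :> MI.
Proof.
rewrite -scalerA zscaleC.
have -> : map_poly (iincl IK) P *: (tens (1 : RIK) (x : M) : zm MI) =
    tens (1 : RIK) (P *: x : M) :> MI.
  elim/poly_ind: P x => [|P c IH] x; first by rewrite rmorph0 !scale0r tens0r.
  rewrite rmorphD rmorphM /= map_polyX map_polyC !scalerDl -!scalerA tensDr.
  rewrite zscaleX -{1}/(tens (1 : RIK) (x : M)).
  rewrite [ract _ _](_ : _ = tens (1 : RIK) ('X *: x : M)); last first.
    by rewrite zscaleX; apply: tract_pi.
  rewrite IH; congr (_ + _); rewrite !zscaleC -tens_bal /=.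
  apply: etrans (tlact_pi _ _) _; rewrite /= mulr1.
  by congr (tens _ _); rewrite /= mul1r.
by apply: etrans (tlact_pi _ _) _; rewrite /= mulr1.
Qed.

(** The coordinates along [v_t] are determined up to polynomials vanishing at
    [x_l], so their values at [x_l] are functions on [M]. *)
Lemma based_functional t (l : 'I_N) : (l < j t)%N -> exists e : zm M -> R,
  forall P, e (\sum_s P s *: v s) = evl l (P t).
Proof.
move=> lt; have [c cE] := choice (based_span bM).
exists (fun x => evl l (c x t)) => P; apply/eqP; rewrite -subr_eq0 -evlN -evlD.
apply/eqP; set x := \sum_s _.
have [+ _] := based_rel bM (fun s => c x s - P s); apply=> //.
under eq_bigr do rewrite scalerBl.
by rewrite sumrB -cE subrr.
Qed.

(** The functionals reading off values of coordinates extend to the induced module,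
    so induction creates no new relations. *)
Lemma based_tensor :
  based (I := I) (M := MI) j d (fun t => tens (1 : RIK) (v t : M) : zm MI).
Proof.
split.
- by move=> t; apply: bdry_sub IK _; apply: based_bdry bM t.
- exact: based_le bM.
- move=> t; exists [:: ((1 : RIK), (v t : M))]; split=> // p /[!inE] /eqP-> /=.
  exists 0, (d t); split; [by rewrite add0r| |exact: based_deg bM t].
  exact: (@gr_deg1 (RI k I)).
- elim/tensorW => s; elim: s => [|[r x] s [Q eQ]].
    by exists (fun=> 0); rewrite big1 // => t _; rewrite scale0r.
  have [P eP] := based_span bM x.
  exists (fun t => (r : invring k I)%:P * map_poly (iincl IK) (P t) + Q t).
  rewrite -cat1s tpi_cat eQ -[tpi _]/(tens (r : RIK) x) {1}eP tens_sumr.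
  by rewrite -big_split; apply: eq_bigr => t _; rewrite scalerDl tens_scale.
- move=> P; split=> [P0 t l lt|P0].
    have [e eE] := based_functional lt.
    have eD x y : e (x + y) = e x + e y.
      have [Px ->] := based_span bM x; have [Py ->] := based_span bM y.
      rewrite -big_split -[X in e X]/(\sum_s (Px s *: v s + Py s *: v s)).
      under eq_bigr do rewrite -scalerDl.
      by rewrite !eE evlD.
    have eZ (c : invring k K) x : e (c%:P *: x) = val c * e x.
      have [Px ->] := based_span bM x; rewrite scaler_sumr.
      under eq_bigr do rewrite scalerA.
      by rewrite !eE evlM evlC.
    have := @tensor_lift _ _ _ RIK M R (fun r x => val (r : invring k I) * e x).
    case=> [r r' x|r x y|r b x|H [HD HE]]; first by rewrite mulrDl.
    + by rewrite eD mulrDr.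
    + by rewrite -zscaleC eZ mulrA.
    have H0 : H 0 = 0 by apply: (@addrI _ (H 0)); rewrite -HD !addr0.
    have eX s m : e ('X^m *: v s) = if s == t then 'X_l ^+ m else 0.
      have := eE (fun u => if u == s then 'X^m else 0).
      rewrite (bigD1 s) //= eqxx big1 ?addr0 => [->|u /negPf->]; last first.
        by rewrite scale0r.
      rewrite [t == s]eq_sym; case: eqP => _; last exact: evl0.
      by rewrite /evl map_polyXn hornerXn.
    have HS s : forall Q m, H (Q *: (tens (1 : RIK) ('X^m *: v s : M) : zm MI)) =
        if s == t then evl l Q * 'X_l ^+ m else 0.
      elim/poly_ind => [|Q c IH] m.
        by rewrite scale0r H0 evl0 mul0r; case: ifP.
      rewrite scalerDl HD -scalerA.
      have -> : 'X *: (tens (1 : RIK) ('X^m *: v s : M) : zm MI) =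
          tens (1 : RIK) ('X^(m.+1) *: v s : M).
        have := tens_scale 1 'X ('X^m *: v s).
        by rewrite map_polyX mul1r scalerA -exprS.
      rewrite IH.
      have -> : c%:P *: (tens (1 : RIK) ('X^m *: v s : M) : zm MI) =
          tens (c : RIK) ('X^m *: v s : M).
        by have := tens_scale c 1 ('X^m *: v s); rewrite rmorph1 mulr1 scale1r.
      rewrite HE eX; case: eqP => _; last by rewrite mulr0 addr0.
      by rewrite evlD evlM evlX evlC mulrDl -mulrA -exprS.
    have := congr1 H P0; rewrite H0 (big_morph H HD H0) (bigD1 t) //= big1.
      by have := HS t (P t) 0; rewrite expr0 scale1r mulr1 eqxx addr0 => ->.
    by move=> s /negPf st; have := HS s (P s) 0; rewrite expr0 scale1r mulr1 st.
  rewrite big1 // => t _; have [F [F0 FP]] := vanishing_poly (based_bdry bM t).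
  have [q ->] := FP _ IK (P t) (P0 t).
  rewrite -scalerA -[map_poly _ F]mul1r -[1]/(1%:P).
  by rewrite tens_scale (based_kill bM) ?tens0r ?scaler0.
Qed.

End Induction.

End Based.

Section Step.
Variables (k : fieldType) (n : nat).
Local Notation N := n.+1.
Local Notation R := {mpoly k[N]}.
Variables (K : {set 'I_N.-1}) (a b : 'I_N).
Hypothesis Kab : block K a b.
Local Notation I := (split_off K a).
Let IK : I \subset K := split_off_sub K a.
Let m := (size (pts a b)).-1.

Let size_pts : size (pts a b) = m.+1.
Proof.
have : a \in pts a b by rewrite mem_pts leqnn; case: Kab.
by rewrite /m; case: (pts a b).
Qed.

Fact Xa_invariant : 'X_a \in Defs.invariant (k := k) I.
Proof.
apply: invariant_refl => j; rewrite inE => /andP[jK ja].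
have [_ _ /(_ _ jK)[_ ja']] := Kab.
by rewrite msymU /refl tpermD // -(inj_eq val_inj).
Qed.

Definition xa : invring k I := InvRing Xa_invariant.

(** A basis of [R^I[z]] over [R^K[z]]; for [sp] it is adapted to the
    submodule generated by [z - x_a]. *)
Definition gen (sp : bool) (i : nat) : {poly invring k I} :=
  if sp && (0 < i)%N then (xa ^+ i.-1)%:P * ('X - xa%:P) else (xa ^+ i)%:P.

Lemma gen_span sp p : exists Q : 'I_m.+1 -> {poly invring k K},
  p = \sum_i map_poly (iincl IK) (Q i) * gen sp i.
Proof.
pose S s p := exists Q : 'I_m.+1 -> {poly invring k K},
  p = \sum_i map_poly (iincl IK) (Q i) * gen s i.
have S0 s : S s 0.
  by exists (fun=> 0); rewrite big1 // => i _; rewrite rmorph0 mul0r.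
have SD s p1 p2 : S s p1 -> S s p2 -> S s (p1 + p2).
  move=> [Q1 ->] [Q2 ->]; exists (fun i => Q1 i + Q2 i); rewrite -big_split.
  by apply: eq_bigr => i _; rewrite rmorphD mulrDl.
have SM s q p1 : S s p1 -> S s (map_poly (iincl IK) q * p1).
  move=> [Q1 ->]; exists (fun i => q * Q1 i); rewrite mulr_sumr.
  by apply: eq_bigr => i _; rewrite rmorphM mulrA.
have Sgen s i : (i < m.+1)%N -> S s (gen s i).
  move=> im; exists (fun j => if j == Ordinal im then 1 else 0).
  rewrite (bigD1 (Ordinal im)) //= eqxx rmorph1 mul1r big1 ?addr0 //.
  by move=> j /negPf->; rewrite rmorph0 mul0r.
have Spow i : (i < m.+1)%N -> S sp (xa ^+ i)%:P.
  case: sp; last exact: (Sgen false).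
  elim: i => [|i IH] im; first exact: (Sgen true 0).
  have -> : (xa ^+ i.+1)%:P = map_poly (iincl IK) 'X * (xa ^+ i)%:P
      + map_poly (iincl IK) (-1) * gen true i.+1.
    rewrite map_polyX rmorphN rmorph1 /gen /= exprS rmorphM /=; ring.
  apply: SD; apply: SM; last exact: Sgen.
  by apply: IH; apply: ltnW.
have Sbig (F : 'I_m.+1 -> {poly invring k I}) : (forall i, S sp (F i)) -> S sp (\sum_i F i).
  by move=> SF; apply: (big_ind (S sp)) => // p1 p2; apply: SD.
have SC (c : invring k I) : S sp c%:P.
  have [P sP PE] := interpolate Kab (valP c).
  have -> : c%:P = \sum_(i < m.+1) map_poly (iincl IK) (P`_i)%:P * (xa ^+ i)%:P.
    under eq_bigr do rewrite map_polyC -rmorphM /=.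
    rewrite -rmorph_sum /=; congr _%:P; apply: val_inj; rewrite [RHS]raddf_sum /=.
    rewrite -[LHS]/(val c) -[LHS]msym1m -(tperm1 a) -PE ?mem_pts ?leqnn; last by case: Kab.
    rewrite /evl (horner_coef_wide _ (n := m.+1)); last first.
      by rewrite -size_pts; apply: leq_trans (size_poly _ _) sP.
    apply: eq_bigr => i _; rewrite coef_map /=.
    by congr (_ * _); rewrite rmorphXn.
  by apply: Sbig => i; apply: SM; apply: Spow.
elim/poly_ind: p => [|p c IH]; first exact: S0.
by apply: SD => //; rewrite mulrC -(map_polyX (iincl IK)); apply: SM.
Qed.

(** The exponents of the cyclic modules into which a cyclic module of exponent
    [j] splits over [R^K[z]]; here [sp] means that [j] is [a.+1]. *)
Definition newj (j i : nat) : nat :=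
  if j == a.+1 then if i == 0%N then b.+1 else a else j.

(** Let [f_j] be [prod_(l < j) (z - x_l)]. Over [R^K[z]] the module [R^I[z]/f_j] is
    a sum of copies of [R^K[z]/f_j], except when [j = a.+1] separates two points of the
    orbit: then 1 generates [R^K[z]/f_(b.+1)], and each [x_a^i (z - x_a)] a copy of
    [R^K[z]/f_a]. *)
Lemma gen_rel (j : nat) (Q : 'I_m.+1 -> {poly invring k K}) : bdry I j ->
  (forall l : 'I_N, (l < j)%N ->
     evl l (\sum_i map_poly (iincl IK) (Q i) * gen (j == a.+1) i) = 0) <->
  (forall (i : 'I_m.+1) (l : 'I_N), (l < newj j i)%N -> evl l (Q i) = 0).
Proof.
move=> Ij; have [ab abK bK] := Kab.
have aab : a \in pts a b by rewrite mem_pts leqnn.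
have xpow l i : evl l (xa ^+ i)%:P = 'X_a ^+ i by rewrite evlC rmorphXn.
have evlS s l : evl l (\sum_i map_poly (iincl IK) (Q i) * gen s i) =
    \sum_i evl l (Q i) * evl l (gen s i).
  by rewrite evl_sum; apply: eq_bigr => i _; rewrite evlM evl_iincl.
have genT l i : evl l (gen true i.+1) = 'X_a ^+ i * ('X_l - 'X_a).
  by rewrite /gen /= evlM xpow evlD evlN evlX evlC.
have tQ l r i : r \in pts a b -> msym (tperm a r) (evl l (Q i)) = evl (tperm a r l) (Q i).
  by move=> rab; apply: (evl_tperm _ Kab).
rewrite /newj; case: (eqVneq j a.+1) => [ej|nj]; last first.
  split=> [H i l lj|H l lj]; last first.
    by rewrite evlS big1 // => i _; rewrite H ?mul0r.
  pose P : {poly R} := \poly_(i < m.+1) evl l (Q (inord i)).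
  suff P0 : P = 0.
    by have := congr1 (fun p : {poly R} => p`_i) P0; rewrite coef_poly ltn_ord inord_val coef0.
  have jab : (j <= a)%N || (b < j)%N.
    case: leqP => //= aj; case: ltnP => // jb.
    have jn : (j.-1 < N.-1)%N by have := ltn_ord b => /=; lia.
    have := Ij (Ordinal jn); rewrite !inE abK /=; last by lia.
    by move=> H'; have := H' (ltac:(lia)); rewrite prednK ?eqxx //; lia.
  apply: (horner_uniq (uniq_pts a b)); rewrite ?size_poly0 //.
    by rewrite size_pts; apply: size_poly.
  move=> r rab; rewrite horner0 horner_poly.
  have lj' : (tperm a r l < j)%N.
    by move: rab lj; rewrite mem_pts; case: tpermP => [->|->|//]; lia.
  have := congr1 (msym (tperm a r)) (H _ lj').
  rewrite evlS rmorph0 raddf_sum /= => e0; rewrite -[RHS]e0; apply: eq_bigr => i' _.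
  by rewrite rmorphM /= tQ // tpermK xpow rmorphXn /= msymU tpermL inord_val.
split=> [H|H l lj]; last first.
  rewrite evlS big_ord_recl H /=; last by lia.
  rewrite mul0r add0r big1 // => i _; rewrite genT.
  have [la|la] := ltnP l a; first by rewrite H ?mul0r.
  have -> : l = a by apply: val_inj => /=; lia.
  by rewrite subrr mulr0 mulr0.
have H' (l : 'I_N) : (l < j)%N -> evl l (Q ord0) +
    ('X_l - 'X_a) * (\sum_(i < m) evl l (Q (lift ord0 i)) * 'X_a ^+ i) = 0.
  move=> lj; rewrite -[RHS](H l lj) evlS big_ord_recl /gen /= expr0 polyC1 evl1 mulr1.
  rewrite mulr_sumr; congr (_ + _); apply: eq_bigr => i _.
  by rewrite -/(gen true i.+1) genT; ring.
have Q0 r : r \in pts a b -> evl r (Q ord0) = 0.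
  move=> rab; have := H' a; rewrite ej ltnSn subrr mul0r addr0 => /(_ isT).
  by move/(congr1 (msym (tperm a r))); rewrite rmorph0 tQ // tpermL.
have Ql (l : 'I_N) : (l < a)%N -> evl l (Q ord0) = 0 /\ forall i, evl l (Q (lift ord0 i)) = 0.
  move=> la; pose S : {poly R} := \poly_(i < m) evl l (Q (inord i.+1)).
  have inS (i : 'I_m) : inord i.+1 = lift ord0 i :> 'I_m.+1.
    by apply: val_inj; rewrite /= inordK ?ltnS ?ltn_ord.
  pose P : {poly R} := (evl l (Q ord0))%:P + (('X_l)%:P - 'X) * S.
  have P0 : P = 0.
    apply: (horner_uniq (uniq_pts a b)); rewrite ?size_poly0 //.
      rewrite size_pts; apply: leq_trans (size_polyD _ _) _; rewrite geq_max.
      rewrite (leq_trans (size_polyC_leq1 _)) //=.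
      apply: leq_trans (size_polyMleq _ _) _.
      have : (size (('X_l)%:P - 'X : {poly R})%R <= 2)%N.
        by rewrite -opprB size_polyN size_XsubC.
      have s3 : (size S <= m)%N by apply: size_poly.
      move=> s2; have := leq_add s2 s3; rewrite add2n.
      by case: addn => //= u; rewrite ltnS.
    move=> r rab; rewrite horner0 !(hornerD, hornerM, hornerN, hornerC, hornerX).
    have lj : (l < j)%N by lia.
    have tl : tperm a r l = l.
      move: rab; rewrite mem_pts => rab.
      by rewrite tpermD // -(inj_eq val_inj) /=; lia.
    have := congr1 (msym (tperm a r)) (H' l lj).
    rewrite rmorph0 rmorphD rmorphM rmorphB /= tQ // tl !msymU tl tpermL => e0.
    rewrite -[RHS]e0 {e0}.
    congr (_ + _ * _); rewrite raddf_sum horner_poly /=; apply: eq_bigr => i _.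
    by rewrite rmorphM rmorphXn /= msymU tpermL tQ // tl inS.
  have e0 : evl l (Q ord0) = 0.
    have := congr1 (fun p => p.['X_l]) P0.
    by rewrite horner0 !(hornerD, hornerM, hornerN, hornerC, hornerX) subrr mul0r addr0.
  split=> // i; have : S = 0.
    move: P0; rewrite /P e0 add0r => /eqP; rewrite mulf_eq0 => /orP[|/eqP //].
    by rewrite subr_eq0 eq_sym -subr_eq0 polyXsubC_eq0.
  by move/(congr1 (fun p : {poly R} => p`_i)); rewrite coef_poly ltn_ord inS coef0.
move=> i l; case: (unliftP ord0 i) => [i'|] -> /=.
  by move=> la; apply: (Ql l la).2.
move=> lb; have [la|la] := ltnP l a; first exact: (Ql l la).1.
by apply: Q0; rewrite mem_pts; lia.
Qed.

End Step.

(** * Gradings and retracts *)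

Section Gradings.

Definition hcomp (M : zmodType) (g : int -> M -> Prop) (gg : is_grading g) :=
  projT1 (cid (grading_proj gg)).

Section Component.
Variables (M : zmodType) (g : int -> M -> Prop) (gg : is_grading g).

Lemma hcompD d x y : hcomp gg d (x + y) = hcomp gg d x + hcomp gg d y.
Proof. by rewrite /hcomp; case: cid => D []. Qed.

Lemma hcomp_deg d x : g d (hcomp gg d x).
Proof. by rewrite /hcomp; case: cid => D []. Qed.

Lemma hcomp_id d x : g d x -> hcomp gg d x = x.
Proof. by rewrite /hcomp; case: cid => D [_ _ H _ _] /=; apply: H. Qed.

Lemma hcomp_ne d e x : g e x -> e <> d -> hcomp gg d x = 0.
Proof. by rewrite /hcomp; case: cid => D [_ _ _ H _] /=; apply: H. Qed.

Lemma hcomp_sum x : exists r : seq int, [/\ uniq r,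
  forall d, d \notin r -> hcomp gg d x = 0 & \sum_(d <- r) hcomp gg d x = x].
Proof. by rewrite /hcomp; case: cid => D [_ _ _ _ H] /=; apply: H. Qed.

Lemma hcomp0 d : hcomp gg d 0 = 0.
Proof. by apply: hcomp_id; apply: grading0. Qed.

Lemma hcomp_bigsum d (J : Type) (r : seq J) (P : pred J) (F : J -> M) :
  hcomp gg d (\sum_(i <- r | P i) F i) = \sum_(i <- r | P i) hcomp gg d (F i).
Proof. exact: (big_morph _ (hcompD d) (hcomp0 d)). Qed.

End Component.

Lemma hcomp_hom (M N : zmodType) g h (gg : @is_grading M g) (hh : @is_grading N h)
    (f : M -> N) r : {morph f : x y / x + y} ->
  (forall i x, g i x -> h (i + r) (f x)) ->
  forall d x, hcomp hh (d + r) (f x) = f (hcomp gg d x).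
Proof.
move=> fD fdeg d x.
have f0 : f 0 = 0 by apply: (@addrI _ (f 0)); rewrite -fD !addr0.
have [s [us s0 sx]] := hcomp_sum gg x.
rewrite -{1}sx (big_morph f fD f0) hcomp_bigsum.
have [ds|ds] := boolP (d \in s).
  rewrite (bigD1_seq d) //= hcomp_id; last exact: fdeg (hcomp_deg _ _ _).
  rewrite big1 ?addr0 // => e ed; apply: hcomp_ne (fdeg _ _ (hcomp_deg _ _ _)) _.
  by move/addIr => e'; rewrite e' eqxx in ed.
rewrite s0 // f0 big_seq big1 // => e es.
apply: hcomp_ne (fdeg _ _ (hcomp_deg _ _ _)) _.
by move/addIr => ed; rewrite ed (negPf ds) in es.
Qed.

(** By injectivity, as [f] commutes with the homogeneous components. *)
Lemma deg_reflect (M N : zmodType) g h (gg : @is_grading M g) (hh : @is_grading N h)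
    (f : M -> N) : {morph f : x y / x + y} -> injective f ->
  (forall i x, g i x -> h i (f x)) -> forall i x, h i (f x) -> g i x.
Proof.
move=> fD fI fdeg i x hx.
have fdeg' j y : g j y -> h (j + 0) (f y) by rewrite addr0; apply: fdeg.
have <- : hcomp gg i x = x; last exact: hcomp_deg.
apply: fI; have := hcomp_hom gg hh fD fdeg' i x.
by rewrite addr0 => <-; rewrite hcomp_id.
Qed.

(** Preserving degrees means commuting with the homogeneous components, a
    condition additive in the argument. *)
Lemma deg_of_span (M N : zmodType) g h (gg : @is_grading M g) (hh : @is_grading N h)
    (f : M -> N) : {morph f : x y / x + y} ->
  (forall S : M -> Prop, S 0 -> (forall x y, S x -> S y -> S (x + y)) ->
    (forall i x, g i x -> h i (f x) -> S x) -> forall x, S x) ->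
  forall i x, g i x -> h i (f x).
Proof.
move=> fD span i x gx.
have f0 : f 0 = 0 by apply: (@addrI _ (f 0)); rewrite -fD !addr0.
rewrite -[x](hcomp_id gg gx) (_ : f _ = hcomp hh i (f x)); first exact: hcomp_deg.
apply: (span (fun x => f (hcomp gg i x) = hcomp hh i (f x))) => [|y z ey ez|e y ge he].
- by rewrite f0 !hcomp0.
- by rewrite fD !hcompD fD ey ez.
have [<-|/eqP ne] := eqVneq e i; first by rewrite !hcomp_id.
by rewrite (hcomp_ne _ ge) // (hcomp_ne _ he).
Qed.

(** A subgroup containing the homogeneous components of its elements is graded. *)
Lemma sub_grading (L M : zmodType) g (gg : @is_grading M g) (f : L -> M) :
  {morph f : x y / x + y} -> injective f ->
  (forall d x, exists y, f y = hcomp gg d (f x)) ->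
  is_grading (fun d x => g d (f x)).
Proof.
move=> fD fI comp.
have f0 : f 0 = 0 by apply: (@addrI _ (f 0)); rewrite -fD !addr0.
have fN x : f (- x) = - f x by apply: (@addrI _ (f x)); rewrite -fD !subrr.
have [c cE] := choice (fun p : int * L => comp p.1 p.2); split.
- by move=> d; rewrite f0; apply: grading0.
- by move=> d x y gx gy; rewrite fD fN; apply: gradingB.
- move=> x; have [r [_ _ rx]] := hcomp_sum gg (f x).
  exists [seq (d, c (d, x)) | d <- r]; split.
    by move=> _ /mapP[d _ ->] /=; rewrite cE; apply: hcomp_deg.
  apply: fI; rewrite big_map (big_morph f fD f0) -[LHS]rx.
  by apply: eq_bigr => d _; rewrite cE.
- apply: (@grading_proj_indep L (fun d x => g d (f x)) (fun d x => c (d, x)))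
    => [d x y|d x gx|d e x gx ed];
    apply: fI; rewrite ?fD !cE /=.
  + by rewrite fD hcompD.
  + exact: hcomp_id.
  + by rewrite f0; apply: hcomp_ne gx ed.
Qed.

End Gradings.

Section BimodIso.
Variables (A B : gring).
Implicit Types M N : gbimod A B.

Lemma bij_gbimod_iso M N (f : gbimod_hom M N) : bijective (sval f) ->
  exists g : gbimod_hom N M, cancel (sval f) (sval g) /\ cancel (sval g) (sval f).
Proof.
case=> g fg gf; have [fD fl fr fdeg] := svalP f; have fI := can_inj fg.
have hg : is_gbimod_hom g.
  split=> [x y|a x|x b|i x xi]; try by apply: fI; rewrite ?(fD, fl, fr) !gf.
  apply: (deg_reflect (bm_grading M) (bm_grading N) fD fI fdeg).
  by rewrite gf.
by exists (exist _ g hg).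
Qed.

Lemma bij_gbimod_is_iso M N (f : gbimod_hom M N) : bijective (sval f) ->
  @is_iso (gbimod_cat A B) M N f.
Proof.
move=> /bij_gbimod_iso[g [fg gf]]; exists g.
by split; apply: sval_inj; apply: funext => x /=; rewrite ?fg ?gf.
Qed.

Lemma gbimod_isomorphicP M N : (exists f : gbimod_hom M N, bijective (sval f)) ->
  @isomorphic (gbimod_cat A B) M N.
Proof. by case=> f /bij_gbimod_is_iso; exists f. Qed.

Lemma isomorphic_gbimod M N : @isomorphic (gbimod_cat A B) M N ->
  exists (f : gbimod_hom M N) (g : gbimod_hom N M),
    cancel (sval f) (sval g) /\ cancel (sval g) (sval f).
Proof.
case=> f [g [gf fg]]; exists f, g; split=> x.
  by have := congr1 (fun h => sval h x) gf.
by have := congr1 (fun h => sval h x) fg.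
Qed.

Definition retract M N : Prop := exists (i : gbimod_hom M N) (p : gbimod_hom N M),
  cancel (sval i) (sval p).

Lemma retract_refl M : retract M M.
Proof. by exists (gbimod_id M), (gbimod_id M). Qed.

Lemma retract_trans M N P : retract M N -> retract N P -> retract M P.
Proof.
move=> [i [p ip]] [j [q jq]]; exists (gbimod_cmp j i), (gbimod_cmp p q) => x /=.
by rewrite jq ip.
Qed.

Lemma retract_iso M N : @isomorphic (gbimod_cat A B) M N -> retract M N.
Proof. by case/isomorphic_gbimod=> f [g [fg _]]; exists f, g. Qed.

Lemma dsum_inl_hom M N : is_gbimod_hom (fun x : M => (x, 0) : dsum M N).
Proof.
have bN := @bm_bimodule _ _ N.
have l0 (a : A) : lact a (0 : N) = 0.
  by apply: (@addrI _ (lact a (0 : N))); rewrite -(lactDr bN) !addr0.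
have r0 (b : B) : ract (0 : N) b = 0.
  by apply: (@addrI _ (ract (0 : N) b)); rewrite -(ractDl bN) !addr0.
split=> [x y|a x|x b|i x xi] /=; rewrite ?l0 ?r0 //.
  by congr pair; rewrite addr0.
by split=> //; apply: grading0 (bm_grading N) i.
Qed.

Lemma retract_dsuml M N : retract M (dsum M N).
Proof.
have hp : is_gbimod_hom (fun x : dsum M N => x.1) by split=> // i x [].
by exists (exist _ _ (dsum_inl_hom M N)), (exist _ _ hp).
Qed.

Lemma retract_dsum M M' N N' : retract M N -> retract M' N' ->
  retract (dsum M M') (dsum N N').
Proof.
move=> [i [p ip]] [i' [p' ip']].
have hom2 (X X' Y Y' : gbimod A B) (f : gbimod_hom X Y) (f' : gbimod_hom X' Y') :
    is_gbimod_hom (fun x : dsum X X' => (sval f x.1, sval f' x.2) : dsum Y Y').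
  case: f f' => f [fD fl fr fd] [f' [fD' fl' fr' fd']].
  split=> [x y|a x|x b|e x []] /=; rewrite ?fD ?fD' ?fl ?fl' ?fr ?fr' //.
  by move=> /fd ? /fd'.
exists (exist _ _ (hom2 _ _ _ _ i i')), (exist _ _ (hom2 _ _ _ _ p p')).
by case=> x x' /=; rewrite ip ip'.
Qed.

Lemma direct_summand_retract M N : direct_summand M N -> retract M N.
Proof.
case=> Y /isomorphic_gbimod[f [g [fg gf]]].
by apply: retract_trans (retract_dsuml M Y) _; exists g, f.
Qed.

Lemma direct_summand_refl M : direct_summand M M.
Proof.
exists (gbimod0 A B); apply: gbimod_isomorphicP.
exists (exist _ _ (dsum_inl_hom M (gbimod0 A B))); exists fst => // -[x y] /=.
by rewrite [y]thinmx0 [X in (_, X)]thinmx0.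
Qed.

Lemma retract_shift M N r : retract M N -> retract (shift r M) (shift r N).
Proof.
have hs (X Y : gbimod A B) (f : gbimod_hom X Y) :
    is_gbimod_hom (sval f : shift r X -> shift r Y).
  by case: f => f [fD fl fr fd]; split=> // i x /fd.
by move=> [i [p ip]]; exists (exist _ _ (hs _ _ i)), (exist _ _ (hs _ _ p)).
Qed.

End BimodIso.

Section GmodIso.
Variable B : gring.
Implicit Types M : gmod B.

Lemma bij_gmod_iso M (M' : gmod B) (f : gmod_hom M M') : bijective (sval f) ->
  @is_iso (gmod_cat B) M M' f.
Proof.
case=> g fg gf; have [lf df] := svalP f.
have fD : {morph sval f : x y / x + y} by move=> x y; have := lf 1 x y; rewrite !scale1r.
have lg : linear g by move=> a x y; apply: (can_inj fg); rewrite gf lf !gf.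
have dg i x : gm_deg i x -> gm_deg i (g x).
  move=> ix; apply: (deg_reflect (gm_grading M) (gm_grading M') fD (can_inj fg) df).
  by rewrite gf.
exists (exist _ g (conj lg dg)).
by split; apply: sval_inj; apply: funext => x /=; rewrite ?fg ?gf.
Qed.

End GmodIso.

Section GRetract.
Variable B : gring.

Definition gretract (M M' : gmod B) : Prop :=
  exists (i : gmod_hom M M') (p : gmod_hom M' M), cancel (sval i) (sval p).

Lemma gretract_fin_gen (M M' : gmod B) : gretract M M' -> fin_gen M' -> fin_gen M.
Proof.
move=> [i [p ip]] [m [v gv]]; exists m, (fun s => sval p (v s)) => x.
have [a ea] := gv (sval i x); exists a; rewrite -[LHS]ip ea; have [lp _] := svalP p.
have pD : {morph sval p : x y / x + y} by move=> y z; have := lp 1 y z; rewrite !scale1r.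
have p0 : sval p 0 = 0 by apply: (@addrI _ (sval p 0)); rewrite -pD !addr0.
rewrite (big_morph _ pD p0); apply: eq_bigr => s _.
by have := lp (a s) (v s) 0; rewrite p0 !addr0.
Qed.

Lemma gretract_gproj (M M' : gmod B) : gretract M M' -> gproj M' -> gproj M.
Proof.
move=> [i [p ip]] pM' M1 M2 q f qs; have [g gE] := pM' M1 M2 q (gmod_cmp f p) qs.
exists (gmod_cmp g i); apply: sval_inj; apply: funext => x /=.
have /(congr1 (fun h : gmod_hom _ _ => sval h (sval i x))) /= := gE.
by rewrite ip.
Qed.

End GRetract.


(** * Operations on sums of cyclic bimodules *)

Section BasedOps.
Variables (k : fieldType) (n : nat).
Local Notation N := n.+1.
Local Notation R := {mpoly k[N]}.
Local Notation hat := (hat1 N).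
Local Notation bimod I := (gbimod (RI k I) (RI k hat)).
Implicit Types (I K : {set 'I_N.-1}).

Lemma zscale_degC I (M : bimod I) (c : invring k I) (x : zm M) i e :
  pdeg i (val c) -> bm_deg e (x : M) -> bm_deg (i + e) (c%:P *: x : M).
Proof. by move=> ci xe; rewrite zscaleC; apply: bm_degl. Qed.

Lemma pdeg_X (l : 'I_N) : pdeg 2 ('X_l : R).
Proof. by have := pdeg_homog (p := 'X_l : R) (d := 1); apply; rewrite dhomogX /= mdeg1. Qed.

Lemma zscale_degX I (M : bimod I) (x : zm M) e :
  bm_deg e (x : M) -> bm_deg (e + 2) ('X *: x : M).
Proof. by move=> xe; rewrite zscaleX; apply: bm_degr => //; apply: pdeg_X. Qed.

Lemma based_transport I (M M' : bimod I) (f : gbimod_hom M M')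
    (T : finType) (j : T -> nat) d (v : T -> zm M) :
  bijective (sval f) -> based j d v -> based j d (fun t => sval f (v t) : zm M').
Proof.
case=> g fg gf bM; have [fD _ _ fdeg] := svalP f.
have f0 : sval f 0 = 0 by apply: (@addrI _ (sval f 0)); rewrite -fD !addr0.
have fsum (P : T -> {poly invring k I}) :
    sval f (\sum_t P t *: v t) = \sum_t P t *: (sval f (v t) : zm M').
  rewrite (big_morph (sval f) fD f0); apply: eq_bigr => t _; exact: hom_zscale.
split.
- exact: based_bdry bM.
- exact: based_le bM.
- by move=> t; apply: fdeg; apply: based_deg bM t.
- move=> x; have [P eP] := based_span bM (g x); exists P.
  by rewrite -fsum -eP gf.
- move=> P; rewrite -(based_rel bM) -fsum; split=> [/(congr1 g)|->//].
  by rewrite fg => ->; rewrite -{1}f0 fg.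
Qed.

Lemma based_reindex I (M : bimod I) (T T' : finType)
    (h : T' -> T) (j : T -> nat) d (v : T -> zm M) :
  bijective h -> based j d v -> based (j \o h) (d \o h) (v \o h).
Proof.
case=> h' hK h'K bM.
have bh : {on [pred i | xpredT i], bijective h} by exists h' => x _.
have sumE (P : T -> {poly invring k I}) :
    \sum_t P t *: v t = \sum_t P (h t) *: v (h t).
  by rewrite (reindex _ bh).
split.
- by move=> t; apply: based_bdry bM (h t).
- by move=> t; apply: based_le bM (h t).
- by move=> t; apply: based_deg bM (h t).
- move=> x; have [P ->] := based_span bM x; exists (P \o h); exact: sumE.
- move=> P; have := based_rel bM (P \o h'); rewrite sumE /=.
  under eq_bigr do rewrite hK.
  move=> ->; split=> H t l lt; last by apply: H; rewrite /= h'K.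
  by have := H (h t) l lt; rewrite hK.
Qed.

(** The generators with exponent 0 vanish. *)
Lemma based_cyclic I (M : bimod I) (T : finType)
    (j : T -> nat) d (v : T -> zm M) (t0 : T) :
  (forall t, t != t0 -> j t = 0%N) -> based j d v ->
  based (fun _ : unit => j t0) (fun _ => d t0) (fun _ => v t0).
Proof.
move=> j0 bM.
have sumE (P : T -> {poly invring k I}) : \sum_t P t *: v t = P t0 *: v t0.
  rewrite (bigD1 t0) //= big1 ?addr0 // => t /j0 jt; apply: (based_kill bM).
  by move=> l; rewrite jt.
have sumU (F : unit -> zm M) : \sum_t F t = F tt.
  by rewrite (bigD1 tt) //= big1 ?addr0 // => -[].
split.
- by move=> _; apply: based_bdry bM t0.
- by move=> _; apply: based_le bM t0.
- by move=> _; apply: based_deg bM t0.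
- move=> x; have [P ->] := based_span bM x; exists (fun _ => P t0).
  by rewrite sumU sumE.
- move=> P; rewrite sumU; split=> [H [] l lt|H].
    exact: (based_coord bM) H l lt.
  by apply: (based_kill bM) => l lt; apply: (H tt).
Qed.

(** As a left module over itself [R^hat1] is [R^hat1[z]/(z - x_0)]. *)
Lemma based_regular : based (M := regular_gbimod (RI k hat))
  (fun _ : unit => 1%N) (fun _ => 0) (fun _ => (1 : RI k hat)).
Proof.
have sumU (F : unit -> zm (regular_gbimod (RI k hat))) : \sum_t F t = F tt.
  by rewrite (bigD1 tt) //= big1 ?addr0 // => -[].
have pE (P : {poly invring k hat}) :
    val (P *: (1 : zm (regular_gbimod (RI k hat))) : invring k hat) = evl ord0 P.
  elim/poly_ind: P => [|P c IH]; first by rewrite scale0r evl0.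
  rewrite scalerDl mulrC -scalerA zscaleX evlD evlM evlX evlC -IH zscaleC.
  transitivity (val ((P *: (1 : zm (regular_gbimod (RI k hat))) : invring k hat) * x0 k n + c * 1)).
    by [].
  by rewrite mulr1 rmorphD rmorphM mulrC.
split.
- by move=> _ i; rewrite inE; lia.
- by [].
- by move=> _; apply: (@gr_deg1 (RI k hat)).
- move=> x; exists (fun _ => (x : invring k hat)%:P); rewrite sumU zscaleC.
  by rewrite /= mulr1.
- move=> P; rewrite sumU; split=> [P0 [] l|P0].
    rewrite ltnS leqn0 => /eqP l0; have -> : l = ord0 by apply: val_inj.
    by rewrite -pE P0.
  by apply: val_inj; rewrite [LHS]pE (P0 tt).
Qed.

(** Restriction from [R^(K\a)] to [R^K] splits each cyclic summand along [gen]. *)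
Lemma based_step K (a b : 'I_N) (M : bimod (split_off K a))
    (T : finType) (j : T -> nat) d (v : T -> zm M) : block K a b -> based j d v ->
  exists v', based
    (M := restrict (RI_incl k (split_off_sub K a)) (gring_id _) M)
    (fun ti : T * 'I_(size (pts a b)).-1.+1 => newj a b (j ti.1) ti.2)
    (fun ti => d ti.1 + (2 * ti.2)%:Z) v'.
Proof.
move=> Kab bM; have [ab abK bK] := Kab; pose IK := split_off_sub K a.
pose M' := restrict (RI_incl k IK) (gring_id _) M.
exists (fun ti : T * 'I_(size (pts a b)).-1.+1 =>
  (gen k Kab (j ti.1 == a.+1) ti.2 *: v ti.1 : M) : zm M').
have sumE (Q : T * 'I_(size (pts a b)).-1.+1 -> {poly invring k K}) :
    \sum_ti Q ti *: ((gen k Kab (j ti.1 == a.+1) ti.2 *: v ti.1 : M) : zm M') =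
    \sum_t (\sum_i map_poly (iincl IK) (Q (t, i)) * gen k Kab (j t == a.+1) i) *: v t :> M.
  rewrite (eq_bigr (fun ti => map_poly (iincl IK) (Q (ti.1, ti.2)) *:
     (gen k Kab (j ti.1 == a.+1) ti.2 *: v ti.1) : zm M')); last first.
    by move=> [t i] _; rewrite zscale_restrict.
  rewrite -(pair_bigA _ (fun t i => map_poly (iincl IK) (Q (t, i)) *:
     (gen k Kab (j t == a.+1) i *: v t) : zm M')) /=.
  apply: eq_bigr => t _; rewrite scaler_suml.
  by apply: eq_bigr => i _; rewrite scalerA.
have Xadeg i : pdeg (2 * i)%:Z (val (xa k Kab ^+ i)).
  have ha : ('X_a : R) \is 1.-homog by rewrite dhomogX /= mdeg1.
  by rewrite rmorphXn /=; have /pdeg_homog := dhomogMn i ha; rewrite mul1n.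
split.
- move=> [t i] i' i'K /=; rewrite /newj; have [jb ja] := bK _ i'K.
  case: (eqVneq (j t) a.+1) => [_|nj]; first by case: ifP.
  have [ea|na] := eqVneq (i' : nat) a; first by rewrite ea eq_sym.
  by apply: (based_bdry bM t); rewrite inE i'K.
- move=> [t i] /=; rewrite /newj; case: eqP => [_|_]; last exact: based_le bM t.
  by case: ifP => _; [apply: ltn_ord | apply: ltnW].
- move=> [t i] /=; rewrite /gen; case: ifP => [/andP[_ i0]|_]; last first.
    by rewrite addrC; apply: zscale_degC => //; apply: based_deg bM t.
  have -> : d t + (2 * i)%:Z = (2 * i.-1)%:Z + (d t + 2) by lia.
  rewrite -scalerA; apply: zscale_degC => //.
  rewrite scalerBl; apply: (gradingB (bm_grading M)).
    exact/zscale_degX/(based_deg bM).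
  by rewrite addrC; apply: zscale_degC; [apply: pdeg_X | apply: based_deg bM t].
- move=> x; have [P eP] := based_span bM (x : M).
  have /choice[Q QE] := fun t => gen_span Kab (j t == a.+1) (P t).
  exists (fun ti => Q ti.1 ti.2); rewrite sumE eP.
  by apply: eq_bigr => t _; rewrite {1}QE.
- move=> Q; rewrite sumE (based_rel bM); split=> [H [t i]|H t l].
    exact: (proj1 (gen_rel Kab (fun i => Q (t, i)) (based_bdry bM t)) (H t) i).
  exact: (proj2 (gen_rel Kab (fun i => Q (t, i)) (based_bdry bM t)) (fun i => H (t, i))) l.
Qed.

Lemma based_dsum I (M M' : bimod I) (T T' : finType)
    (j : T -> nat) (j' : T' -> nat) d d' (v : T -> zm M) (v' : T' -> zm M') :
  based j d v -> based j' d' v' ->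
  based (M := dsum M M') (fun t => match t with inl t => j t | inr t => j' t end)
    (fun t => match t with inl t => d t | inr t => d' t end)
    (fun t => match t with inl t => (v t : M, 0) | inr t => (0, v' t : M') end).
Proof.
move=> bM bM'.
have pE (P : {poly invring k I}) (x : M) (y : M') :
    P *: ((x, y) : zm (dsum M M')) = (P *: (x : zm M) : M, P *: (y : zm M') : M') :> dsum M M'.
  elim/poly_ind: P x y => [|P c IH] x y; first by rewrite !scale0r.
  rewrite !scalerDl -!scalerA [LHS]/(_ + _) zscaleX zscaleC.
  by rewrite IH !zscaleX !zscaleC.
have sumE (P : T + T' -> {poly invring k I}) :
   \sum_t P t *: (match t with inl t => (v t : M, 0) | inr t => (0, v' t : M') end
       : zm (dsum M M')) =
   (\sum_t P (inl t) *: v t : M, \sum_t P (inr t) *: v' t : M') :> dsum M M'.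
  rewrite big_sumType /=.
  rewrite (eq_bigr (fun t => (P (inl t) *: v t, 0) : M * M')); last first.
    by move=> t _; rewrite pE scaler0.
  rewrite [X in _ + X](eq_bigr (fun t => (0, P (inr t) *: v' t) : M * M')); last first.
    by move=> t _; rewrite pE scaler0.
  have sl (F : T -> M) : \sum_t (F t, 0 : M') = (\sum_t F t, 0).
    by rewrite [LHS]surjective_pairing; congr pair; rewrite raddf_sum // big1.
  have sr (F : T' -> M') : \sum_t (0 : M, F t) = (0, \sum_t F t).
    by rewrite [LHS]surjective_pairing; congr pair; rewrite raddf_sum // big1.
  by rewrite sl sr; congr pair; rewrite ?addr0 ?add0r.
split.
- by case=> t; [apply: based_bdry bM t | apply: based_bdry bM' t].
- by case=> t; [apply: based_le bM t | apply: based_le bM' t].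
- case=> t; split=> /=; [exact: based_deg bM t|exact: grading0 (bm_grading _) _|
    exact: grading0 (bm_grading _) _|exact: based_deg bM' t].
- case=> x y; have [P eP] := based_span bM x; have [Q eQ] := based_span bM' y.
  exists (fun t => match t with inl t => P t | inr t => Q t end).
  by rewrite sumE -eP -eQ.
- move=> P; rewrite sumE; split=> [[/(based_rel bM) H /(based_rel bM') H']|H].
    by case=> t l lt; [apply: H | apply: H'].
  congr pair; [apply/(based_rel bM) => t | apply/(based_rel bM') => t].
    exact: (H (inl t)).
  exact: (H (inr t)).
Qed.

Lemma based0 I : based (M := gbimod0 (RI k I) (RI k hat))
  (fun t : void => 0%N) (fun _ => 0) (fun _ => 0).
Proof.
split=> //; try by case.
- move=> x; exists (fun _ => 0); rewrite [LHS]thinmx0; exact/esym/thinmx0.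
- by move=> P; split=> [_ []|_]; exact: thinmx0.
Qed.

Lemma based_shift I (M : bimod I) (T : finType) r
    (j : T -> nat) d (v : T -> zm M) : based j d v ->
  based (M := shift r M) j (fun t => d t + r) (fun t => v t : M).
Proof.
have pE P (x : M) : P *: (x : zm (shift r M)) = P *: (x : zm M) :> M.
  elim/poly_ind: P x => [|P c IH] x; first by rewrite !scale0r.
  by rewrite !scalerDl -!scalerA; congr (_ + _); rewrite ?zscaleC // IH !zscaleX.
have sumE P : \sum_t P t *: (v t : zm (shift r M)) = \sum_t P t *: v t :> M.
  by apply: eq_bigr => t _; apply: pE.
move=> bM; split.
- exact: based_bdry bM.
- exact: based_le bM.
- by move=> t /=; rewrite addrK; apply: based_deg bM t.
- by move=> x; have [P eP] := based_span bM x; exists P; rewrite sumE.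
- by move=> P; rewrite sumE; apply: based_rel bM P.
Qed.

End BasedOps.

(** * Bott-Samelson and Soergel bimodules *)

Section BottSamelson.
Variables (k : fieldType) (n : nat).
Local Notation N := n.+1.
Local Notation R := {mpoly k[N]}.
Local Notation hat := (hat1 N).
Local Notation bimod I := (gbimod (RI k I) (RI k hat)).
Implicit Types (I J K : {set 'I_N.-1}).

Lemma block_exists K (i : 'I_N.-1) : i \in K -> (forall i', i' \in K -> i <= i')%N ->
  exists a b : 'I_N, block K a b /\ a = i :> nat.
Proof.
move=> iK imin.
have ex : exists c, (i <= c)%N && [forall i' : 'I_N.-1, (i' == c :> nat) ==> (i' \notin K)].
  exists n; apply/andP; split; first by have := ltn_ord i => /=; lia.
  apply/forallP => i'; apply/implyP => /eqP e.
  by have := ltn_ord i'; rewrite e /= ltnn.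
have [c /andP[ic /forallP cK] cmin] := ex_minnP ex.
have cN : (c <= n)%N.
  apply: cmin; apply/andP; split; first by have := ltn_ord i => /=; lia.
  apply/forallP => i'; apply/implyP => /eqP e.
  by have := ltn_ord i'; rewrite e /= ltnn.
have iN : (i < N)%N by apply: leq_trans (ltn_ord i) _.
exists (Ordinal iN), (Ordinal (cN : (c < N)%N)); split=> //; split=> //= [j|j jK].
  move=> /andP[ij jc]; apply: contraLR jc => jK; rewrite -leqNgt; apply: cmin.
  rewrite ij; apply/forallP => j'; apply/implyP => /eqP/val_inj->; exact: jK.
split; last by apply/eqP => /= e; have := imin _ jK; rewrite -e ltnn.
by apply: contraTneq jK => e; have := cK j; rewrite e eqxx.
Qed.

(** Parabolic subgroups are built up by adding simple reflections at the left
    end of an orbit. *)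
Lemma parabolic_ind (P : {set 'I_N.-1} -> Prop) : P set0 ->
  (forall K (a b : 'I_N), block K a b -> P (split_off K a) -> P K) -> forall K, P K.
Proof.
move=> P0 PS K; have [m] := ubnP #|K|; elim: m K => // m IH K Km.
have [->//|[i iK]] := set_0Vmem K.
have [i0 i0K imin] := arg_minnP (fun i : 'I_N.-1 => i : nat) iK.
have [a [b [Kab ai]]] := block_exists i0K imin.
apply: (PS K a b Kab); apply: IH; apply: leq_trans (_ : #|K| <= m)%N => //.
apply: proper_card; rewrite properE split_off_sub; apply/subsetPn; exists i0 => //.
by rewrite inE ai eqxx andbF.
Qed.

Lemma based_restrict_comp I J K (IJ : I \subset J) (JK : J \subset K) (IK : I \subset K)
    (M : bimod I) (T : finType) (j : T -> nat) d v :
  based (M := restrict (RI_incl k JK) (gring_id _)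
                (restrict (RI_incl k IJ) (gring_id _) M)) j d v ->
  based (M := restrict (RI_incl k IK) (gring_id _) M) j d (v : T -> M).
Proof.
set M1 := restrict _ _ _; set M2 := restrict _ _ M => bM.
have h : is_gbimod_hom (fun x : M1 => x : M2).
  split=> // a x /=; congr (lact _ _); exact: val_inj.
have hb : bijective (sval (exist _ _ h : gbimod_hom M1 M2)) by exists id.
exact: (based_transport hb bM).
Qed.

(** The reflections of [K] are added one at a time. *)
Lemma based_restrict K (M : bimod set0) (T : finType)
    (j : T -> nat) d (v : T -> zm M) : based j d v ->
  exists (T' : finType) (j' : T' -> nat) (d' : T' -> int) v',
    based (M := restrict (RI_incl k (sub0set K)) (gring_id _) M) j' d' v'.
Proof.
move=> bM; elim/parabolic_ind: K => [|K a b Kab [T' [j' [d' [v' bM']]]]].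
  exists T, j, d, v; set M' := restrict _ _ _.
  have h : is_gbimod_hom (fun x : M => x : M').
    split=> // c x /=; congr (lact _ _); exact: val_inj.
  have hb : bijective (sval (exist _ _ h : gbimod_hom M M')) by exists id.
  exact: (based_transport hb bM).
have [v'' bM''] := based_step Kab bM'.
exists (T' * 'I_(size (pts a b)).-1.+1)%type; do 3!eexists.
exact: based_restrict_comp bM''.
Qed.

(** [R^K] is a graded direct summand of [R] as an [R^K]-module: [R^(K\a)] is free
    over [R^K] on powers of [x_a], and the projection takes the constant coefficient. *)
Lemma invariant_retract K : exists pi : R -> R,
  [/\ forall p, pi p \in Defs.invariant K, {morph pi : p q / p + q},
      forall c p, c \in Defs.invariant K -> pi (c * p) = c * pi p, pi 1 = 1 &
      forall e p, pdeg e p -> pdeg e (pi p)].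
Proof.
elim/parabolic_ind: K => [|K a b Kab [pi [piI piD piM pi1 pid]]].
  exists id; split=> // p; apply: invariant_refl => j; by rewrite inE.
pose I := split_off K a.
have aab : a \in pts a b by rewrite mem_pts leqnn; case: Kab.
have /choice[P PP] (p : invring k I) : exists P : {poly invring k K},
    [/\ (size P <= size (pts a b))%N, evl a P = val p & forall e, pdeg e (val p) -> hpoly e P].
  have [P sP PE] := interpolate Kab (valP p); exists P.
  split=> // [|e pe]; first by rewrite PE // tperm1 msym1m.
  have [Q [sQ hQ] QE] := interpolate_homog Kab (valP p) pe.
  by suff -> : P = Q by []; apply: (evl_uniq Kab) => //; rewrite PE ?QE.
have PU (p : invring k I) (Q : {poly invring k K}) :
    (size Q <= size (pts a b))%N -> evl a Q = val p -> P p = Q.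
  by move=> sQ Qp; have [sP Pp _] := PP p; apply: (evl_uniq Kab); rewrite ?Pp.
pose c0 (p : invring k I) : R := val (P p)`_0.
have c0D p q : c0 (p + q) = c0 p + c0 q.
  have [sp ep _] := PP p; have [sq eq _] := PP q.
  rewrite /c0 (PU (p + q) (P p + P q)) ?coefD ?rmorphD //.
    by apply: leq_trans (size_polyD _ _) _; rewrite geq_max sp.
  by rewrite evlD ep eq.
have c0M (c : invring k K) p : c0 (iincl (split_off_sub K a) c * p) = val c * c0 p.
  have [sp ep _] := PP p.
  rewrite /c0 (PU _ (c%:P * P p)) ?coefCM ?rmorphM //.
    by rewrite mul_polyC; apply: leq_trans (size_scale_leq _ _) _.
  by rewrite evlM evlC ep.
exists (fun p => c0 (InvRing (piI p))); split=> [p|p q|c p cK||e p pe].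
- exact: valP.
- by rewrite -c0D; congr c0; apply: val_inj; rewrite /= piD.
- rewrite -[c in RHS]/(val (InvRing cK : invring k K)) -c0M; congr c0.
  by apply: val_inj; rewrite /= piM //; apply: (invariantS (split_off_sub K a)).
- rewrite /c0 (PU _ 1) ?coef1 ?rmorph1 //.
    by rewrite size_poly1; case: (pts a b) aab.
  by rewrite evl1 /= pi1.
- rewrite /c0; have [_ _ /(_ e)] := PP (InvRing (piI p)).
  move=> /(_ (pid _ _ pe)) /(_ 0%N); by rewrite muln0 subr0.
Qed.

Lemma central_restrict I K (IK : I \subset K) (M : bimod I) :
  central M -> central (restrict (RI_incl k IK) (gring_id _) M).
Proof.
move=> cM c x /=; rewrite -[RHS]cM; congr (lact _ _); exact: val_inj.
Qed.

Lemma central_tensor I K (IK : I \subset K) (M : bimod K) :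
  central M -> central (tensor_gbimod
    (restrict (gring_id (RI k I)) (RI_incl k IK) (regular_gbimod (RI k I))) M).
Proof.
move=> cM c; elim/tensorW => s; rewrite [LHS]tlact_pi [RHS]tract_pi !tpi_sum.
rewrite !big_map; apply: eq_bigr => -[r x] _ /=; rewrite -cM -tens_bal /=.
congr (tens _ _); rewrite [LHS]mulrC; congr (_ * _); exact: val_inj.
Qed.

Lemma central_retract I (M M' : bimod I) :
  retract M M' -> central M' -> central M.
Proof.
move=> [i [p ip]] cM' c x; apply: (can_inj ip).
have [_ il ir _] := svalP i; by rewrite il ir cM'.
Qed.

Lemma central_dsum I (M M' : bimod I) :
  central M -> central M' -> central (dsum M M').
Proof. by move=> cM cM' c [x y] /=; rewrite cM cM'. Qed.

Section TensorHom.
Variables (A B C : gring) (L : gbimod A B) (M M' : gbimod B C).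

Lemma lact_tens a (x : L) (y : M) :
  lact a (tens x y : tensor_gbimod L M) = tens (lact a x) y.
Proof. exact: tlact_pi. Qed.

Lemma ract_tens (x : L) (y : M) c :
  ract (tens x y : tensor_gbimod L M) c = tens x (ract y c).
Proof. exact: tract_pi. Qed.

Lemma tensor_hom (f : gbimod_hom M M') : exists
  F : gbimod_hom (tensor_gbimod L M) (tensor_gbimod L M'),
  forall x y, sval F (tens x y) = tens x (sval f y).
Proof.
have [fD fl fr fd] := svalP f.
have [|||F [FD FE]] := @tensor_lift _ _ _ L M (tensor L M') (fun x y => tens x (sval f y)).
- by move=> x x' y; rewrite tensDl.
- by move=> x y y'; rewrite fD tensDr.
- by move=> x b y; rewrite fl tens_bal.
have F0 : F 0 = 0 by apply: (@addrI _ (F 0)); rewrite -FD !addr0.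
have Fpi s : F (tpi s) = tpi [seq (p.1, sval f p.2) | p <- s].
  rewrite !tpi_sum (big_morph F FD F0) big_map; apply: eq_bigr => p _; exact: FE.
suff hF : @is_gbimod_hom _ _ (tensor_gbimod L M) (tensor_gbimod L M') F.
  by exists (exist _ F hF).
split=> //.
- move=> a; elim/tensorW => s; rewrite [lact a _]tlact_pi !Fpi [RHS]tlact_pi.
  by rewrite -!map_comp.
- move=> + c; elim/tensorW => s; rewrite [ract _ c]tract_pi !Fpi [RHS]tract_pi.
  rewrite -!map_comp; congr tpi; by apply: eq_map => p /=; rewrite fr.
- move=> i _ [s [-> hs]]; exists [seq (p.1, sval f p.2) | p <- s]; split=> //.
  move=> _ /mapP[p /hs[u [w [uw hu hw]]] ->]; exists u, w; split=> //; exact: fd.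
Qed.

Lemma tensor_eq (P : zmodType) (F G : tensor L M -> P) :
  {morph F : x y / x + y} -> {morph G : x y / x + y} ->
  (forall x y, F (tens x y) = G (tens x y)) -> F =1 G.
Proof.
move=> FD GD FG; elim/tensorW => s; rewrite tpi_sum.
have F0 : F 0 = 0 by apply: (@addrI _ (F 0)); rewrite -FD !addr0.
have G0 : G 0 = 0 by apply: (@addrI _ (G 0)); rewrite -GD !addr0.
by rewrite (big_morph F FD F0) (big_morph G GD G0); apply: eq_bigr => p _.
Qed.

End TensorHom.

Lemma retract_tensor (A B C : gring) (L : gbimod A B) (M M' : gbimod B C) :
  retract M M' -> retract (tensor_gbimod L M) (tensor_gbimod L M').
Proof.
move=> [i [p ip]]; have [F FE] := tensor_hom L i; have [G GE] := tensor_hom L p.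
exists F, G => x; have [FD _ _ _] := svalP F; have [GD _ _ _] := svalP G.
apply: (@tensor_eq _ _ _ L M _ (fun x => sval G (sval F x)) id) => // [y z|y z].
  by rewrite FD GD.
by rewrite FE GE ip.
Qed.

Definition based_summand I (M : bimod I) : Prop :=
  exists (M' : bimod I) (T : finType) (j : T -> nat) d
    (v : T -> zm M'), [/\ based j d v, central M' & retract M M'].

Lemma central_regular : central (regular_gbimod (RI k hat)).
Proof.
move=> c x /=; rewrite [LHS]mulrC; congr (_ * _); exact: val_inj.
Qed.

(** The projection of [R] onto [R^I] splits the map from [M] to the induced
    module. *)
Lemma retract_restrict I K (IK : I \subset K) (M : bimod I) :
  retract (restrict (RI_incl k IK) (gring_id _) M)
    (restrict (RI_incl k (sub0set K)) (gring_id _) (tensor_gbimod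
      (restrict (gring_id (RI k set0)) (RI_incl k (sub0set I)) (regular_gbimod (RI k set0))) M)).
Proof.
set L := restrict (gring_id _) _ _; set M1 := restrict _ _ M; set M2 := restrict _ _ _.
have bM := @bm_bimodule _ _ M.
have [pi [piI piD piM pi1 pid]] := invariant_retract I.
have hi : is_gbimod_hom (fun x : M1 => tens (1 : L) (x : M) : M2).
  split=> [x y|c x|x c|e x xe].
  - by rewrite tensDr.
  - rewrite [RHS]lact_tens -tens_bal; congr (tens _ _) => /=.
    by rewrite mul1r mulr1; apply: val_inj.
  - by rewrite [RHS]ract_tens.
  - exists [:: (1 : L, x : M)]; split=> // p /[!inE] /eqP-> /=.
    exists 0, e; split=> //; [by rewrite add0r | exact: (@gr_deg1 (RI k set0))].
pose piK (r : L) : invring k I := InvRing (piI (val (r : invring k set0))).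
have piKM (c : invring k I) (r : invring k set0) :
    piK (iincl (sub0set I) c * r) = c * piK r.
  by apply: val_inj; rewrite /= piM //; apply: valP.
have [|||H [HD HE]] := @tensor_lift _ _ _ L M M (fun r x => lact (piK r : RI k I) x).
- move=> r r' x; rewrite -(lactDl bM); congr (lact _ _).
  by apply: val_inj; rewrite /= piD.
- by move=> r x y; rewrite (lactDr bM).
- move=> r c x; rewrite -(lactM bM); congr (lact _ _).
  by rewrite [ract r c]mulrC [RHS]mulrC; apply: piKM.
have H0 : H 0 = 0 by apply: (@addrI _ (H 0)); rewrite -HD !addr0.
have hH : is_gbimod_hom (H : M2 -> M1).
  split=> //.
  - move=> c; apply: tensor_eq => [x y|x y|r x].
    + by rewrite (lactDr (@bm_bimodule _ _ M2)) HD.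
    + by rewrite HD (lactDr (@bm_bimodule _ _ M1)).
    + rewrite [lact c _]lact_tens !HE /= -(lactM bM); congr (lact _ _).
      rewrite -[RHS]piKM; congr piK; congr (_ * _); exact: val_inj.
  - move=> x c; move: x; apply: tensor_eq => [x y|x y|r x].
    + by rewrite (ractDl (@bm_bimodule _ _ M2)) HD.
    + by rewrite HD (ractDl (@bm_bimodule _ _ M1)).
    + by rewrite [ract _ _]ract_tens !HE (lractA bM).
  - move=> e _ [s [-> hs]]; rewrite tpi_sum (big_morph H HD H0).
    apply: (grading_sum (bm_grading M)) => -[r x] rs _; rewrite HE.
    have [u [w [<- hu hw]]] := hs _ rs.
    apply: bm_degl hw; exact: pid.
exists (exist _ _ hi), (exist _ _ hH) => x /=; rewrite HE.
rewrite -[RHS](lact1 bM); congr (lact _ _); apply: val_inj; exact: pi1.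
Qed.

(** Restriction is understood for bimodules over [R] only; going up to [R] first
    replaces a bimodule by one of which it is a summand. *)
Lemma bott_samelson_summand I (M : bimod I) :
  bott_samelson M -> based_summand M.
Proof.
elim=> {I M} [|I K I' IK I'K M _ [M' [T [j [d [v [bM cM ret]]]]]]].
  exists (regular_gbimod (RI k hat)); do 4!eexists; split.
  - exact: based_regular.
  - exact: central_regular.
  - exact: retract_refl.
have bM0 := based_tensor (sub0set I') bM.
have [T1 [j1 [d1 [v1 bM1]]]] := based_restrict K bM0.
have bM2 := based_tensor IK bM1; do 5!eexists; split; first exact: bM2.
  by apply: central_tensor; apply: central_restrict; apply: central_tensor.
apply: retract_tensor; apply: retract_trans (retract_restrict I'K M') => {bM0 bM1 bM2 v1}.
have hr (X Y : bimod I') (f : gbimod_hom X Y) : is_gbimod_hom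
    (sval f : restrict (RI_incl k I'K) (gring_id _) X ->
      restrict (RI_incl k I'K) (gring_id _) Y).
  by case: f => f [fD fl fr fd]; split=> // a x /=; rewrite fl.
by case: ret => [i [p ip]]; exists (exist _ _ (hr _ _ i)), (exist _ _ (hr _ _ p)).
Qed.

(** [R[z]/prod_(l < j) (z - x_l)] is itself a Bott-Samelson bimodule:
    with [K] generated by the first [j - 1] simple reflections and [K1] by
    those of them that fix the first variable, it is [R (x)_(R^K) R^K1]. *)
Lemma cyclic_bott_samelson (j : nat) : (0 < j <= N)%N ->
  exists (M : bimod set0) (v : unit -> zm M),
    [/\ bott_samelson M, based (fun _ => j) (fun _ => 0) v & central M].
Proof.
move=> /andP[j0 jN]; have bN : (j.-1 < N)%N by lia.
pose b := Ordinal bN; pose K : {set 'I_N.-1} := [set i : 'I_N.-1 | (i < j.-1)%N].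
have Kb : block K ord0 b.
  split=> // i; first by rewrite inE.
  by rewrite inE => ij /=; split=> //; rewrite ltn_eqF.
have Khat : split_off K (ord0 : 'I_N) \subset hat.
  by apply/subsetP => i; rewrite !inE lt0n => /andP[].
pose Mr := restrict (RI_incl k (subxx hat)) (gring_id _) (regular_gbimod (RI k hat)).
have h0 : is_gbimod_hom (fun x : regular_gbimod (RI k hat) => x : Mr).
  split=> // c x /=; congr (_ * _); exact: val_inj.
have h0b : bijective (sval (exist _ _ h0 : gbimod_hom (regular_gbimod (RI k hat)) Mr)).
  by exists id.
have b1 := based_tensor Khat (based_transport h0b (based_regular k n)).
have [v2 b2] := based_step Kb b1.
have nz (t : unit * 'I_(size (pts ord0 b)).-1.+1) : t != (tt, ord0) ->
    newj ord0 b 1 t.2 = 0%N.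
  by case: t => [[] i]; case: (unliftP ord0 i) => [i'|] ->; rewrite ?eqxx.
have b3 := based_cyclic nz b2.
have ej : newj ord0 b 1 0 = j by rewrite /newj /= prednK.
rewrite /= ej muln0 addr0 in b3.
have b4 := based_tensor (sub0set K) b3; do 2!eexists; refine (And3 _ b4 _).
  by do 2!apply: BS_cons; apply: BS_one.
by do 2![apply: central_tensor; apply: central_restrict]; apply: central_regular.
Qed.

End BottSamelson.

Section Soergel.
Variables (k : fieldType) (n : nat).
Local Notation N := n.+1.
Local Notation hat := (hat1 N).
Local Notation bimod I := (gbimod (RI k I) (RI k hat)).
Implicit Types (I J K : {set 'I_N.-1}).

Section BasedHom.
Variables (I : {set 'I_N.-1}) (M M' : bimod I) (T : finType).
Variables (j : T -> nat) (d : T -> int) (v : T -> zm M) (w : T -> zm M').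
Hypotheses (bM : based j d v) (cM : central M) (cM' : central M').
Hypothesis wdeg : forall t, bm_deg (d t) (w t : M').
Hypothesis wkill : forall t P, (forall l : 'I_N, (l < j t)%N -> evl l P = 0) ->
  P *: w t = 0.

(** Maps out of a sum of cyclic bimodules are given by the images of the
    generators; on central bimodules linearity over [R^I[z]] is linearity on both sides. *)
Lemma based_hom : exists f : gbimod_hom M M',
  forall P, sval f (\sum_t P t *: v t) = \sum_t P t *: w t.
Proof.
have [c cE] := choice (based_span bM).
pose f (x : zm M) : zm M' := \sum_t c x t *: w t.
have fE P : f (\sum_t P t *: v t) = \sum_t P t *: w t.
  set x := \sum_t _; apply/eqP; rewrite -subr_eq0 -sumrB; apply/eqP.
  apply: big1 => t _; rewrite -scalerBl; apply: wkill.
  have [+ _] := based_rel bM (fun s => c x s - P s); move=> H; apply: (H _ t).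
  under eq_bigr do rewrite scalerBl.
  by rewrite sumrB -cE subrr.
have fD : {morph f : x y / x + y}.
  move=> x y; rewrite [x]cE [y]cE -big_split.
  rewrite [X in f X](eq_bigr (fun t => (c x t + c y t) *: v t)); last first.
    by move=> t _; rewrite scalerDl.
  by rewrite !fE -big_split; apply: eq_bigr => t _; rewrite scalerDl.
have fZ P (x : zm M) : f (P *: x) = P *: (f x : zm M').
  rewrite {1}[x]cE [X in f X]scaler_sumr.
  rewrite [X in f X](eq_bigr (fun t => (P * c x t) *: v t)); last first.
    by move=> t _; rewrite scalerA.
  by rewrite fE /f scaler_sumr; apply: eq_bigr => t _; rewrite scalerA.
have f0 : f 0 = 0 by apply: (@addrI _ (f 0)); rewrite -fD !addr0.
suff hf : is_gbimod_hom f by exists (exist _ f hf).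
split=> //.
- by move=> a x; rewrite -!zscaleC fZ.
- by move=> x b; rewrite !ract_kappa // fZ.
apply: (deg_of_span (bm_grading M) (bm_grading M') fD) => S S0 SD S1.
have SC (a : invring k I) (x : zm M) e : bm_deg e (x : M) -> bm_deg e (f x) ->
    S (a%:P *: x).
  move=> xe fe; have [r [hr ea]] := grading_span (inv_grading k I) a.
  have -> : a%:P *: x = \sum_(p <- r) p.2%:P *: x.
    by rewrite -scaler_suml -rmorph_sum -ea.
  rewrite big_seq; apply: (big_ind S) => // p pr.
  apply: (S1 (p.1 + e)); first by apply: zscale_degC => //; apply: hr.
  by rewrite fZ; apply: zscale_degC => //; apply: hr.
move=> x; rewrite [x]cE; apply: (big_ind S) => // t _.
have deg i : bm_deg (d t + (2 * i)%:Z) ('X^i *: v t : M) /\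
    bm_deg (d t + (2 * i)%:Z) ('X^i *: w t : M').
  elim: i => [|i [IH IH']].
    by rewrite muln0 addr0 !expr0 !scale1r; split; [apply: based_deg bM t | apply: wdeg].
  have -> : d t + (2 * i.+1)%:Z = d t + (2 * i)%:Z + 2 by lia.
  by rewrite !exprS -!scalerA; split; apply: zscale_degX.
suff SP P i : S (P *: ('X^i *: v t)) by have := SP (c x t) 0%N; rewrite expr0 scale1r.
elim/poly_ind: P i => [|P a IH] i; first by rewrite scale0r.
rewrite scalerDl -scalerA [X in P *: X]scalerA -exprS; apply: SD => //.
have [d1 d2] := deg i; apply: SC d1 _; rewrite fZ.
have := fE (fun s => if s == t then 1 else 0).
rewrite (bigD1 t) //= eqxx scale1r big1 ?addr0 => [->|s /negPf->]; last by rewrite scale0r.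
rewrite (bigD1 t) //= eqxx scale1r big1 ?addr0 // => s /negPf->.
by rewrite scale0r.
Qed.

End BasedHom.

Lemma based_iso I (M M' : bimod I) (T : finType) (j : T -> nat) d
    (v : T -> zm M) (w : T -> zm M') : based j d v -> based j d w ->
  central M -> central M' -> @isomorphic (gbimod_cat _ _) M M'.
Proof.
move=> bM bM' cM cM'.
have [f fE] := based_hom bM cM cM' (based_deg bM') (based_kill bM').
have [g gE] := based_hom bM' cM' cM (based_deg bM) (based_kill bM).
apply: gbimod_isomorphicP; exists f; exists (sval g) => x.
  by have [P ->] := based_span bM x; rewrite fE gE.
by have [P ->] := based_span bM' x; rewrite gE fE.
Qed.

Lemma is_soergel_iso I (M M' : bimod I) :
  @isomorphic (gbimod_cat _ _) M M' -> is_soergel M' -> is_soergel M.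
Proof.
move=> MM' [s [hs M's]]; exists s; split=> //.
have [f [g [fg gf]]] := isomorphic_gbimod MM'.
have [f' [g' [fg' gf']]] := isomorphic_gbimod M's.
apply: gbimod_isomorphicP; exists (gbimod_cmp f' f).
by exists (sval g \o sval g') => x /=; rewrite ?fg' ?fg ?gf ?gf'.
Qed.

(** Sum the shifts of the bimodules of [cyclic_bott_samelson]. *)
Lemma soergel_exists m (j : 'I_m -> nat) (d : 'I_m -> int) :
  (forall t, 0 < j t <= N)%N ->
  exists (M : bimod set0) (v : 'I_m -> zm M),
    [/\ based j d v, central M & is_soergel M].
Proof.
move=> jN; suff [s [M [v [bM cM hs sM]]]] : exists s M (v : 'I_m -> zm M),
    [/\ based j d v, central M, forall i, (i < size s)%N -> exists r M',
      bott_samelson M' /\ direct_summand (nth (gbimod0 (RI k set0) (RI k hat)) s i) (shift r M')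
     & M = dsums s].
  exists M, v; split=> //; exists s; split=> //; rewrite sM.
  by apply: gbimod_isomorphicP; exists (gbimod_id _); exists id.
elim: m j d jN => [|m IH] j d jN.
  exists [::], (gbimod0 _ _), (fun _ => 0); split=> //.
  - have h (i : 'I_0) : void by case: i.
    have hbij : bijective h.
      by exists (fun x : void => match x with end) => [i|[]]; case: i.
    have := based_reindex hbij (based0 k (set0 : {set 'I_N.-1})).
    have -> : (fun=> 0%N) \o h = j by apply: funext => i; case: (h i).
    by have -> : (fun=> 0) \o h = d by apply: funext => i; case: (h i).
have [s [M [v [bM cM hs sM]]]] := IH (j \o lift ord0) (d \o lift ord0) (fun t => jN _).
have [B [u [BS bB cB]]] := cyclic_bott_samelson k (jN ord0).
pose h (i : 'I_m.+1) : unit + 'I_m := if unlift ord0 i is Some i' then inr i' else inl tt.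
have hbij : bijective h.
  exists (fun t : unit + 'I_m => match t with inl _ => ord0 | inr i => lift ord0 i end).
    by move=> i; rewrite /h; case: unliftP.
  by case=> [[]|i]; rewrite /h ?unlift_none ?liftK.
have := based_reindex hbij (based_dsum (based_shift (d ord0) bB) bM).
set j' := _ \o h; set d' := _ \o h; set v' := _ \o h.
have -> : j' = j by apply: funext => i; rewrite /j' /h /=; case: unliftP => [i'|] ->.
have -> : d' = d.
  by apply: funext => i; rewrite /d' /h /=; case: unliftP => [i'|] ->; rewrite ?add0r.
move=> bM'; exists (shift (d ord0) B :: s), (dsum (shift (d ord0) B) M), v'; split=> //.
- exact: central_dsum.
- case=> [|i] /= si; last exact: hs.
  by exists (d ord0), B; split=> //; apply: direct_summand_refl.
- by rewrite sM.
Qed.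

Lemma soergel_summand (M : bimod set0) : is_soergel M -> based_summand M.
Proof.
move=> [s [hs /retract_iso Ms]].
suff [M' [T [j [d [v [bM' cM' ret]]]]]] : based_summand (dsums s).
  by exists M', T, j, d, v; split=> //; apply: retract_trans ret.
elim: s hs {Ms} => [|X s IH] hs /=.
  exists (gbimod0 _ _), void; do 3!eexists; split; [exact: based0| |exact: retract_refl].
  by move=> c x; rewrite [LHS]thinmx0 [RHS]thinmx0.
have [i /(hs i.+1) //|M1 [T1 [j1 [d1 [v1 [b1 c1 r1]]]]]] := IH.
have [r [B [/bott_samelson_summand[M2 [T2 [j2 [d2 [v2 [b2 c2 r2]]]]]]]]] := hs 0%N isT.
move=> /direct_summand_retract /= rX.
do 5!eexists; split; first exact: (based_dsum (based_shift r b2) b1).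
  by apply: central_dsum.
apply: retract_dsum => //; apply: retract_trans rX _; exact: retract_shift.
Qed.

End Soergel.

(** * The algebra and its central polynomial subring *)

Section WRing.
Variables (k : fieldType) (n : nat).
Local Notation N := n.+1.
Local Notation R := {mpoly k[N]}.

Definition Walg : Type := presalg (@Wrel k N).
HB.instance Definition _ := GRing.PzRing.on Walg.
Implicit Types w : Walg.

Definition cst (c : k) : Walg := ppi (@Wrel k N) (Cst _ c).
Definition We (i : 'I_N.+1) : Walg := ppi (@Wrel k N) (Gen k (genE i)).
Definition Wy (i : 'I_N.+1) : Walg := ppi (@Wrel k N) (Gen k (genY i)).
Definition Wp (j : 'I_N) : Walg := ppi (@Wrel k N) (Gen k (genPsi j)).

Local Notation lo j := (@lo N.+1 j).
Local Notation hi j := (@hi N.+1 j).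

Let relE t u : @Wrel k N t u -> ppi (@Wrel k N) t = ppi (@Wrel k N) u.
Proof. by move=> tu; apply/ppiP/cong_rel. Qed.

(** The one-dimensional representation at the last vertex shows that [W] is
    not the zero ring. *)
Fixpoint last_rep (t : term k (Wgen N)) : k :=
  match t with
  | Cst c => c
  | Gen (genE i) => (i == ord_max)%:R
  | Gen _ => 0
  | Add t u => last_rep t + last_rep u
  | Mul t u => last_rep t * last_rep u
  end.

Lemma last_rep_cong t u : cong (@Wrel k N) t u -> last_rep t = last_rep u.
Proof.
elim=> {t u} //=; try by move=> *; congruence.
- move=> t u; case=> {t u} /=; try by move=> *; rewrite ?(mulr0, mul0r, addr0).
  + move=> i j; case: (eqVneq i j) => [->|ij] /=.
      by case: eqP; rewrite ?mulr1 ?mulr0.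
    case: (eqVneq i ord_max) ij => [->|_] ij; rewrite ?mul0r //.
    by rewrite [j == _]eq_sym (negPf ij) mulr0.
  + rewrite (big_morph last_rep (id1 := 0) (op1 := +%R)) //=.
    by rewrite (bigD1 ord_max) //= eqxx big1 ?addr0 // => i /negPf->.
- by move=> *; rewrite addrA.
- by move=> *; rewrite addrC.
- by move=> *; rewrite add0r.
- by move=> *; rewrite mulrA.
- by move=> *; rewrite mul1r.
- by move=> *; rewrite mul0r.
- by move=> *; rewrite mulrDl.
- by move=> *; rewrite mulrDr.
- by move=> *; rewrite mulrC.
Qed.

Fact Walg_nz : (1 : Walg) != 0.
Proof.
apply/eqP => /ppiP /last_rep_cong /=; apply/eqP; exact: oner_neq0.
Qed.
HB.instance Definition _ := GRing.PzSemiRing_isNonZero.Build Walg Walg_nz.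

Lemma We_idem i j : We i * We j = if i == j then We i else 0.
Proof. by rewrite /We -ppiM (relE (W_ee k i j)); case: ifP. Qed.

Lemma sum_We : \sum_i We i = 1.
Proof.
rewrite -[RHS](relE (W_e1 k N)); apply/esym.
exact: (big_morph (ppi (@Wrel k N)) (@ppiD _ _ _)).
Qed.

Lemma WyE j i : Wy j * We i = We i * Wy j.
Proof. by rewrite /We /Wy -!ppiM (relE (W_ye k j i)). Qed.

Lemma WyC j i : Wy j * Wy i = Wy i * Wy j.
Proof. by rewrite /Wy -!ppiM (relE (W_yy k j i)). Qed.

Lemma WpE0 j i : i != lo j -> i != hi j -> Wp j * We i = 0.
Proof. by move=> h h'; rewrite /Wp /We -ppiM (relE (W_psie0 k h h')). Qed.

Lemma WpE_lo j : Wp j * We (lo j) = We (hi j) * Wp j.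
Proof. by rewrite /Wp /We -!ppiM (relE (W_psie_lo k j)). Qed.

Lemma WpE_hi j : Wp j * We (hi j) = We (lo j) * Wp j.
Proof. by rewrite /Wp /We -!ppiM (relE (W_psie_hi k j)). Qed.

Lemma WpY j l : l != lo j -> l != hi j -> Wp j * Wy l = Wy l * Wp j.
Proof. by move=> h h'; rewrite /Wp /Wy -!ppiM (relE (W_psiy k h h')). Qed.

Lemma WpY_lo j : Wp j * Wy (lo j) = Wy (hi j) * Wp j.
Proof. by rewrite /Wp /Wy -!ppiM (relE (W_psiy_lo k j)). Qed.

Lemma WpY_hi j : Wp j * Wy (hi j) = Wy (lo j) * Wp j.
Proof. by rewrite /Wp /Wy -!ppiM (relE (W_ypsi_lo k j)). Qed.

Let ppiB t u : ppi (@Wrel k N) (Add t (Mul (Cst _ (- 1)) u)) = ppi _ t - ppi _ u.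
Proof. by rewrite ppiD -popp_pi. Qed.

Lemma Wp2_lo j : Wp j * Wp j * We (lo j) = (Wy (lo j) - Wy (hi j)) * We (lo j).
Proof. by have := relE (W_psi2_lo k j); rewrite !ppiM ppiB. Qed.

Lemma Wp2_hi j : Wp j * Wp j * We (hi j) = (Wy (hi j) - Wy (lo j)) * We (hi j).
Proof. by have := relE (W_psi2_hi k j); rewrite !ppiM ppiB. Qed.

Lemma We0 : We ord0 = 0.
Proof. exact: (relE (W_cyc k N)). Qed.

Lemma Walg_ind (P : Walg -> Prop) : (forall c, P (cst c)) ->
  (forall i, P (We i)) -> (forall i, P (Wy i)) -> (forall j, P (Wp j)) ->
  (forall w w', P w -> P w' -> P (w + w')) ->
  (forall w w', P w -> P w' -> P (w * w')) -> forall w, P w.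
Proof.
move=> Pc Pe Py Pp PD PM; elim/presalgW; elim=> [c|[i|i|j]|t IHt u IHu|t IHt u IHu].
- exact: Pc.
- exact: Pe.
- exact: Py.
- exact: Pp.
- by rewrite ppiD; apply: PD.
- by rewrite ppiM; apply: PM.
Qed.

Fact cst_zmod : zmod_morphism cst.
Proof.
move=> a b; rewrite /cst; have -> : ppi (@Wrel k N) (Cst _ (a - b)) =
   ppi (@Wrel k N) (Add (Cst _ a) (Cst _ (- b))) by apply/ppiP/cong_cstD.
rewrite ppiD; congr (_ + _); rewrite -mulN1r.
have -> : ppi (@Wrel k N) (Cst _ (-1 * b)) = ppi _ (Mul (Cst _ (-1)) (Cst _ b)).
  by apply/ppiP/cong_cstM.
by rewrite -popp_pi.
Qed.
HB.instance Definition _ := GRing.isZmodMorphism.Build k Walg cst cst_zmod.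

Fact cst_monoid : monoid_morphism cst.
Proof. by split=> // a b; rewrite /cst -ppiM; apply/ppiP/cong_cstM. Qed.
HB.instance Definition _ := GRing.isMonoidMorphism.Build k Walg cst cst_monoid.

Lemma cst_comm c w : cst c * w = w * cst c.
Proof. exact: ppi_central. Qed.

Lemma comm_gen (z : Walg) : (forall i, z * We i = We i * z) ->
  (forall i, z * Wy i = Wy i * z) -> (forall j, z * Wp j = Wp j * z) ->
  forall w, z * w = w * z.
Proof.
move=> ze zy zp; apply: Walg_ind => // [c|w w' zw zw'|w w' zw zw'].
- by rewrite cst_comm.
- by rewrite mulrDr mulrDl zw zw'.
- by rewrite mulrA zw -mulrA zw' mulrA.
Qed.

(** In the [i]th summand of the identity the variable [x_l] is the [y] of the
    [l]th red strand, and [z] that of the blue strand. *)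
Definition Wx (l : 'I_N) : Walg := \sum_(i < N.+1) Wy (lift i l) * We i.
Definition Wz : Walg := \sum_i Wy i * We i.

Lemma WxE l (i : 'I_N.+1) : Wx l * We i = Wy (lift i l) * We i.
Proof.
rewrite mulr_suml (bigD1 i) //= -mulrA We_idem eqxx big1 ?addr0 // => s si.
by rewrite -mulrA We_idem (negPf si) mulr0.
Qed.

Lemma WzE i : Wz * We i = Wy i * We i.
Proof.
rewrite mulr_suml (bigD1 i) //= -mulrA We_idem eqxx big1 ?addr0 // => s si.
by rewrite -mulrA We_idem (negPf si) mulr0.
Qed.

Lemma We_ext w w' : (forall i, w * We i = w' * We i) -> w = w'.
Proof.
by move=> H; rewrite -[w]mulr1 -[w']mulr1 -sum_We !mulr_sumr; apply: eq_bigr.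
Qed.

Lemma WpE_out j i : i != lo j -> i != hi j -> We i * Wp j = 0.
Proof.
move=> il ih; rewrite -[Wp j]mulr1 -sum_We !mulr_sumr big1 // => s _.
have [->|sl] := eqVneq s (lo j).
  by rewrite WpE_lo mulrA We_idem (negPf ih) mul0r.
have [->|sh] := eqVneq s (hi j).
  by rewrite WpE_hi mulrA We_idem (negPf il) mul0r.
by rewrite WpE0 // mulr0.
Qed.

Let sum_comm (f : 'I_N.+1 -> 'I_N.+1) :
  (forall i, (\sum_s Wy (f s) * We s) * We i = Wy (f i) * We i) ->
  (forall j l, Wp j * (Wy (f l) * We l) = (\sum_s Wy (f s) * We s) * (Wp j * We l)) ->
  forall w, (\sum_s Wy (f s) * We s) * w = w * (\sum_s Wy (f s) * We s).
Proof.
set z := \sum_s _ => zE zP; apply: comm_gen => [i|i|j].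
- rewrite zE /z mulr_sumr (bigD1 i) //= big1 ?addr0.
    by rewrite mulrA -WyE -mulrA We_idem eqxx.
  by move=> s si; rewrite mulrA -WyE -mulrA We_idem eq_sym (negPf si) mulr0.
- apply: We_ext => s; rewrite -[LHS]mulrA WyE mulrA zE -[RHS]mulrA zE.
  by rewrite -mulrA -WyE !mulrA [Wy i * _]WyC.
- by apply: We_ext => s; rewrite -[RHS]mulrA zE zP mulrA.
Qed.

Lemma Wz_comm w : Wz * w = w * Wz.
Proof.
apply: (sum_comm (f := id)) => [i|j l]; rewrite -/Wz; first exact: WzE.
have [->|ll] := eqVneq l (lo j).
  by rewrite WpE_lo !mulrA WzE WpY_lo -!mulrA WpE_lo.
have [->|lh] := eqVneq l (hi j).
  by rewrite WpE_hi !mulrA WzE WpY_hi -!mulrA WpE_hi.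
by rewrite [Wp j * We _]WpE0 // mulr0 /= WyE mulrA WpE0 // mul0r.
Qed.

Lemma lift_lo_hi (j l : 'I_N) :
  if l == j then lift (lo j) l = hi j /\ lift (hi j) l = lo j else
  [/\ lift (lo j) l = lift (hi j) l, lift (lo j) l != lo j & lift (lo j) l != hi j].
Proof.
case: eqVneq => [->|lj].
  by split; apply: val_inj; rewrite /= /bump ?leqnn ?ltnn.
rewrite eq_sym neq_lift -!(inj_eq val_inj); move: lj; rewrite -(inj_eq val_inj) /=.
move=> lj; split=> //.
  by apply: val_inj; rewrite /= /bump; case: ltngtP lj.
by rewrite /bump; case: leqP => jl; rewrite ?add1n ?eqSS //; lia.
Qed.

Lemma Wx_comm l w : Wx l * w = w * Wx l.
Proof.
apply: (sum_comm (f := fun i : 'I_N.+1 => lift i l)) => [i|j s]; rewrite -/(Wx l).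
  exact: WxE.
have := lift_lo_hi j l.
have [->|sl] := eqVneq s (lo j).
  rewrite WpE_lo !mulrA WxE; case: ifP => [_ [-> ->]|_ [<- yl yh]].
    by rewrite WpY_hi -!mulrA WpE_lo.
  by rewrite WpY // -!mulrA WpE_lo.
have [->|sh] := eqVneq s (hi j).
  rewrite WpE_hi !mulrA WxE; case: ifP => [_ [-> ->]|_ [<- yl yh]].
    by rewrite WpY_lo -!mulrA WpE_hi.
  by rewrite WpY // -!mulrA WpE_hi.
by rewrite [Wp j * We _]WpE0 // mulr0 /= WyE mulrA WpE0 // mul0r.
Qed.

(** The polynomial ring [R[z]] acts through the centre of [W]. *)
Local Notation A := (invring k (set0 : {set 'I_N.-1})).

Definition mev (p : R) : Walg := mmap cst Wx p.

Fact mev_zmod : zmod_morphism mev.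
Proof. by move=> p q; rewrite /mev mmapB. Qed.
HB.instance Definition _ := GRing.isZmodMorphism.Build R Walg mev mev_zmod.

Fact mev_monoid : monoid_morphism mev.
Proof.
have [] := @commr_mmap_is_multiplicative N k Walg Wx cst.
- by move=> i x; rewrite /GRing.comm Wx_comm.
- by move=> p m m'; rewrite /GRing.comm cst_comm.
by [].
Qed.
HB.instance Definition _ := GRing.isMonoidMorphism.Build R Walg mev mev_monoid.

Lemma mevX l : mev 'X_l = Wx l.
Proof. by rewrite /mev mmapX mmap1U. Qed.

Lemma mevC c : mev c%:MP = cst c.
Proof. by rewrite /mev mmapC. Qed.

Lemma mev_comm p w : mev p * w = w * mev p.
Proof.
elim/mpoly_alg_ind: p => [c|i|p q hp hq|p q hp hq].
- by rewrite mevC cst_comm.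
- by rewrite mevX Wx_comm.
- by rewrite rmorphD mulrDr mulrDl hp hq.
- by rewrite rmorphM mulrA -hp -mulrA hq mulrA.
Qed.

Definition aev (a : A) : Walg := mev (val a).
HB.instance Definition _ := GRing.RMorphism.copy aev (mev \o (\val : A -> R)).

Fact aev_commr : commr_rmorph aev Wz.
Proof. by move=> a; rewrite /GRing.comm Wz_comm. Qed.

Definition ev (p : {poly A}) : Walg := horner_morph aev_commr p.
HB.instance Definition _ := GRing.RMorphism.copy ev (horner_morph aev_commr).

Lemma evC a : ev a%:P = mev (val a).
Proof. exact: horner_morphC. Qed.

Lemma evX : ev 'X = Wz.
Proof. exact: horner_morphX. Qed.

Lemma ev_comm p w : ev p * w = w * ev p.
Proof.
elim/poly_ind: p => [|p c IH]; first by rewrite rmorph0 mul0r mulr0.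
rewrite rmorphD rmorphM /= evC evX mulrDl mulrDr mev_comm; congr (_ + _).
by rewrite -mulrA Wz_comm mulrA IH mulrA.
Qed.

Lemma xv_subproof (l : 'I_N) : 'X_l \in Defs.invariant (k := k) (set0 : {set 'I_N.-1}).
Proof. by apply: invariant_refl => j; rewrite inE. Qed.

Definition xv (l : 'I_N) : A := InvRing (xv_subproof l).

(** The difference by which [psi_l^2] acts. *)
Definition zx (l : 'I_N) : {poly A} := 'X - (xv l)%:P.

Lemma ev_zx l : ev (zx l) = Wz - Wx l.
Proof. by rewrite rmorphB /= evX evC mevX. Qed.

Lemma evl_zx l i : evl i (zx l) = 'X_i - 'X_l.
Proof. by rewrite evlD evlN evlX evlC. Qed.

Lemma Wp2_zx_lo j : Wp j * Wp j * We (lo j) = ev (zx j) * We (lo j).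
Proof.
rewrite Wp2_lo ev_zx !mulrBl WzE WxE.
by have := lift_lo_hi j j; rewrite eqxx => -[-> _].
Qed.

Lemma Wp2_zx_hi j : Wp j * Wp j * We (hi j) = ev (zx j) * We (hi j).
Proof.
rewrite Wp2_hi ev_zx !mulrBl WzE WxE.
by have := lift_lo_hi j j; rewrite eqxx => -[_ ->].
Qed.

Lemma Wy_central i j : Wy j * We i =
  (if unlift i j is Some l then Wx l else Wz) * We i.
Proof. by case: unliftP => [l|] ->; rewrite ?WxE ?WzE. Qed.

End WRing.

(** * Paths between vertices *)

Section Paths.
Variables (k : fieldType) (n : nat).
Local Notation N := n.+1.
Local Notation R := {mpoly k[N]}.
Local Notation A := (invring k (set0 : {set 'I_N.-1})).
Local Notation W := (Walg k n).
Implicit Types (w : W).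

Definition wdeg (d : int) (w : W) : Prop := @gr_deg (Defs.W k N) d w.

Lemma wdeg0 d : wdeg d 0.
Proof. exact: grading0 (@gr_grading (Defs.W k N)) d. Qed.

Lemma wdegD d w w' : wdeg d w -> wdeg d w' -> wdeg d (w + w').
Proof. exact: gradingD (@gr_grading (Defs.W k N)). Qed.

Lemma wdegM d e w w' : wdeg d w -> wdeg e w' -> wdeg (d + e) (w * w').
Proof. exact: (@gr_degM (Defs.W k N)). Qed.

Lemma wdeg1 : wdeg 0 1.
Proof. exact: (@gr_deg1 (Defs.W k N)). Qed.

Lemma wdeg_sum d (J : eqType) (r : seq J) (F : J -> W) :
  (forall x, x \in r -> wdeg d (F x)) -> wdeg d (\sum_(x <- r) F x).
Proof.
move=> H; rewrite big_seq; apply: (big_ind (wdeg d)) => //; first exact: wdeg0.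
by move=> x y; apply: wdegD.
Qed.

Lemma wdegX d w i : wdeg d w -> wdeg (d * i%:Z) (w ^+ i).
Proof.
move=> dw; elim: i => [|i IH]; first by rewrite mulr0 expr0; apply: wdeg1.
by rewrite exprS -[i.+1]add1n PoszD mulrDr mulr1; apply: wdegM.
Qed.

Lemma wdeg_cst c : wdeg 0 (cst n c).
Proof. by exists (Cst _ c) => //; constructor. Qed.

Lemma wdeg_We i : wdeg 0 (We k i).
Proof. exists (Gen k (genE i)) => //; exact: (homog_gen _ _ (genE i)). Qed.

Lemma wdeg_Wy i : wdeg 2 (Wy k i).
Proof. exists (Gen k (genY i)) => //; exact: (homog_gen _ _ (genY i)). Qed.

Lemma wdeg_Wp i : wdeg 1 (Wp k i).
Proof. exists (Gen k (genPsi i)) => //; exact: (homog_gen _ _ (genPsi i)). Qed.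

Lemma wdeg_Wx l : wdeg 2 (Wx k l).
Proof.
apply: wdeg_sum => i _; rewrite -[2]addr0.
by apply: wdegM; [apply: wdeg_Wy | apply: wdeg_We].
Qed.

Lemma wdeg_Wz : wdeg 2 (Wz k n).
Proof.
apply: wdeg_sum => i _; rewrite -[2]addr0.
by apply: wdegM; [apply: wdeg_Wy | apply: wdeg_We].
Qed.

Lemma wdeg_mev e p : pdeg e p -> wdeg e (mev p).
Proof.
move=> pe; apply: wdeg_sum => m /pe ->; rewrite -[Posz _]add0r.
apply: wdegM; first exact: wdeg_cst.
rewrite mdegE big_distrr /= /mmap1.
apply: (big_ind2 (fun w (i : nat) => wdeg i%:Z w)); first exact: wdeg1.
  by move=> x i y j hx hy; rewrite PoszD; apply: wdegM.
by move=> i _; rewrite PoszM; apply/wdegX/wdeg_Wx.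
Qed.

Lemma wdeg_ev e (p : {poly A}) : hpoly e p -> wdeg e (ev p).
Proof.
move=> pe; rewrite /ev /horner_morph horner_coef.
apply: wdeg_sum => i _; rewrite coef_map -[e](subrK (2 * i)%:Z).
apply: wdegM; first exact: wdeg_mev (pe i).
by rewrite PoszM; apply/wdegX/wdeg_Wz.
Qed.

(** No generator has negative degree, and those of degree 0 are the idempotents. *)
Lemma wdeg_le0 d w : wdeg d w ->
  (d < 0 -> w = 0) /\ (d = 0 -> exists c : 'I_N.+1 -> k, w = \sum_i cst n (c i) * We k i).
Proof.
have c0 (c : k) : exists c' : 'I_N.+1 -> k, cst n c = \sum_i cst n (c' i) * We k i.
  by exists (fun=> c); rewrite -mulr_sumr sum_We mulr1.
have s0 : exists c' : 'I_N.+1 -> k, 0 = \sum_i cst n (c' i) * We k i.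
  by exists (fun=> 0); rewrite big1 // => i _; rewrite rmorph0 mul0r.
case=> t ht -> {w}; elim: ht => {d t}
  [d|c|g|d t u _ [IH1 IH1'] _ [IH2 IH2']|d e t u _ [IH1 IH1'] _ [IH2 IH2']].
- by split.
- by split=> // _; apply: c0.
- split; first by case: g.
  case: g => // i _; exists (fun s => (s == i)%:R); rewrite (bigD1 i) //= eqxx.
  rewrite rmorph1 mul1r big1 ?addr0 // => s /negPf->.
  by rewrite rmorph0 mul0r.
- rewrite ppiD; split=> [d0|d0]; first by rewrite IH1 // IH2 // addr0.
  have [c ->] := IH1' d0; have [c' ->] := IH2' d0; exists (fun i => c i + c' i).
  by rewrite -big_split; apply: eq_bigr => i _; rewrite rmorphD mulrDl.
- have [d0|d0|d0] := Order.TotalTheory.ltgtP d 0.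
  + by rewrite ppiM IH1 // mul0r.
  + have [e0|e0|e0] := Order.TotalTheory.ltgtP e 0.
    * by rewrite ppiM IH2 // mulr0.
    * by split; lia.
    * by split; lia.
  rewrite d0 add0r; split=> [e0|e0]; first by rewrite ppiM IH2 // mulr0.
  have [c ec] := IH1' d0; have [c' ec'] := IH2' e0; exists (fun i => c i * c' i).
  rewrite ppiM ec ec' mulr_suml; apply: eq_bigr => i _.
  rewrite mulr_sumr (bigD1 i) //= big1 ?addr0.
    by rewrite -mulrA [We k i * _]mulrA -cst_comm -mulrA We_idem eqxx mulrA rmorphM.
  move=> s si; rewrite -mulrA [We k i * _]mulrA -cst_comm -mulrA We_idem.
  by rewrite eq_sym (negPf si) !mulr0.
Qed.

(** With natural numbers as indices, neighbouring vertices are [i] and [i.+1]. *)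
Definition eW (i : nat) : W := We k (inord i : 'I_N.+1).
Definition pW (i : nat) : W := Wp k (inord i : 'I_N).
Definition zxn (i : nat) : {poly A} := zx k (inord i : 'I_N).

Lemma lo_inord i : (i < N)%N -> @lo N.+1 (inord i : 'I_N) = inord i :> 'I_N.+1.
Proof. by move=> iN; apply: val_inj; rewrite /= !inordK // ltnW. Qed.

Lemma hi_inord i : (i < N)%N -> @hi N.+1 (inord i : 'I_N) = inord i.+1 :> 'I_N.+1.
Proof. by move=> iN; apply: val_inj; rewrite /= !inordK. Qed.

Lemma eW_ord (i : 'I_N.+1) : eW i = We k i.
Proof. by rewrite /eW inord_val. Qed.

Lemma pW_ord (i : 'I_N) : pW i = Wp k i.
Proof. by rewrite /pW inord_val. Qed.

Lemma pWe i : (i < N)%N -> pW i * eW i = eW i.+1 * pW i.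
Proof. by move=> iN; rewrite /eW -(lo_inord iN) -(hi_inord iN) WpE_lo. Qed.

Lemma pWeS i : (i < N)%N -> pW i * eW i.+1 = eW i * pW i.
Proof. by move=> iN; rewrite /eW -(lo_inord iN) -(hi_inord iN) WpE_hi. Qed.

Lemma pWpWe i : (i < N)%N -> pW i * (pW i * eW i) = ev (zxn i) * eW i.
Proof. by move=> iN; rewrite mulrA /eW -(lo_inord iN) Wp2_zx_lo. Qed.

Lemma pWpWeS i : (i < N)%N -> pW i * (pW i * eW i.+1) = ev (zxn i) * eW i.+1.
Proof. by move=> iN; rewrite mulrA /eW -(hi_inord iN) Wp2_zx_hi. Qed.

Lemma pW_out i j : (i < N)%N -> (j <= N)%N -> j != i -> j != i.+1 -> pW i * eW j = 0.
Proof.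
move=> iN jN ji ji'; apply: WpE0.
  by rewrite lo_inord // -(inj_eq val_inj) /= !inordK // ltnW.
by rewrite hi_inord // -(inj_eq val_inj) /= !inordK.
Qed.

Lemma eW_idem i : eW i * eW i = eW i.
Proof. by rewrite /eW We_idem eqxx. Qed.

Lemma eW_ne i j : (i <= N)%N -> (j <= N)%N -> i != j -> eW i * eW j = 0.
Proof.
move=> iN jN ij; rewrite /eW We_idem -(inj_eq val_inj) /= !inordK //.
by rewrite (negPf ij).
Qed.

(** Paths from the vertex [i] to [i + m] and back. *)
Fixpoint upW i m : W := if m is m'.+1 then pW (i + m') * upW i m' else 1.
Fixpoint dnW i m : W := if m is m'.+1 then dnW i m' * pW (i + m') else 1.

Lemma upW_e i m : (i + m <= N)%N -> eW (i + m) * upW i m = upW i m * eW i.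
Proof.
elim: m => [|m IH] im /=; first by rewrite addn0 mulr1 mul1r.
rewrite addnS in im *; rewrite mulrA -pWe // -!mulrA IH //; exact: ltnW.
Qed.

Lemma dnW_e i m : (i + m <= N)%N -> eW i * dnW i m = dnW i m * eW (i + m).
Proof.
elim: m => [|m IH] im /=; first by rewrite addn0 mulr1 mul1r.
by rewrite addnS in im *; rewrite mulrA IH ?(ltnW im) // -!mulrA pWeS.
Qed.

Lemma dnW_S i m : dnW i m.+1 = pW i * dnW i.+1 m.
Proof.
elim: m => [|m IH]; first by rewrite /= addn0 mul1r mulr1.
have -> : dnW i m.+2 = dnW i m.+1 * pW (i + m.+1) by [].
by rewrite IH -mulrA -addSnnS.
Qed.

(** The path from [j] to [i]. *)
Definition pth i j : W := if (j <= i)%N then upW j (i - j) else dnW i (j - i).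

Lemma pth_e i j : (i <= N)%N -> (j <= N)%N -> eW i * pth i j = pth i j * eW j.
Proof.
rewrite /pth => iN jN; case: leqP => ji.
  by rewrite -{1}(subnKC ji) upW_e // subnKC.
by rewrite dnW_e ?subnKC // ltnW.
Qed.

Lemma pth_refl i : pth i i = 1.
Proof. by rewrite /pth leqnn subnn. Qed.

Lemma pth_up i j : (j <= i)%N -> pth i.+1 j = pW i * pth i j.
Proof. by move=> ji; rewrite /pth ji leqW // subSn //= subnKC. Qed.

Lemma pth_dn i j : (i < j)%N -> pth i j = pW i * pth i.+1 j.
Proof.
move=> ij; have ej : j = (i + (j - i.+1).+1)%N by lia.
move: (j - i.+1)%N ej => m {ij} ->.
have -> : pth i (i + m.+1) = dnW i m.+1.
  by rewrite /pth ifF ?addKn //; apply/negbTE; rewrite -ltnNge; lia.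
rewrite dnW_S; congr (_ * _); case: m => [|m].
  by rewrite addn1 pth_refl.
by rewrite /pth ifF; [congr dnW; lia | apply/negbTE; rewrite -ltnNge; lia].
Qed.

(** [psi_i] acts on paths: each backtracking contributes a factor. *)
Lemma pW_pth_dn i j : (i < j)%N -> (j <= N)%N ->
  pW i * pth i j * eW j = ev (zxn i) * (pth i.+1 j * eW j).
Proof.
move=> ij jN; have iN := leq_trans ij jN.
by rewrite pth_dn // -!mulrA -pth_e // [pW i * (eW _ * _)]mulrA [pW i * (_ * _)]mulrA
  pWpWeS // mulrA.
Qed.

Lemma pW_pth_up i j : (j <= i)%N -> (i < N)%N ->
  pW i * pth i.+1 j * eW j = ev (zxn i) * (pth i j * eW j).
Proof.
move=> ji iN; have jN : (j <= N)%N by apply: leq_trans ji (ltnW iN).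
by rewrite pth_up // -!mulrA -pth_e ?(ltnW iN) // [pW i * (eW _ * _)]mulrA
  [pW i * (_ * _)]mulrA pWpWe // mulrA.
Qed.

Lemma wdeg_pth i j : (i <= N)%N -> (j <= N)%N ->
  wdeg (Posz (if j <= i then i - j else j - i)%N) (pth i j).
Proof.
have up a m : wdeg m%:Z (upW a m).
  elim: m => [|m IH] /=; first exact: wdeg1.
  by rewrite -add1n PoszD; apply: wdegM => //; apply: wdeg_Wp.
have dn a m : wdeg m%:Z (dnW a m).
  elim: m => [|m IH] /=; first exact: wdeg1.
  by rewrite -addn1 PoszD; apply: wdegM => //; apply: wdeg_Wp.
by rewrite /pth; case: ifP.
Qed.

Definition gp (a b : nat) : {poly A} := \prod_(a <= l < b) zxn l.

Lemma gp_refl a : gp a a = 1.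
Proof. by rewrite /gp big_geq. Qed.

Lemma gp_recr a b : (a <= b)%N -> gp a b.+1 = gp a b * zxn b.
Proof. by move=> ab; rewrite /gp big_nat_recr. Qed.

Lemma evl_gp_eq0 a b (l : 'I_N) : (b <= N)%N ->
  (evl l (gp a b) == 0) = (a <= l < b)%N.
Proof.
move=> bN; rewrite /gp /evl rmorph_prod horner_prod -/(index_iota _ _) prodf_seq_eq0.
apply/hasP/idP => [[i]|ab]; last first.
  exists (l : nat); first by rewrite mem_index_iota.
  by rewrite -/(evl _ _) evl_zx inord_val subrr /=.
rewrite mem_index_iota => /andP[ai ib] /=; rewrite -/(evl _ _) evl_zx subr_eq0.
move=> /eqP/mX_inj ->; rewrite inordK ?ai //; exact: leq_trans ib bN.
Qed.

Lemma gp_dvd a b (p : {poly A}) : (b <= N)%N ->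
  (forall l : 'I_N, (a <= l < b)%N -> evl l p = 0) -> exists q, p = gp a b * q.
Proof.
elim: b => [|b IH] bN p0; first by exists p; rewrite /gp big_geq // mul1r.
have [ab|ba] := leqP a b; last by exists p; rewrite /gp big_geq // mul1r.
have [l lab|q eq] := IH (ltnW bN); first by apply: p0; lia.
have bl : (inord b : 'I_N) = b :> nat by rewrite inordK.
have : evl (inord b) q = 0.
  have := p0 (inord b); rewrite bl ab leqnn => /(_ isT); rewrite eq evlM => /eqP.
  by rewrite mulf_eq0 evl_gp_eq0 ?(ltnW bN) // bl ltnn andbF /= => /eqP.
move=> q0; have /factor_theorem[q' eq'] : root q (xv k (inord b)).
  apply/eqP/val_inj; rewrite -[RHS]q0 /evl /=.
  by rewrite -horner_map.
by exists q'; rewrite gp_recr // -mulrA -/(zx k _) [zxn b * _]mulrC -eq'.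
Qed.

(** Descending to the vertex 0, where the idempotent vanishes, and coming back
    contributes each factor once. *)
Lemma gp_kill i : (i <= N)%N -> ev (gp 0 i) * eW i = 0.
Proof.
elim: i => [|i IH] iN.
  by rewrite (eW_ord ord0) We0 mulr0.
rewrite gp_recr // rmorphM /= -mulrA -pWpWeS // pWeS // mulrA ev_comm -mulrA.
by rewrite [ev _ * (_ * _)]mulrA IH ?mul0r ?mulr0 // ltnW.
Qed.

Lemma evl_kill i (p : {poly A}) : (i <= N)%N ->
  (forall l : 'I_N, (l < i)%N -> evl l p = 0) -> ev p * eW i = 0.
Proof.
move=> iN p0; have [l /p0 //|q ->] := gp_dvd (a := 0) (p := p) iN.
by rewrite mulrC rmorphM /= -mulrA gp_kill // mulr0.
Qed.

(** A path from [j] down to [i] followed by an ascent is the direct path, up to a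
    factor for each step retraced. *)
Lemma upW_pth i j m : (i + m <= N)%N -> (j <= N)%N ->
  upW i m * (pth i j * eW j) =
  ev (gp i (minn (i + m) j)) * (pth (i + m) j * eW j).
Proof.
move=> + jN; elim: m => [|m IH] imN /=.
  by rewrite addn0 mul1r /gp big_geq ?geq_minl // rmorph1 mul1r.
rewrite addnS in imN *; rewrite -mulrA IH ?(ltnW imN) // mulrA -ev_comm -mulrA.
rewrite [pW _ * (_ * _)]mulrA; have [ji|ij] := leqP j (i + m).
  by rewrite (minn_idPr (leqW ji)) pth_up.
rewrite pW_pth_dn // (minn_idPl ij) [in RHS]gp_recr ?leq_addr //.
by rewrite rmorphM /= !mulrA.
Qed.

End Paths.

(** * From bimodules to modules *)

Section Representation.
Variables (k : fieldType) (G : Type) (rel : term k G -> term k G -> Prop).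
Variables (V : zmodType) (c : k -> V -> V) (rho : G -> V -> V).

Fixpoint tm_act (t : term k G) (v : V) : V :=
  match t with
  | Cst a => c a v
  | Gen g => rho g v
  | Add t u => tm_act t v + tm_act u v
  | Mul t u => tm_act t (tm_act u v)
  end.

Hypothesis cDr : forall a, {morph c a : u v / u + v}.
Hypothesis cDl : forall a b v, c (a + b) v = c a v + c b v.
Hypothesis cM : forall a b v, c (a * b) v = c a (c b v).
Hypothesis c1 : forall v, c 1 v = v.
Hypothesis rhoD : forall g, {morph rho g : u v / u + v}.
Hypothesis rhoC : forall g a v, rho g (c a v) = c a (rho g v).
Hypothesis rhoR : forall t u, rel t u -> forall v, tm_act t v = tm_act u v.

Lemma tm_actD t : {morph tm_act t : u v / u + v}.
Proof.
elim: t => [a|g|t IHt u IHu|t IHt u IHu] v w /=; first exact: cDr.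
- exact: rhoD.
- by rewrite IHt IHu addrACA.
- by rewrite IHu IHt.
Qed.

Lemma tm_actC a t v : tm_act t (c a v) = c a (tm_act t v).
Proof.
elim: t v => [b|g|t IHt u IHu|t IHt u IHu] v /=; first by rewrite -!cM mulrC.
- exact: rhoC.
- by rewrite IHt IHu cDr.
- by rewrite IHu IHt.
Qed.

Lemma rep_cst0 v : c 0 v = 0.
Proof. by apply: (@addrI _ (c 0 v)); rewrite -cDl !addr0. Qed.

Lemma tm_act_cong t u : cong rel t u -> forall v, tm_act t v = tm_act u v.
Proof.
elim=> {t u} /=.
- exact: rhoR.
- by [].
- by move=> t u _ IH v; rewrite IH.
- by move=> t u w _ IH1 _ IH2 v; rewrite IH1 IH2.
- by move=> t t' u u' _ IH1 _ IH2 v; rewrite IH1 IH2.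
- by move=> t t' u u' _ IH1 _ IH2 v; rewrite IH1 IH2.
- by move=> t u w v; rewrite addrA.
- by move=> t u v; rewrite addrC.
- by move=> t v; rewrite rep_cst0 add0r.
- by [].
- by move=> t v; rewrite c1.
- by move=> t v; rewrite !rep_cst0.
- by [].
- by move=> t u w v; rewrite tm_actD.
- by [].
- by [].
- by move=> a t v; rewrite tm_actC.
Qed.

(** Operators for the generators that satisfy the relations act through the
    presented algebra. *)
Definition rep_act (x : presalg rel) (v : V) : V := tm_act (repr x) v.

Lemma rep_act_pi t v : rep_act (ppi rel t) v = tm_act t v.
Proof. exact/tm_act_cong/cong_repr. Qed.

Fact rep_actA x y v : rep_act x (rep_act y v) = rep_act (x * y) v.
Proof.
by elim/presalgW: x => t; elim/presalgW: y => u; rewrite -ppiM !rep_act_pi.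
Qed.

Fact rep_act1 : left_id 1 rep_act.
Proof. by move=> v; rewrite -(ppi1 rel) rep_act_pi /= c1. Qed.

Fact rep_actDr : right_distributive rep_act +%R.
Proof. by elim/presalgW=> t u v; rewrite !rep_act_pi tm_actD. Qed.

Fact rep_actDl v : {morph rep_act^~ v : x y / x + y}.
Proof.
by elim/presalgW=> t; elim/presalgW=> u; rewrite -ppiD !rep_act_pi.
Qed.

End Representation.

Section Psi.
Variables (k : fieldType) (n : nat).
Local Notation N := n.+1.
Local Notation R := {mpoly k[N]}.
Local Notation hat := (hat1 N).
Local Notation A := (invring k (set0 : {set 'I_N.-1})).
Local Notation lo j := (@lo N.+1 j).
Local Notation hi j := (@hi N.+1 j).

Section Object.
Variable X : gbimod (RI k (set0 : {set 'I_N.-1})) (RI k hat).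

(** When [X] is the last vertex of a sum of cyclic projective modules, the [i]th
    condition describes the image of the vertex [i] in it. *)
Definition psi_pred : {pred {ffun 'I_N.+1 -> zm X}} :=
  fun v => [forall i : 'I_N.+1, gp k n 0 i *: v i == 0].

Lemma psi_predP (v : {ffun 'I_N.+1 -> zm X}) :
  reflect (forall i : 'I_N.+1, gp k n 0 i *: v i = 0) (v \in psi_pred).
Proof. by apply: (iffP forallP) => H i; apply/eqP. Qed.

Fact psi_zmod_closed : zmod_closed psi_pred.
Proof.
split; first by apply/psi_predP => i; rewrite ffunE scaler0.
move=> u v /psi_predP hu /psi_predP hv; apply/psi_predP => i.
by rewrite !ffunE scalerBr hu hv subrr.
Qed.
HB.instance Definition _ := GRing.isZmodClosed.Build _ psi_pred psi_zmod_closed.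

Record psiT := PsiT { psi_val : {ffun 'I_N.+1 -> zm X}; _ : psi_val \in psi_pred }.
HB.instance Definition _ := [isSub for psi_val].
HB.instance Definition _ := [Choice of psiT by <:].
HB.instance Definition _ := [SubChoice_isSubZmodule of psiT by <:].

(* Evaluation and the operators below are sealed: unification must not unfold
   them. *)
Fact psi_at_subproof : {f : psiT -> 'I_N.+1 -> zm X | f = fun v => psi_val v}.
Proof. by eexists. Qed.

Definition psi_at := sval psi_at_subproof.
Local Coercion psi_at : psiT >-> Funclass.

Let psi_atE : psi_at = fun v i => psi_val v i.
Proof. exact: (svalP psi_at_subproof). Qed.

Lemma psi_kill (v : psiT) (i : 'I_N.+1) : gp k n 0 i *: v i = 0.
Proof. by have /psi_predP := valP v; rewrite psi_atE; apply. Qed.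

Lemma psi_ext (u v : psiT) : (forall i, u i = v i) -> u = v.
Proof. by rewrite psi_atE => uv; apply/val_inj/ffunP => i; apply: uv. Qed.

Lemma psiDE (u v : psiT) i : (u + v) i = u i + v i.
Proof. by rewrite psi_atE [LHS]ffunE. Qed.

Lemma psi0E i : (0 : psiT) i = 0.
Proof. by apply: (@addrI _ ((0 : psiT) i)); rewrite -psiDE !addr0. Qed.

Lemma psi_mk_exists (f : 'I_N.+1 -> zm X) :
  (forall i : 'I_N.+1, gp k n 0 i *: f i = 0) -> exists v : psiT, forall i, v i = f i.
Proof.
move=> hf; have vf : [ffun i => f i] \in psi_pred.
  by apply/psi_predP => i; rewrite ffunE.
by exists (PsiT vf) => i; rewrite psi_atE ffunE.
Qed.

Fact psi_mk_subproof (f : 'I_N.+1 -> zm X)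
  (hf : forall i : 'I_N.+1, gp k n 0 i *: f i = 0) : {v : psiT | forall i, v i = f i}.
Proof. exact: cid (psi_mk_exists hf). Qed.

Definition psi_mk f hf : psiT := sval (@psi_mk_subproof f hf).

Lemma psi_mkE f hf i : @psi_mk f hf i = f i.
Proof. exact: (svalP (psi_mk_subproof hf)). Qed.

Lemma psi_e_subproof (s : 'I_N.+1) (v : psiT) (i : 'I_N.+1) :
  gp k n 0 i *: (if i == s then v i else 0) = 0.
Proof. by case: ifP => _; rewrite ?psi_kill ?scaler0. Qed.

(** At the vertex [i] the strand [l] is the blue one if [l = i], and carries [z];
    otherwise it is a red one and carries its own variable. *)
Definition ycoef (i l : 'I_N.+1) : {poly A} :=
  if unlift i l is Some l' then (xv k l')%:P else 'X.

Lemma psi_y_subproof (l : 'I_N.+1) (v : psiT) (i : 'I_N.+1) :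
  gp k n 0 i *: (ycoef i l *: v i) = 0.
Proof. by rewrite scalerA mulrC -scalerA psi_kill scaler0. Qed.

Lemma psi_c_subproof (a : {poly A}) (v : psiT) (i : 'I_N.+1) :
  gp k n 0 i *: (a *: v i) = 0.
Proof. by rewrite scalerA mulrC -scalerA psi_kill scaler0. Qed.

Lemma gpS (j : 'I_N) : gp k n 0 j.+1 = gp k n 0 j * zx k j.
Proof. by rewrite (gp_recr _ _ (leq0n j)); congr (_ * zx k _); apply: inord_val. Qed.

Lemma psi_p_subproof (j : 'I_N) (v : psiT) (i : 'I_N.+1) :
  gp k n 0 i *: (if i == hi j then v (lo j) else if i == lo j then zx k j *: v (hi j) else 0) = 0.
Proof.
case: eqP => [->|_]; first by rewrite gpS mulrC -scalerA (psi_kill v (lo j)) scaler0.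
case: eqP => [->|_]; last by rewrite scaler0.
by rewrite scalerA -gpS (psi_kill v (hi j)).
Qed.

Fact constA_subproof (a : k) : {c : A | val c = a%:MP}.
Proof.
have ca : a%:MP \in Defs.invariant (set0 : {set 'I_N.-1}).
  by apply: invariant_refl => j; rewrite inE.
by exists (InvRing ca).
Qed.

(* The opaque existence proof keeps unification from unfolding the constant. *)
Definition cA (a : k) : A := sval (constA_subproof a).

Lemma val_cA a : val (cA a) = a%:MP.
Proof. exact: (svalP (constA_subproof a)). Qed.

Fact psi_cst_subproof : {f : k -> psiT -> psiT |
  forall a v i, f a v i = (cA a)%:P *: v i}.
Proof. by exists (fun a v => psi_mk (psi_c_subproof (cA a)%:P v)) => a v i; rewrite psi_mkE. Qed.

Definition psi_cst := sval psi_cst_subproof.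

Lemma psi_cstE a v i : psi_cst a v i = (cA a)%:P *: v i.
Proof. exact: (svalP psi_cst_subproof). Qed.

Fact psi_gen_subproof : {f : Wgen N -> psiT -> psiT | [/\
  forall s v i, f (genE s) v i = if i == s then v i else 0,
  forall l v i, f (genY l) v i = ycoef i l *: v i &
  forall j v i, f (genPsi j) v i =
    if i == hi j then v (lo j) else if i == lo j then zx k j *: v (hi j) else 0]}.
Proof.
exists (fun g v => match g with
  | genE s => psi_mk (psi_e_subproof s v)
  | genY l => psi_mk (psi_y_subproof l v)
  | genPsi j => psi_mk (psi_p_subproof j v)
  end).
by split=> *; rewrite psi_mkE.
Qed.

Definition psi_gen := sval psi_gen_subproof.

Lemma psi_eE s v i : psi_gen (genE s) v i = if i == s then v i else 0.
Proof. by have [] := svalP psi_gen_subproof. Qed.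

Lemma psi_yE l v i : psi_gen (genY l) v i = ycoef i l *: v i.
Proof. by have [] := svalP psi_gen_subproof. Qed.

Lemma psi_pE j v i : psi_gen (genPsi j) v i =
  if i == hi j then v (lo j) else if i == lo j then zx k j *: v (hi j) else 0.
Proof. by have [] := svalP psi_gen_subproof. Qed.

Lemma lo_hi (j : 'I_N) : (lo j == hi j) = false.
Proof. by rewrite -(inj_eq val_inj) /= ltn_eqF. Qed.

Lemma hi_lo (j : 'I_N) : (hi j == lo j) = false.
Proof. by rewrite eq_sym lo_hi. Qed.

Lemma psi_genD g : {morph psi_gen g : u v / u + v}.
Proof.
case: g => [s|l|j] u v; apply: psi_ext => i; rewrite psiDE.
- by rewrite !psi_eE psiDE; case: ifP; rewrite ?addr0.
- by rewrite !psi_yE psiDE scalerDr.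
- by rewrite !psi_pE !psiDE scalerDr; do 2![case: ifP => _ //]; rewrite addr0.
Qed.

Lemma psi_genC g a v : psi_gen g (psi_cst a v) = psi_cst a (psi_gen g v).
Proof.
case: g => [s|l|j]; apply: psi_ext => i; rewrite psi_cstE.
- by rewrite !psi_eE psi_cstE; case: ifP; rewrite ?scaler0.
- by rewrite !psi_yE psi_cstE !scalerA mulrC.
- rewrite !psi_pE !psi_cstE; do 2![case: ifP => _ //]; last by rewrite scaler0.
  by rewrite !scalerA mulrC.
Qed.

Lemma cAD a b : cA (a + b) = cA a + cA b.
Proof. by apply: val_inj; rewrite rmorphD /= !val_cA mpolyCD. Qed.

Lemma cAM a b : cA (a * b) = cA a * cA b.
Proof. by apply: val_inj; rewrite rmorphM /= !val_cA mpolyCM. Qed.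

Lemma cA1 : cA 1 = 1.
Proof. by apply: val_inj; rewrite val_cA. Qed.

Lemma cAN a : cA (- a) = - cA a.
Proof. by apply: val_inj; rewrite rmorphN /= !val_cA mpolyCN. Qed.

Lemma psi_cst0 v i : psi_cst 0 v i = 0.
Proof.
rewrite psi_cstE (_ : cA 0 = 0) ?polyC0 ?scale0r //.
by apply: val_inj; rewrite val_cA mpolyC0.
Qed.

Lemma ycoef_eq i : ycoef i i = 'X.
Proof. by rewrite /ycoef unlift_none. Qed.

Lemma ycoef_lo_hi j : ycoef (lo j) (hi j) = (xv k j)%:P.
Proof.
by have := lift_lo_hi j j; rewrite eqxx => -[<- _]; rewrite /ycoef liftK.
Qed.

Lemma ycoef_hi_lo j : ycoef (hi j) (lo j) = (xv k j)%:P.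
Proof.
by have := lift_lo_hi j j; rewrite eqxx => -[_ <-]; rewrite /ycoef liftK.
Qed.

Lemma ycoef_out j l : l != lo j -> l != hi j -> ycoef (lo j) l = ycoef (hi j) l.
Proof.
move=> ll lh; have := lift_lo_hi j; rewrite {1}/ycoef.
case: unliftP ll lh => [l'|] ->; last by rewrite eqxx.
move=> ll lh /(_ l'); case: ifP => [_ [e _]|_ [-> _ _]]; first by rewrite e eqxx in lh.
by rewrite /ycoef liftK.
Qed.

(** The upward maps are inclusions and the downward maps multiplications by
    [z - x_j]. The products in the relations between distant or adjacent [psi]s vanish
    for lack of a path, and the first vertex carries the kernel of 1, which is 0. *)
Lemma psi_rel t u : @Wrel k N t u -> forall v,
  tm_act psi_cst psi_gen t v = tm_act psi_cst psi_gen u v.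
Proof.
case=> {t u} [i j||j i|j l|j i il ih|j|j|j l jl|j l ll lh|j|j|j|j|j l jl|] v /=;
  apply: psi_ext => s.
- case: (eqVneq i j) => [->|ij] /=; rewrite !psi_eE; first by case: (s == j).
  rewrite psi_cst0; case: (eqVneq s i) => [->|//].
  by rewrite (negPf ij).
- rewrite psi_cstE cA1 scale1r.
  pose T (t : term k (Wgen N)) := tm_act psi_cst psi_gen t v.
  rewrite -[tm_act _ _ _ _]/(T _) (big_morph T (id1 := 0) (op1 := +%R)) //; last first.
    by apply: psi_ext => i; rewrite psi_cst0 psi0E.
  have sumE (F : 'I_N.+1 -> psiT) : (\sum_i F i) s = \sum_i F i s.
    by apply: (big_morph (fun u : psiT => u s)) => [u u'|]; [exact: psiDE|exact: psi0E].
  rewrite sumE /T /= (bigD1 s) //= psi_eE eqxx big1 ?addr0 // => i is_.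
  by rewrite psi_eE eq_sym (negPf is_).
- by rewrite !(psi_eE, psi_yE); case: ifP; rewrite ?scaler0.
- by rewrite !psi_yE !scalerA mulrC.
- rewrite psi_pE !psi_eE psi_cst0 [lo j == i]eq_sym (negPf il).
  by rewrite [hi j == i]eq_sym (negPf ih) scaler0 !if_same.
- rewrite psi_pE !psi_eE psi_pE eqxx hi_lo scaler0.
  by case: (s == hi j); rewrite ?if_same.
- rewrite psi_pE !psi_eE psi_pE lo_hi eqxx.
  by case: (eqVneq s (hi j)) => [->|_]; [rewrite hi_lo | case: (s == lo j)].
- have jl0 (j' l' : 'I_N) : (j'.+1 < l')%N || (l'.+1 < j')%N ->
      psi_gen (genPsi j') (psi_gen (genPsi l') v) s = 0.
    move=> h; rewrite psi_pE !psi_pE.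
    have -> : (lo j' == hi l') = false by apply/negbTE; rewrite -(inj_eq val_inj) /=; lia.
    have -> : (lo j' == lo l') = false by apply/negbTE; rewrite -(inj_eq val_inj) /=; lia.
    have -> : (hi j' == hi l') = false by apply/negbTE; rewrite -(inj_eq val_inj) /=; lia.
    have -> : (hi j' == lo l') = false by apply/negbTE; rewrite -(inj_eq val_inj) /=; lia.
    by rewrite scaler0 !if_same.
  have jl' : (l.+1 < j)%N || (j.+1 < l)%N by move: jl => /orP[->|->]; rewrite ?orbT.
  exact: etrans (jl0 _ _ jl) (esym (jl0 _ _ jl')).
- rewrite psi_pE !psi_yE psi_pE (ycoef_out ll lh).
  case: (eqVneq s (hi j)) => [->//|_].
  case: (eqVneq s (lo j)) => [->|_]; last by rewrite ?scaler0.
  by rewrite (ycoef_out ll lh) !scalerA mulrC.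
- rewrite psi_pE !psi_yE psi_pE !ycoef_eq ycoef_hi_lo.
  case: (eqVneq s (hi j)) => [->|_]; first by rewrite ycoef_eq.
  case: (eqVneq s (lo j)) => [->|_]; last by rewrite ?scaler0.
  by rewrite ycoef_lo_hi !scalerA mulrC.
- rewrite psi_pE !psi_yE psi_pE !ycoef_eq ycoef_lo_hi.
  case: (eqVneq s (hi j)) => [->|_]; first by rewrite ycoef_hi_lo.
  case: (eqVneq s (lo j)) => [->|_]; last by rewrite ?scaler0.
  by rewrite ycoef_eq !scalerA mulrC.
- rewrite psi_pE !psi_pE !psiDE psi_cstE !psi_yE !psi_eE eqxx !lo_hi.
  rewrite !hi_lo !eqxx cAN cA1 polyCN polyC1 scaleN1r.
  case: (eqVneq s (lo j)) => [->|nl]; last by rewrite ?(scaler0, subrr, if_same).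
  by rewrite lo_hi ycoef_eq ycoef_lo_hi -scalerBl.
- rewrite psi_pE !psi_pE !psiDE psi_cstE !psi_yE !psi_eE eqxx !lo_hi.
  rewrite !hi_lo !eqxx cAN cA1 polyCN polyC1 scaleN1r.
  case: (eqVneq s (hi j)) => [->|nl].
    by rewrite ycoef_eq ycoef_hi_lo -scalerBl.
  by rewrite ?(scaler0, subrr, if_same).
- have nn (i i' : 'I_N) : (i' == i.+1 :> nat) || (i == i'.+1 :> nat) ->
      psi_gen (genPsi i) (psi_gen (genPsi i') (psi_gen (genPsi i) v)) s = 0.
    move=> ii'; have h1 := psi_pE i v; move: (psi_gen (genPsi i) v) h1 => v1 h1.
    have h2 := psi_pE i' v1; move: (psi_gen (genPsi i') v1) h2 => v2 h2.
    rewrite psi_pE !h2 !h1 {h1 h2}.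
    have -> : (lo i == hi i') = (i == i'.+1 :> nat) by rewrite -(inj_eq val_inj).
    have -> : (lo i == lo i') = false by rewrite -(inj_eq val_inj) /=; lia.
    have -> : (hi i == hi i') = false by rewrite -(inj_eq val_inj) /=; lia.
    have -> : (hi i == lo i') = (i' == i.+1 :> nat) by rewrite -(inj_eq val_inj) eq_sym.
    have -> : (lo i' == hi i) = (i' == i.+1 :> nat) by rewrite -(inj_eq val_inj).
    have -> : (lo i' == lo i) = false by rewrite -(inj_eq val_inj) /=; lia.
    have -> : (hi i' == hi i) = false by rewrite -(inj_eq val_inj) /=; lia.
    have -> : (hi i' == lo i) = (i == i'.+1 :> nat) by rewrite -(inj_eq val_inj) eq_sym.
    case: (eqVneq (i : nat) i'.+1) => [e|ne].
      have -> : (i' == i.+1 :> nat) = false by apply/negbTE; move: e; clear; lia.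
      by rewrite !scaler0 !if_same.
    move: (i' == i.+1 :> nat) (s == hi i) (s == lo i) => B B1 B2.
    have z0 (p : {poly A}) : p *: (0 : zm X) = 0 by exact: scaler0.
    case: B1; first by [].
    case: B2; last by [].
    by case: B; [exact: etrans (congr1 _ (z0 _)) (z0 _) | exact: z0].
  have jl1 : (l == j.+1 :> nat) || (j == l.+1 :> nat) by rewrite jl eqxx.
  have jl2 : (j == l.+1 :> nat) || (l == j.+1 :> nat) by rewrite jl eqxx orbT.
  exact: etrans (nn _ _ jl1) (esym (nn _ _ jl2)).
- rewrite psi_eE psi_cst0; case: eqP => [->|//].
  by have := psi_kill v ord0; rewrite gp_refl scale1r.
Qed.

Lemma psi_cstDr a : {morph psi_cst a : u v / u + v}.
Proof. by move=> u v; apply: psi_ext => i; rewrite psiDE !psi_cstE psiDE scalerDr. Qed.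

Lemma psi_cstDl a b v : psi_cst (a + b) v = psi_cst a v + psi_cst b v.
Proof. by apply: psi_ext => i; rewrite psiDE !psi_cstE cAD polyCD scalerDl. Qed.

Lemma psi_cstM a b v : psi_cst (a * b) v = psi_cst a (psi_cst b v).
Proof. by apply: psi_ext => i; rewrite !psi_cstE cAM polyCM scalerA. Qed.

Lemma psi_cst1 v : psi_cst 1 v = v.
Proof. by apply: psi_ext => i; rewrite !psi_cstE cA1 scale1r. Qed.

Fact psi_act_subproof : {f : Walg k n -> psiT -> psiT |
  f = rep_act psi_cst psi_gen (rel := @Wrel k N)}.
Proof. by eexists. Qed.

Definition psi_act := sval psi_act_subproof.

Let psi_actE : psi_act = rep_act psi_cst psi_gen (rel := @Wrel k N).
Proof. exact: (svalP psi_act_subproof). Qed.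

Fact psi_act_assoc x y v : psi_act x (psi_act y v) = psi_act (x * y) v.
Proof.
rewrite psi_actE; exact: (rep_actA psi_cstDr psi_cstDl psi_cstM psi_cst1
  psi_genD psi_genC psi_rel).
Qed.

Fact psi_act_1 : left_id 1 psi_act.
Proof.
rewrite psi_actE; exact: (rep_act1 psi_cstDr psi_cstDl psi_cstM psi_cst1
  psi_genD psi_genC psi_rel).
Qed.

Fact psi_act_Dr : right_distributive psi_act +%R.
Proof.
rewrite psi_actE; exact: (rep_actDr psi_cstDr psi_cstDl psi_cstM psi_cst1
  psi_genD psi_genC psi_rel).
Qed.

Fact psi_act_Dl v : {morph psi_act^~ v : x y / x + y}.
Proof.
rewrite psi_actE; exact: (rep_actDl psi_cstDr psi_cstDl psi_cstM psi_cst1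
  psi_genD psi_genC psi_rel).
Qed.

HB.instance Definition _ := GRing.Zmodule_isLmodule.Build (Defs.W k N) psiT
  psi_act_assoc psi_act_1 psi_act_Dr psi_act_Dl.

Lemma psi_act_pi t v : (ppi (@Wrel k N) t : Defs.W k N) *: v = tm_act psi_cst psi_gen t v.
Proof.
rewrite [LHS]/GRing.scale /= psi_actE; exact: (rep_act_pi psi_cstDr psi_cstDl psi_cstM psi_cst1
  psi_genD psi_genC psi_rel).
Qed.

Lemma psi_scale_cst a v : (cst n a : Defs.W k N) *: v = psi_cst a v.
Proof. exact: psi_act_pi. Qed.

Lemma psi_scale_e s v : (We k s : Defs.W k N) *: v = psi_gen (genE s) v.
Proof. exact: psi_act_pi. Qed.

Lemma psi_scale_y l v : (Wy k l : Defs.W k N) *: v = psi_gen (genY l) v.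
Proof. exact: psi_act_pi. Qed.

Lemma psi_scale_p j v : (Wp k j : Defs.W k N) *: v = psi_gen (genPsi j) v.
Proof. exact: psi_act_pi. Qed.

Lemma zx_deg j e (x : zm X) : bm_deg e (x : X) -> bm_deg (e + 2) (zx k j *: x : X).
Proof.
move=> xe; rewrite scalerBl; apply: (gradingB (bm_grading X)).
  exact: zscale_degX.
by rewrite addrC; apply: zscale_degC => //; apply: pdeg_X.
Qed.

Lemma gp_deg a b e (x : zm X) : (a <= b)%N -> bm_deg e (x : X) ->
  bm_deg (e + (2 * (b - a))%:Z) (gp k n a b *: x : X).
Proof.
move=> ab xe; elim: b ab => [|b IH] ab.
  by move: ab; rewrite leqn0 => /eqP->; rewrite gp_refl scale1r subnn muln0 addr0.
have [ba|ab'] := leqP a b; last first.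
  have -> : a = b.+1 by lia.
  by rewrite gp_refl scale1r subnn muln0 addr0.
rewrite (gp_recr _ _ ba) mulrC -scalerA.
have -> : e + (2 * (b.+1 - a))%:Z = e + (2 * (b - a))%:Z + 2 by lia.
exact/zx_deg/IH.
Qed.

(** Shifting the vertices by their distance to the last one makes the upward
    maps, which are inclusions, of degree 1. *)
Definition psi_deg (d : int) (v : psiT) : Prop :=
  forall i : 'I_N.+1, bm_deg (d + (N - i)%:Z) (v i : X).

Let hX d (x : zm X) : zm X := hcomp (bm_grading X) d (x : X).

Lemma psi_comp_subproof d (v : psiT) (i : 'I_N.+1) :
  gp k n 0 i *: hX (d + (N - i)%:Z) (v i) = 0.
Proof.
have gD : {morph (fun x : X => gp k n 0 i *: (x : zm X) : X) : x y / x + y}.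
  by move=> x y; rewrite scalerDr.
have gdeg e x : bm_deg e x -> bm_deg (e + (2 * (i - 0))%:Z) (gp k n 0 i *: (x : zm X) : X).
  exact: gp_deg.
have := hcomp_hom (bm_grading X) (bm_grading X) gD gdeg (d + (N - i)%:Z) (v i).
by rewrite psi_kill hcomp0 => <-.
Qed.

Definition psi_comp d v : psiT := psi_mk (psi_comp_subproof d v).

Lemma psi_compE d v i : psi_comp d v i = hX (d + (N - i)%:Z) (v i).
Proof. exact: psi_mkE. Qed.

Lemma psi_grading : is_grading psi_deg.
Proof.
have gX := bm_grading X; split.
- by move=> d i; rewrite psi0E; apply: grading0 gX _.
- move=> d u v hu hv i; rewrite psiDE.
  have -> : (- v) i = - v i by apply: (@addrI _ (v i)); rewrite -psiDE !subrr psi0E.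
  exact: (gradingB gX (hu i) (hv i)).
- move=> v; have /choice[r rP] (i : 'I_N.+1) := hcomp_sum (bm_grading X) (v i).
  pose s := undup (flatten [seq [seq e - (N - i)%:Z | e <- r i] | i : 'I_N.+1]).
  exists [seq (d, psi_comp d v) | d <- s]; split.
    move=> _ /mapP[d _ ->] /= i; rewrite psi_compE; exact: hcomp_deg.
  rewrite big_map /=; apply: psi_ext => i.
  have sumE (F : int -> psiT) : (\sum_(d <- s) F d) i = \sum_(d <- s) F d i.
    by apply: (big_morph (fun u : psiT => u i)) => [u u'|]; [exact: psiDE|exact: psi0E].
  apply/esym; rewrite (sumE (psi_comp^~ v)) (eq_bigr _ (fun d _ => psi_compE d v i)).
  have [ur r0 e0] := rP i.
  have e1 : \sum_(d <- r i) hX d (v i) = v i := e0.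
  rewrite -[RHS]e1 {e0 e1}.
  rewrite -(big_map (fun d => d + (N - i)%:Z) xpredT (fun e => hX e (v i))).
  have us : uniq [seq d + (N - i)%:Z | d <- s].
    by rewrite map_inj_uniq ?undup_uniq // => d e /addIr.
  rewrite (bigID (mem (r i))) /= [X in _ + X]big1 ?addr0; last first.
    by move=> e; rewrite /hX => /r0.
  rewrite -big_filter; apply: perm_big; apply: uniq_perm => //.
    exact: filter_uniq.
  move=> e; rewrite mem_filter; case: (boolP (e \in r i)) => //= er.
  apply/mapP; exists (e - (N - i)%:Z); last by rewrite subrK.
  rewrite mem_undup; apply/flattenP; exists [seq e - (N - i)%:Z | e <- r i].
    by apply/mapP; exists i; rewrite ?mem_enum.
  exact: map_f.
- apply: (@grading_proj_indep _ _ psi_comp).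
  + move=> d u v; apply: psi_ext => i; rewrite psiDE !psi_compE psiDE.
    exact: (hcompD (bm_grading X)).
  + move=> d v hv; apply: psi_ext => i; rewrite psi_compE.
    exact: (hcomp_id (bm_grading X) (hv i)).
  + move=> d e v hv ed; apply: psi_ext => i; rewrite psi_compE psi0E.
    by apply: (hcomp_ne (bm_grading X) (hv i)) => /addIr.
Qed.

Lemma psi_degZ i j (a : Defs.W k N) v : gr_deg i a -> psi_deg j v -> psi_deg (i + j) (a *: v).
Proof.
have gX := bm_grading X.
case=> t ht -> {a}; rewrite psi_act_pi.
elim: ht j v => {i t} [d|c|g|d t u _ IH1 _ IH2|d e t u _ IH1 _ IH2] j v hv /=.
- by move=> i; rewrite psi_cst0; apply: grading0 gX _.
- move=> i; rewrite psi_cstE add0r -[j + _]add0r; apply: zscale_degC; last exact: hv.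
  rewrite val_cA; move=> m; rewrite msuppC; case: ifP => // _; rewrite inE => /eqP->.
  by rewrite mdeg0.
- case: g => [s|l|p] i.
  + by rewrite psi_eE add0r; case: ifP => _; [apply: hv | apply: grading0 gX _].
  + rewrite psi_yE /ycoef -addrA; case: (unlift i l) => [l'|].
      by apply: zscale_degC; [apply: pdeg_X | apply: hv].
    by rewrite addrC; apply: zscale_degX; apply: hv.
  + rewrite psi_pE; case: eqP => [->|_].
      have -> : 1 + j + (N - hi p)%:Z = j + (N - lo p)%:Z.
        by have := ltn_ord p; rewrite /=; lia.
      exact: hv.
    case: eqP => [->|_]; last exact: grading0 gX _.
    have -> : 1 + j + (N - lo p)%:Z = j + (N - hi p)%:Z + 2.
      by have := ltn_ord p; rewrite /=; lia.
    exact/zx_deg/hv.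
- by move=> i; rewrite psiDE; apply: gradingD gX _ _; [apply: IH1 | apply: IH2].
- by rewrite -addrA; apply/IH1/IH2.
Qed.

End Object.

Definition psi_gmod X : gmod (Defs.W k N) := GMod (psi_grading X) (@psi_degZ X).

End Psi.

Section WModules.
Variables (k : fieldType) (n : nat).
Local Notation N := n.+1.
Local Notation R := {mpoly k[N]}.
Local Notation hat := (hat1 N).
Local Notation A := (invring k (set0 : {set 'I_N.-1})).
Local Notation W := (Walg k n).
Local Notation WG := (Defs.W k N).
Local Notation lo j := (@lo N.+1 j).
Local Notation hi j := (@hi N.+1 j).

(** A module over the graded ring, seen over [Walg k n]; the action is sealed
    as unification must not unfold it. *)
Definition wm (M : gmod WG) : Type := M.

Section Alias.
Variable M : gmod WG.
HB.instance Definition _ := GRing.Zmodule.on (wm M).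

Fact wact_subproof : {f : W -> wm M -> wm M | f = fun a (x : M) => (a : WG) *: x}.
Proof. by eexists. Qed.

Definition wact := sval wact_subproof.

Let wactE : wact = fun a (x : M) => (a : WG) *: x.
Proof. exact: (svalP wact_subproof). Qed.

Fact wact_assoc a b x : wact a (wact b x) = wact (a * b) x.
Proof. by rewrite wactE; apply: scalerA. Qed.

Fact wact_1 : left_id 1 wact.
Proof. by rewrite wactE => x; apply: scale1r. Qed.

Fact wact_Dr : right_distributive wact +%R.
Proof. by rewrite wactE => a x y; apply: scalerDr. Qed.

Fact wact_Dl x : {morph wact^~ x : a b / a + b}.
Proof. by rewrite wactE => a b; apply: scalerDl. Qed.

HB.instance Definition _ := GRing.Zmodule_isLmodule.Build W (wm M)
  wact_assoc wact_1 wact_Dr wact_Dl.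

Lemma wscaleE (a : W) (x : wm M) : a *: x = (a : WG) *: (x : M) :> M.
Proof. by rewrite [LHS]/GRing.scale /= wactE. Qed.

Lemma wscale_deg d e (a : W) (x : wm M) : wdeg d a -> gm_deg e (x : M) ->
  gm_deg (d + e) (a *: x : M).
Proof. by rewrite wscaleE; apply: gm_degZ. Qed.

End Alias.

Lemma gmod_homD (M M' : gmod WG) (f : gmod_hom M M') (x y : wm M) :
  sval f (x + y) = (sval f x : wm M') + sval f y.
Proof. by have [lf _] := svalP f; have := lf 1 x y; rewrite !scale1r. Qed.

Lemma gmod_hom0 (M M' : gmod WG) (f : gmod_hom M M') : sval f (0 : wm M) = (0 : wm M').
Proof. by apply: (@addrI _ (sval f (0 : wm M) : wm M')); rewrite -gmod_homD !addr0. Qed.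

Lemma gmod_homZ (M M' : gmod WG) (f : gmod_hom M M') (a : W) (x : wm M) :
  sval f (a *: x) = a *: (sval f x : wm M').
Proof.
have [lf _] := svalP f; have := lf a x 0; have := gmod_hom0 f.
by rewrite !wscaleE => ->; rewrite !addr0.
Qed.

Lemma gmod_hom_sum (M M' : gmod WG) (f : gmod_hom M M') (J : Type) (r : seq J)
    (P : pred J) (F : J -> wm M) :
  sval f (\sum_(i <- r | P i) F i) = \sum_(i <- r | P i) (sval f (F i) : wm M').
Proof. exact: (big_morph (sval f : wm M -> wm M') (gmod_homD f) (gmod_hom0 f)). Qed.

Lemma gmod_hom_deg (M M' : gmod WG) (f : gmod_hom M M') d x :
  gm_deg d x -> gm_deg d (sval f x).
Proof. by have [_] := svalP f; apply. Qed.

Lemma gmod_hom_mk (M M' : gmod WG) (f : wm M -> wm M') : {morph f : x y / x + y} ->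
  (forall (a : W) x, f (a *: x) = a *: f x) ->
  (forall d (x : M), gm_deg d x -> gm_deg d (f x : M')) ->
  exists F : gmod_hom M M', forall x, sval F x = f x.
Proof.
move=> fD fZ fd; suff hf : linear (f : M -> M') /\ forall i x, gm_deg i x -> gm_deg i (f x : M').
  by exists (exist _ f hf).
split=> // a x y; have := fZ a x; rewrite !wscaleE => <-; exact: fD.
Qed.

(** Linearity over the algebra is checked on the generators. *)
Lemma w_linear (M M' : gmod WG) (f : wm M -> wm M') : {morph f : x y / x + y} ->
  (forall c x, f (cst n c *: x) = cst n c *: f x) ->
  (forall i x, f (We k i *: x) = We k i *: f x) ->
  (forall i x, f (Wy k i *: x) = Wy k i *: f x) ->
  (forall i x, f (Wp k i *: x) = Wp k i *: f x) ->
  forall (a : W) x, f (a *: x) = a *: f x.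
Proof.
move=> fD fc fe fy fp; apply: Walg_ind => // [a b ha hb|a b ha hb] x.
  by rewrite !scalerDl fD ha hb.
by rewrite -!scalerA ha hb.
Qed.

Local Notation bimod := (gbimod (RI k (set0 : {set 'I_N.-1})) (RI k hat)).
Local Coercion psi_at : psiT >-> Funclass.

Section PsiAction.
Variable X : bimod.
Implicit Types v : wm (psi_gmod X).

Lemma psiwE (a : W) v : a *: v = (a : WG) *: (v : psi_gmod X) :> psiT X.
Proof. exact: (@wscaleE (psi_gmod X) a v). Qed.

Lemma psiw_e s v i : psi_at (We k s *: v) i = if i == s then psi_at v i else 0.
Proof. by rewrite psiwE psi_scale_e psi_eE. Qed.

Lemma psiw_p j v i : psi_at (Wp k j *: v) i =
  if i == hi j then psi_at v (lo j) else
  if i == lo j then zx k j *: psi_at v (hi j) else 0.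
Proof. by rewrite psiwE psi_scale_p psi_pE. Qed.

Lemma psiw_y l v i : psi_at (Wy k l *: v) i = ycoef k i l *: psi_at v i.
Proof. by rewrite psiwE psi_scale_y psi_yE. Qed.

Lemma psiw_cst c v i : psi_at (cst n c *: v) i = (cA n c)%:P *: psi_at v i.
Proof. by rewrite psiwE psi_scale_cst psi_cstE. Qed.

Lemma psiwD u v i : psi_at (u + v) i = psi_at u i + psi_at v i.
Proof. exact: psiDE. Qed.

Lemma psiw_0 i : psi_at (0 : wm (psi_gmod X)) i = 0.
Proof. exact: psi0E. Qed.

Lemma psiw_sum (J : Type) (r : seq J) (P : pred J) (F : J -> wm (psi_gmod X)) i :
  psi_at (\sum_(s <- r | P s) F s) i = \sum_(s <- r | P s) psi_at (F s) i.
Proof.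
exact: (big_morph (fun v : wm (psi_gmod X) => psi_at v i) (fun u v => psiwD u v i) (psiw_0 i)).
Qed.

Lemma psiw_ext u v : (forall i, psi_at u i = psi_at v i) -> u = v.
Proof. exact: psi_ext. Qed.

Lemma psiw_Wx l v i : psi_at (Wx k l *: v) i = (xv k l)%:P *: psi_at v i.
Proof.
rewrite /Wx scaler_suml psiw_sum (bigD1 i) //= big1 ?addr0 => [|i' ni].
  by rewrite -scalerA psiw_y psiw_e eqxx /ycoef liftK.
by rewrite -scalerA psiw_y psiw_e eq_sym (negPf ni) scaler0.
Qed.

Lemma psiw_Wz v i : psi_at (Wz k n *: v) i = 'X *: psi_at v i.
Proof.
rewrite /Wz scaler_suml psiw_sum (bigD1 i) //= big1 ?addr0 => [|i' ni].
  by rewrite -scalerA psiw_y psiw_e eqxx ycoef_eq.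
by rewrite -scalerA psiw_y psiw_e eq_sym (negPf ni) scaler0.
Qed.

Lemma A_val (p : R) : exists a : A, val a = p.
Proof.
have pA : p \in Defs.invariant (set0 : {set 'I_N.-1}).
  by apply: invariant_refl => j; rewrite inE.
by exists (InvRing pA).
Qed.

Lemma psiw_mev (a : A) v i : psi_at (mev (val a) *: v) i = a%:P *: psi_at v i.
Proof.
have [p pa] : exists p, p = val a by eexists.
rewrite -pa; elim/mpoly_alg_ind: p v a pa => [c|l|p q hp hq|p q hp hq] v a pa.
- by rewrite mevC psiw_cst; congr (_%:P *: _); apply: val_inj; rewrite val_cA.
- by rewrite mevX psiw_Wx; congr (_%:P *: _); apply: val_inj.
- have [b bp] := A_val p; have [c cq] := A_val q.
  have -> : a = b + c by apply: val_inj; rewrite rmorphD /= bp cq.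
  by rewrite rmorphD scalerDl psiwD (hp v b) // (hq v c) // polyCD scalerDl.
- have [b bp] := A_val p; have [c cq] := A_val q.
  have -> : a = b * c by apply: val_inj; rewrite rmorphM /= bp cq.
  by rewrite rmorphM -scalerA (hp _ b) // (hq _ c) // polyCM scalerA.
Qed.

Lemma psiw_ev (p : {poly A}) v i : psi_at (ev p *: v) i = p *: psi_at v i.
Proof.
elim/poly_ind: p v => [|p a IH] v; first by rewrite rmorph0 !scale0r psiw_0.
rewrite rmorphD rmorphM /= evX evC !scalerDl psiwD -!scalerA IH psiw_Wz psiw_mev.
by rewrite scalerA.
Qed.

End PsiAction.

Section PsiMap.
Variables (X Y : bimod) (f : gbimod_hom X Y).

Lemma gbimod_homD (x y : X) : sval f (x + y) = sval f x + sval f y.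
Proof. by have [] := svalP f. Qed.

Lemma gbimod_hom0 : sval f 0 = 0.
Proof. by apply: (@addrI _ (sval f 0)); rewrite -gbimod_homD !addr0. Qed.

Lemma gbimod_hom_deg d x : bm_deg d x -> bm_deg d (sval f x).
Proof. by have [_ _ _] := svalP f; apply. Qed.

Lemma psi_map_kill (v : psiT X) (i : 'I_N.+1) :
  gp k n 0 i *: (sval f (v i) : zm Y) = 0.
Proof. by have := hom_zscale f (gp k n 0 i) (v i); rewrite psi_kill gbimod_hom0. Qed.

Lemma psi_map_exists : exists F : gmod_hom (psi_gmod X) (psi_gmod Y),
  forall v i, psi_at (sval F v) i = sval f (psi_at v i).
Proof.
pose g (v : wm (psi_gmod X)) : wm (psi_gmod Y) := psi_mk (psi_map_kill v).
have gE v i : psi_at (g v) i = sval f (psi_at v i) by apply: psi_mkE.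
have fZ p (x : zm X) := hom_zscale f p x.
have [| | |F FE] := @gmod_hom_mk _ _ g.
- by move=> u v; apply: psiw_ext => i; rewrite psiwD !gE psiwD gbimod_homD.
- apply: w_linear => [u v|c v|s v|l v|j v]; apply: psiw_ext => i.
  + by rewrite psiwD !gE psiwD gbimod_homD.
  + by rewrite psiw_cst !gE psiw_cst fZ.
  + by rewrite psiw_e !gE psiw_e; case: ifP => // _; rewrite gbimod_hom0.
  + by rewrite psiw_y !gE psiw_y fZ.
  + rewrite psiw_p !gE psiw_p; case: ifP => // _; case: ifP => _; first by rewrite fZ.
    by rewrite gbimod_hom0.
- by move=> d v hv i; rewrite gE; apply/gbimod_hom_deg/hv.
- by exists F => v i; rewrite FE gE.
Qed.

Definition psi_map := sval (cid psi_map_exists).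

Lemma psi_mapE v i : psi_at (sval psi_map v) i = sval f (psi_at v i).
Proof. exact: (svalP (cid psi_map_exists)). Qed.

End PsiMap.

Lemma psi_map_id (X : bimod) : psi_map (gbimod_id X) = gmod_id (psi_gmod X).
Proof.
by apply: sval_inj; apply: funext => v; apply: psi_ext => i; rewrite psi_mapE.
Qed.

Lemma psi_map_cmp (X Y Z : bimod) (g : gbimod_hom Y Z) (f : gbimod_hom X Y) :
  psi_map (gbimod_cmp g f) = gmod_cmp (psi_map g) (psi_map f).
Proof.
apply: sval_inj; apply: funext => v; apply: psi_ext => i.
by rewrite psi_mapE /= !psi_mapE.
Qed.

End WModules.

(** * From modules to bimodules *)

Section Phi.
Variables (k : fieldType) (n : nat).
Local Notation N := n.+1.
Local Notation hat := (hat1 N).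
Local Notation A := (invring k (set0 : {set 'I_N.-1})).
Local Notation W := (Walg k n).
Local Notation WG := (Defs.W k N).
Local Notation lo j := (@lo N.+1 j).
Local Notation hi j := (@hi N.+1 j).
Local Notation bimod := (gbimod (RI k (set0 : {set 'I_N.-1})) (RI k hat)).
Local Notation eN := (eW k n N).

Definition kap (q : invring k hat) : {poly A} :=
  map_poly (iincl (subsetT (set0 : {set 'I_N.-1}))) (kappa q).

Lemma evl_kap q l : evl l (kap q) = msym (tperm ord0 l) (val q).
Proof. by rewrite evl_iincl evl_kappa. Qed.

Lemma hpoly_kap e q : pdeg e (val q) -> hpoly e (kap q).
Proof.
move=> /hpoly_kappa h i; have -> : val (kap q)`_i = val (kappa q)`_i; last exact: h.
by rewrite coef_map; exact: val_iincl.
Qed.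

Lemma evB (p q : {poly A}) : ev (p - q) = ev p - ev q.
Proof. by have := rmorphD (@ev k n) (p - q) q; rewrite subrK => ->; rewrite addrK. Qed.

Section Object.
Variable M : gmod WG.

Definition phi_pred : {pred wm M} := fun x => eN *: x == x.

Fact phi_zmod_closed : zmod_closed phi_pred.
Proof.
split; first by rewrite /in_mem /= /phi_pred scaler0.
by move=> x y /eqP hx /eqP hy; apply/eqP; rewrite scalerBr hx hy.
Qed.
HB.instance Definition _ := GRing.isZmodClosed.Build _ phi_pred phi_zmod_closed.

Record phiT := PhiT { phi_val :> wm M; _ : phi_val \in phi_pred }.
HB.instance Definition _ := [isSub for phi_val].
HB.instance Definition _ := [Choice of phiT by <:].
HB.instance Definition _ := [SubChoice_isSubZmodule of phiT by <:].

Lemma phiP (x : phiT) : eN *: phi_val x = phi_val x.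
Proof. exact/eqP/(valP x). Qed.

Lemma phi_inj : injective phi_val.
Proof. exact: val_inj. Qed.

Lemma phi_valD (x y : phiT) : phi_val (x + y) = phi_val x + phi_val y.
Proof. by []. Qed.

Lemma phi_ev_subproof (p : {poly A}) (x : phiT) : ev p *: phi_val x \in phi_pred.
Proof. by apply/eqP; rewrite scalerA -ev_comm -scalerA phiP. Qed.

Fact phi_ev_sealed : {f : {poly A} -> phiT -> phiT |
  forall p x, phi_val (f p x) = ev p *: phi_val x}.
Proof. by exists (fun p x => PhiT (phi_ev_subproof p x)). Qed.

Definition phi_ev := sval phi_ev_sealed.

Lemma phi_evE p x : phi_val (phi_ev p x) = ev p *: phi_val x.
Proof. exact: (svalP phi_ev_sealed). Qed.

(** At the last vertex a polynomial acts through its values at the [x_l]. *)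
Lemma phi_ev_eq p q x : (forall l, evl l p = evl l q) -> phi_ev p x = phi_ev q x.
Proof.
move=> pq; apply: phi_inj; rewrite !phi_evE -[phi_val x]phiP !scalerA.
congr (_ *: _); apply: subr0_eq.
have pq0 : ev (p - q) * eN = 0.
  by apply: evl_kill => // l _; rewrite evlD evlN pq subrr.
by rewrite -[RHS]pq0 evB mulrBl.
Qed.

Lemma phi_evDr p x y : phi_ev p (x + y) = phi_ev p x + phi_ev p y.
Proof. by apply: phi_inj; rewrite phi_valD !phi_evE phi_valD scalerDr. Qed.

Lemma phi_evDl p q x : phi_ev (p + q) x = phi_ev p x + phi_ev q x.
Proof. by apply: phi_inj; rewrite phi_valD !phi_evE rmorphD scalerDl. Qed.

Lemma phi_evM p q x : phi_ev (p * q) x = phi_ev p (phi_ev q x).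
Proof. by apply: phi_inj; rewrite !phi_evE rmorphM scalerA. Qed.

Lemma phi_ev1 x : phi_ev 1 x = x.
Proof. by apply: phi_inj; rewrite !phi_evE rmorph1 scale1r. Qed.

Definition phi_lact (a : A) (x : phiT) : phiT := phi_ev a%:P x.
Definition phi_ract (x : phiT) (q : invring k hat) : phiT := phi_ev (kap q) x.
Definition phi_deg (d : int) (x : phiT) : Prop := gm_deg d (phi_val x : M).

Lemma phi_bimodule : @is_bimodule (RI k (set0 : {set 'I_N.-1})) (RI k hat) phiT phi_lact phi_ract.
Proof.
rewrite /phi_lact /phi_ract; split=> *.
- exact: phi_evDr.
- by rewrite polyCD phi_evDl.
- by rewrite polyCM phi_evM.
- exact: phi_ev1.
- exact: phi_evDr.
- rewrite -phi_evDl; apply: phi_ev_eq => l; rewrite evlD !evl_kap.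
  by rewrite -rmorphD.
- rewrite -phi_evM; apply: phi_ev_eq => l; rewrite evlM !evl_kap.
  by rewrite -rmorphM mulrC.
- rewrite -[RHS]phi_ev1; apply: phi_ev_eq => l; rewrite evl1 evl_kap.
  exact: rmorph1.
- by rewrite -!phi_evM mulrC.
Qed.

Lemma phi_comp_subproof d (x : phiT) : hcomp (gm_grading M) d (phi_val x : M) \in phi_pred.
Proof.
apply/eqP; have eD : {morph (fun x : M => eN *: (x : wm M) : M) : x y / x + y}.
  by move=> ? ?; rewrite scalerDr.
have edeg e (y : M) : gm_deg e y -> gm_deg (e + 0) (eN *: (y : wm M) : M).
  move=> ye; have := wscale_deg (wdeg_We _ (inord N)) ye.
  by rewrite add0r addr0.
have := hcomp_hom (gm_grading M) (gm_grading M) eD edeg d (phi_val x).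
by rewrite addr0 phiP => <-.
Qed.

Lemma phi_grading : is_grading phi_deg.
Proof.
apply: (@sub_grading phiT M _ (gm_grading M) phi_val) => [x y|x y|d x].
- exact: phi_valD.
- exact: phi_inj.
- by exists (PhiT (phi_comp_subproof d x)).
Qed.

Lemma phi_deg_ev d e p x : hpoly d p -> phi_deg e x -> phi_deg (d + e) (phi_ev p x).
Proof.
by move=> dp; rewrite /phi_deg phi_evE; apply: wscale_deg; apply: wdeg_ev.
Qed.

Lemma hpolyC e (a : A) : pdeg e (val a) -> hpoly e a%:P.
Proof.
move=> ea [|i]; rewrite coefC /=; last by move=> m; rewrite msupp0.
by rewrite muln0 subr0.
Qed.

End Object.

(** The last vertex of [M]; there [R^hat1] acts through its image in [R[z]]. *)
Definition phi_gbimod (M : gmod WG) : bimod.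
Proof.
apply: (GBimod (phi_bimodule M) (phi_grading M)) => [i j a x ai xj|i j x q xi qj].
  exact: phi_deg_ev (hpolyC ai) xj.
by rewrite addrC; apply: phi_deg_ev (hpoly_kap qj) xi.
Defined.

Lemma phi_zscale (M : gmod WG) (p : {poly A}) (x : zm (phi_gbimod M)) :
  phi_val (p *: x : phiT M) = ev p *: phi_val (x : phiT M).
Proof.
elim/poly_ind: p x => [|p a IH] x; first by rewrite rmorph0 !scale0r.
have -> : (p * 'X + a%:P) *: x = p *: ('X *: x) + a%:P *: x by rewrite scalerDl scalerA.
have -> : ev (p * 'X + a%:P) = ev p * ev 'X + ev a%:P by rewrite rmorphD rmorphM.
rewrite scalerDl -scalerA phi_valD IH zscaleX zscaleC.
rewrite -[ev 'X *: _]phi_evE -[ev a%:P *: _]phi_evE.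
congr (_ *: phi_val _ + _); apply: phi_ev_eq => l; rewrite evl_kap evlX /= msymU.
by rewrite tpermL.
Qed.

Lemma phi_central (M : gmod WG) : central (phi_gbimod M).
Proof.
move=> c x; apply: phi_ev_eq => l; rewrite evlC evl_kap !val_iincl.
have [-> |l0] := eqVneq l ord0; first by rewrite tperm1 msym1m.
by rewrite (tperm_invariant (valP c)) // ?lt0n // => j _; rewrite inE.
Qed.

Section PhiMap.
Variables (M M' : gmod WG) (f : gmod_hom M M').

Lemma phi_map_subproof (x : phiT M) : (sval f (phi_val x) : wm M') \in @phi_pred M'.
Proof. by apply/eqP; rewrite -gmod_homZ phiP. Qed.

Lemma phi_map_hom : @is_gbimod_hom _ _ (phi_gbimod M) (phi_gbimod M')
  (fun x => PhiT (phi_map_subproof x)).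
Proof.
pose F x := PhiT (phi_map_subproof x); rewrite -/F.
have FE x : phi_val (F x) = sval f (phi_val x) by [].
have ev_hom p x : F (phi_ev p x) = phi_ev p (F x).
  by apply: phi_inj; rewrite FE !phi_evE FE gmod_homZ.
split=> [x y|a x|x q|d x].
- by apply: phi_inj; rewrite phi_valD !FE phi_valD gmod_homD.
- exact: ev_hom.
- exact: ev_hom.
- exact: gmod_hom_deg.
Qed.

Definition phi_map : gbimod_hom (phi_gbimod M) (phi_gbimod M') := exist _ _ phi_map_hom.

Lemma phi_mapE (x : phiT M) : phi_val (sval phi_map x : phiT M') = sval f (phi_val x).
Proof. by []. Qed.

End PhiMap.

Lemma phi_map_id (M : gmod WG) : phi_map (gmod_id M) = gbimod_id (phi_gbimod M).
Proof. by apply: sval_inj; apply: funext => x; apply: phi_inj. Qed.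

Lemma phi_map_cmp (M M' M'' : gmod WG) (g : gmod_hom M' M'') (f : gmod_hom M M') :
  phi_map (gmod_cmp g f) = gbimod_cmp (phi_map g) (phi_map f).
Proof. by apply: sval_inj; apply: funext => x; apply: phi_inj. Qed.

End Phi.

(** * The unit and the counit *)

Section Units.
Variables (k : fieldType) (n : nat).
Local Notation N := n.+1.
Local Notation hat := (hat1 N).
Local Notation A := (invring k (set0 : {set 'I_N.-1})).
Local Notation W := (Walg k n).
Local Notation WG := (Defs.W k N).
Local Notation lo j := (@lo N.+1 j).
Local Notation hi j := (@hi N.+1 j).
Local Notation bimod := (gbimod (RI k (set0 : {set 'I_N.-1})) (RI k hat)).
Local Notation eN := (eW k n N).

Lemma upW_cons i m : upW k n i m.+1 = upW k n i.+1 m * pW k n i.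
Proof.
by elim: m => [|m IH] /=; rewrite ?addn0 ?mulr1 ?mul1r // -mulrA -IH /= addSnnS.
Qed.

(** The shortest path from the vertex [i] to the last one. *)
Definition toN (i : 'I_N.+1) : W := upW k n i (N - i) * We k i.

Lemma eN_toN i : eN * toN i = toN i.
Proof.
rewrite /toN mulrA; have iN : (i + (N - i) = N)%N by have := ltn_ord i; lia.
by rewrite -[in eW _ _ N]iN upW_e ?iN // -eW_ord -mulrA eW_idem.
Qed.

Lemma toN_e i s : toN i * We k s = if i == s then toN i else 0.
Proof. by rewrite /toN -mulrA We_idem; case: ifP => // _; rewrite mulr0. Qed.

Lemma toN_y i l : toN i * Wy k l = ev (ycoef k i l) * toN i.
Proof.
rewrite /toN -mulrA -WyE Wy_central mulrA [RHS]mulrA ev_comm; congr (_ * _ * _).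
by rewrite /ycoef; case: unliftP => [l'|] _; rewrite ?evX // evC mevX.
Qed.

Lemma toN_p i (j : 'I_N) : toN i * Wp k j =
  if i == hi j then toN (lo j) else if i == lo j then ev (zx k j) * toN (hi j) else 0.
Proof.
have lN : (N - j = (N - j.+1).+1)%N by have := ltn_ord j; lia.
rewrite /toN -mulrA; case: (eqVneq i (hi j)) => [->|ih].
  by rewrite -WpE_lo mulrA /= lN upW_cons pW_ord.
case: (eqVneq i (lo j)) => [->|il]; last by rewrite WpE_out ?mulr0.
rewrite -WpE_hi /= lN upW_cons pW_ord -mulrA [Wp k j * (_ * _)]mulrA Wp2_zx_hi.
by rewrite [LHS]mulrA -ev_comm mulrA.
Qed.

Lemma toN_kill (i : 'I_N.+1) : ev (gp k n 0 i) * toN i = 0.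
Proof.
rewrite /toN mulrA ev_comm -mulrA -eW_ord gp_kill ?mulr0 //.
by have := ltn_ord i.
Qed.

Lemma wdeg_toN (i : 'I_N.+1) : wdeg (N - i)%:Z (toN i).
Proof.
have := wdegM (wdeg_pth k (leqnn N) (leq_ord i)) (wdeg_We k i).
by rewrite addr0 /pth /toN (_ : (i <= N)%N) //; have := ltn_ord i.
Qed.

Section Eta.
Variable M : gmod WG.

Lemma eta_phi (i : 'I_N.+1) (x : wm M) : toN i *: x \in @phi_pred k n M.
Proof. by apply/eqP; rewrite scalerA eN_toN. Qed.

Definition eta_at x i : zm (phi_gbimod M) := PhiT (eta_phi i x).

Lemma eta_atE x i : phi_val (eta_at x i : phiT M) = toN i *: x.
Proof. by []. Qed.

Lemma eta_kill x (i : 'I_N.+1) : gp k n 0 i *: eta_at x i = 0.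
Proof. by apply: phi_inj; rewrite phi_zscale eta_atE scalerA toN_kill scale0r. Qed.

(** Commuting with the [psi]s amounts to [toN_p], since a descent followed by the
    path back up is multiplication by [z - x_j]. *)
Lemma eta_exists : exists F : gmod_hom M (psi_gmod (phi_gbimod M)),
  forall x i, phi_val (psi_at (sval F x) i : phiT M) = toN i *: (x : wm M).
Proof.
pose g (x : wm M) : wm (psi_gmod (phi_gbimod M)) := psi_mk (eta_kill x).
have gE x i : psi_at (g x) i = eta_at x i by apply: psi_mkE.
have gD : {morph g : x y / x + y}.
  move=> x y; apply: psiw_ext => i; rewrite psiwD !gE; apply: phi_inj.
  by rewrite phi_valD !eta_atE scalerDr.
have v0 : phi_val (0 : zm (phi_gbimod M)) = 0 by [].
have [| | |F FE] := @gmod_hom_mk _ _ _ _ g; first exact: gD.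
- apply: w_linear => [|c x|s x|l x|j x]; first exact: gD;
    apply: psiw_ext => i.
  + rewrite psiw_cst !gE; apply: phi_inj.
    by rewrite phi_zscale !eta_atE evC val_cA mevC !scalerA cst_comm.
  + rewrite psiw_e !gE; apply: phi_inj; rewrite eta_atE scalerA toN_e.
    by case: ifP => // _; rewrite v0 scale0r.
  + rewrite psiw_y !gE; apply: phi_inj.
    by rewrite phi_zscale !eta_atE !scalerA toN_y.
  + rewrite psiw_p !gE; apply: phi_inj; rewrite eta_atE scalerA toN_p.
    case: ifP => // _; case: ifP => _; last by rewrite v0 scale0r.
    by rewrite phi_zscale eta_atE scalerA.
- move=> d x dx i; rewrite gE.
  have := wscale_deg (wdeg_toN i) dx; rewrite addrC -eta_atE; exact.
- by exists F => x i; rewrite FE gE eta_atE.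
Qed.

Definition eta := sval (cid eta_exists).

Lemma etaE x i : phi_val (psi_at (sval eta x) i : phiT M) = toN i *: (x : wm M).
Proof. exact: (svalP (cid eta_exists)). Qed.

End Eta.

Lemma eta_nat (M M' : gmod WG) (f : gmod_hom M M') :
  gmod_cmp (eta M') f = gmod_cmp (psi_map (phi_map f)) (eta M).
Proof.
apply: sval_inj; apply: funext => x; apply: psi_ext => i; apply: phi_inj.
by rewrite /= etaE psi_mapE phi_mapE etaE gmod_homZ.
Qed.

Section Epsilon.
Variable X : bimod.

(** The product of all the [z - x_l] has symmetric coefficients, and its value at
    [z = x_0] is 0. *)
Lemma central_kill (cX : central X) (p : {poly A}) (x : zm X) :
  (forall l, evl l p = 0) -> p *: x = 0.
Proof.
have bN : bdry [set: 'I_N.-1] N by move=> i _; have := ltn_ord i => /=; lia.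
have [F [F0 Fdvd]] := vanishing_poly k bN => p0.
have [q ->] := Fdvd _ (subsetT _) p (fun l _ => p0 l).
rewrite -scalerA; have -> : map_poly (iincl (subsetT set0)) F *: x = 0; last exact: scaler0.
have e0 : (map_poly (iincl (subsetT hat)) F).[x0 k n] = 0.
  apply: val_inj; rewrite -horner_map /= -[RHS](F0 ord0) //.
  exact: (evl_iincl (subsetT hat)).
rewrite (central_ract F x cX) e0.
have bm := @bm_bimodule _ _ X; have rD := ractDr bm (x : X) 0 0.
by apply: (@addrI _ (ract (x : X) (0 : RI k hat))); rewrite -rD !addr0.
Qed.

Hypothesis cX : central X.

(** The last vertex of the module attached to [X] is [X] itself. *)
Lemma eps_hom : @is_gbimod_hom _ _ (phi_gbimod (psi_gmod X)) X
  (fun v => psi_at (phi_val (v : phiT (psi_gmod X))) ord_max).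
Proof.
split=> [u v|a v|v q|d v dv].
- by rewrite phi_valD psiwD.
- by rewrite phi_evE psiw_ev zscaleC.
- by rewrite phi_evE psiw_ev ract_kappa.
- by have := dv ord_max; rewrite subnn addr0.
Qed.

Definition eps : gbimod_hom (phi_gbimod (psi_gmod X)) X := exist _ _ eps_hom.

Lemma eps_bij : bijective (sval eps).
Proof.
have kill (x : zm X) (i : 'I_N.+1) : gp k n 0 i *: (if i == ord_max then x else 0) = 0.
  case: eqP => [->|_]; last exact: scaler0.
  apply: central_kill => // l; apply/eqP; rewrite evl_gp_eq0 //=; exact: ltn_ord.
pose g0 (x : X) : wm (psi_gmod X) := psi_mk (kill x).
have g0E x i : psi_at (g0 x) i = if i == ord_max then x else 0 by apply: psi_mkE.
have eNE (v : wm (psi_gmod X)) i : psi_at (eN *: v) i = if i == ord_max then psi_at v i else 0.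
  by rewrite (_ : eN = We k ord_max) ?psiw_e // -eW_ord.
have gP x : g0 x \in @phi_pred k n (psi_gmod X).
  by apply/eqP; apply: psiw_ext => i; rewrite eNE g0E; case: (i == ord_max).
exists (fun x => PhiT (gP x)) => [v|x] /=; last by rewrite g0E eqxx.
apply: phi_inj; apply: psiw_ext => i; rewrite /= g0E.
by rewrite -{2}(phiP v) eNE; case: eqP => [->|].
Qed.

End Epsilon.

Lemma eps_nat (X Y : bimod) (cX : central X) (cY : central Y) (f : gbimod_hom X Y) :
  gbimod_cmp (eps cY) (phi_map (psi_map f)) = gbimod_cmp f (eps cX).
Proof.
by apply: sval_inj; apply: funext => v /=; rewrite psi_mapE.
Qed.

End Units.

(** * Sums of cyclic projective modules *)

Section WBased.
Variables (k : fieldType) (n : nat).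
Local Notation N := n.+1.
Local Notation R := {mpoly k[N]}.
Local Notation A := (invring k (set0 : {set 'I_N.-1})).
Local Notation W := (Walg k n).
Local Notation WG := (Defs.W k N).
Local Notation lo j := (@lo N.+1 j).
Local Notation hi j := (@hi N.+1 j).
Local Notation eW := (eW k n).
Local Notation pth := (pth k n).

Lemma pth_kill i j (p : {poly A}) : (i <= N)%N -> (j <= N)%N ->
  (forall l : 'I_N, (l < minn i j)%N -> evl l p = 0) -> ev p * (pth i j * eW j) = 0.
Proof.
move=> iN jN; have [ij|ji] := leqP i j => p0.
  by rewrite -pth_e // mulrA evl_kill ?mul0r.
by rewrite mulrA ev_comm -mulrA evl_kill ?mulr0.
Qed.

(** The paths from the vertex [j] span the left ideal of [e_j] over the
    polynomials in [z]. *)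
Lemma path_span (a : W) (i j : nat) : (i <= N)%N -> (j <= N)%N ->
  exists Q : 'I_N.+1 -> {poly A},
    a * (pth i j * eW j) = \sum_i' ev (Q i') * (pth i' j * eW j).
Proof.
move=> + jN; pose S (w : W) := exists Q : 'I_N.+1 -> {poly A},
  w = \sum_i' ev (Q i') * (pth i' j * eW j).
have S0 : S 0 by exists (fun _ => 0); rewrite big1 // => i' _; rewrite rmorph0 mul0r.
have SD w w' : S w -> S w' -> S (w + w').
  move=> [Q ->] [Q' ->]; exists (fun i' => Q i' + Q' i'); rewrite -big_split.
  by apply: eq_bigr => i' _; rewrite rmorphD mulrDl.
have SZ p w : S w -> S (ev p * w).
  move=> [Q ->]; exists (fun i' => p * Q i'); rewrite mulr_sumr.
  by apply: eq_bigr => i' _; rewrite rmorphM mulrA.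
have S1 (i' : nat) : (i' <= N)%N -> S (pth i' j * eW j).
  move=> i'N; exists (fun s => if s == inord i' then 1 else 0).
  rewrite (bigD1 (inord i')) //= eqxx inordK // rmorph1 mul1r big1 ?addr0 // => s.
  by move/negPf->; rewrite rmorph0 mul0r.
rewrite -/(S _); elim/Walg_ind: a i => [c|s|l|m|a b ha hb|a b ha hb] i iN.
- have [ca cE] := A_val (c%:MP : R).
  by rewrite -mevC -cE -evC; apply/SZ/S1.
- have [<-|si] := eqVneq (inord i) s.
    by rewrite -pth_e // mulrA -/(eW i) eW_idem pth_e //; apply: S1.
  by rewrite -pth_e // mulrA We_idem eq_sym (negPf si) mul0r.
- rewrite -pth_e // mulrA Wy_central -mulrA pth_e //.
  by case: unlift => [l'|]; [rewrite -mevX -[X in mev X]/(val (xv k l')) -evC | rewrite -evX];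
     apply/SZ/S1.
- rewrite -[Wp k m]pW_ord; have mN := ltn_ord m.
  have [em|im] := eqVneq i m.
    rewrite em; have [jm|mj] := leqP j m.
      by rewrite mulrA -pth_up //; apply: S1.
    by rewrite mulrA pW_pth_dn //; apply/SZ/S1.
  have [em|im'] := eqVneq i m.+1.
    rewrite em; have [jm|mj] := leqP j m.
      by rewrite mulrA pW_pth_up //; apply/SZ/S1/ltnW.
    by rewrite mulrA -pth_dn //; apply/S1/ltnW.
  by rewrite -pth_e // mulrA pW_out // mul0r.
- by rewrite mulrDl; apply: SD; [apply: ha | apply: hb].
- rewrite -mulrA; have [Q ->] := hb i iN; rewrite mulr_sumr.
  apply: (big_ind S) => // i' _; rewrite mulrA -ev_comm -mulrA.
  by apply/SZ/ha; rewrite -ltnS.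
Qed.

Lemma path_vertex (M : gmod WG) (i j : nat) (p : {poly A}) (w : wm M) : (i <= N)%N ->
  (j <= N)%N -> eW j *: w = w ->
  eW i *: (ev p *: (pth i j *: w)) = ev p *: (pth i j *: w).
Proof.
move=> iN jN <-; rewrite !scalerA -ev_comm -!mulrA [eW i * _]mulrA.
by rewrite pth_e // -!mulrA eW_idem.
Qed.

Section Def.
Variables (M : gmod WG) (T : finType) (j : T -> nat) (d : T -> int) (v : T -> wm M).

(** [M] is the direct sum of the cyclic modules generated by the [v_t], each
    isomorphic to the projective module [W e_(j_t)]: the path from [v_t] to the
    vertex [i] has annihilator generated by [prod_(l < min(i,j_t)) (z - x_l)]. *)
Record wbased : Prop := WBased {
  wb_le : forall t, (j t <= N)%N;
  wb_e : forall t, eW (j t) *: v t = v t;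
  wb_deg : forall t, gm_deg (d t) (v t : M);
  wb_span : forall i (x : wm M), (i <= N)%N -> eW i *: x = x ->
    exists P : T -> {poly A}, x = \sum_t ev (P t) *: (pth i (j t) *: v t);
  wb_rel : forall i (P : T -> {poly A}), (i <= N)%N ->
    \sum_t ev (P t) *: (pth i (j t) *: v t) = 0 <->
    forall t (l : 'I_N), (l < minn i (j t))%N -> evl l (P t) = 0 }.

Definition generates : Prop := forall x : wm M, exists a : T -> W, x = \sum_t a t *: v t.

Hypothesis vN : forall t, (j t <= N)%N.

Lemma vertex_decomp (x : wm M) : x = \sum_(i < N.+1) eW i *: x.
Proof.
rewrite -scaler_suml -[LHS]scale1r -(sum_We k n); congr (_ *: _).
by apply: eq_bigr => i _; rewrite eW_ord.
Qed.

(** The coefficients do not depend on the module, only on the vertex. *)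
Lemma scale_path (a : W) (i : nat) : (i <= N)%N -> forall t,
  exists Q : 'I_N.+1 -> {poly A},
  forall (M' : gmod WG) (w : wm M'), eW (j t) *: w = w ->
    a *: (pth i (j t) *: w) = \sum_i' ev (Q i') *: (pth i' (j t) *: w).
Proof.
move=> iN t; have [Q QE] := path_span a iN (vN t); exists Q => M' w we.
rewrite -we !scalerA -mulrA QE scaler_suml; apply: eq_bigr => i' _.
by rewrite !scalerA !mulrA.
Qed.

End Def.

Section Universal.
Variables (M : gmod WG) (T : finType) (j : T -> nat) (d : T -> int) (v : T -> wm M).
Hypothesis bM : wbased j d v.

Lemma wb_gen : generates v.
Proof.
move=> x; have spn (i : 'I_N.+1) : exists P : T -> {poly A},
    eW i *: x = \sum_t ev (P t) *: (pth i (j t) *: v t).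
  by apply: (wb_span bM); rewrite ?leq_ord // scalerA eW_idem.
have [P PE] := choice spn.
exists (fun t => \sum_i ev (P i t) * pth i (j t)).
rewrite [LHS]vertex_decomp (eq_bigr _ (fun i _ => PE i)) exchange_big.
apply: eq_bigr => t _; rewrite scaler_suml; apply: eq_bigr => i _.
by rewrite scalerA.
Qed.

Variables (M' : gmod WG) (w : T -> wm M').
Hypothesis we : forall t, eW (j t) *: w t = w t.
Hypothesis wd : forall t, gm_deg (d t) (w t : M').

(** [M] has the universal property of the sum of the [W e_(j_t)]. *)
Lemma wb_hom : exists f : gmod_hom M M', forall t, sval f (v t) = w t.
Proof.
have jN := wb_le bM.
have spn (p : wm M * 'I_N.+1) : exists P : T -> {poly A},
    eW p.2 *: p.1 = \sum_t ev (P t) *: (pth p.2 (j t) *: v t).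
  by apply: (wb_span bM); rewrite ?leq_ord // scalerA eW_idem.
have [c cE] := choice spn.
pose g (i : 'I_N.+1) (P : T -> {poly A}) : wm M' :=
  \sum_t ev (P t) *: (pth i (j t) *: w t).
pose h (i : 'I_N.+1) (P : T -> {poly A}) : wm M :=
  \sum_t ev (P t) *: (pth i (j t) *: v t).
have gh i P Q : h i P = h i Q -> g i P = g i Q.
  move=> hPQ; apply: subr0_eq; rewrite -sumrB big1 // => t _.
  rewrite -scalerBl -evB -(we t) !scalerA.
  rewrite pth_kill ?scale0r ?leq_ord // => l.
  have := (wb_rel bM (fun t => P t - Q t) (leq_ord i)).1; apply.
  under eq_bigr do rewrite evB scalerBl.
  by rewrite sumrB; apply/eqP; rewrite subr_eq0; apply/eqP.
have g0 i : g i (fun _ => 0) = 0.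
  by rewrite /g big1 // => t _; rewrite rmorph0 scale0r.
have h0 i : h i (fun _ => 0) = 0.
  by rewrite /h big1 // => t _; rewrite rmorph0 scale0r.
have gD i P Q : g i (fun t => P t + Q t) = g i P + g i Q.
  by rewrite -big_split; apply: eq_bigr => t _; rewrite rmorphD scalerDl.
have hD i P Q : h i (fun t => P t + Q t) = h i P + h i Q.
  by rewrite -big_split; apply: eq_bigr => t _; rewrite rmorphD scalerDl.
pose one t P := fun s : T => if s == t then P else 0 : {poly A}.
have g1 i t P : g i (one t P) = ev P *: (pth i (j t) *: w t).
  rewrite /g (bigD1 t) //= /one eqxx big1 ?addr0 // => s /negPf->.
  by rewrite rmorph0 scale0r.
have h1 i t P : h i (one t P) = ev P *: (pth i (j t) *: v t).
  rewrite /h (bigD1 t) //= /one eqxx big1 ?addr0 // => s /negPf->.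
  by rewrite rmorph0 scale0r.
have hc x i : h i (c (x, i)) = eW i *: x by exact: esym (cE (x, i)).
pose F (x : wm M) : wm M' := \sum_(i < N.+1) g i (c (x, i)).
have FD : {morph F : x y / x + y}.
  move=> x y; rewrite /F -big_split; apply: eq_bigr => i _; rewrite /= -gD.
  by apply: gh; rewrite hD !hc scalerDr.
have F0 : F 0 = 0 by apply: (@addrI _ (F 0)); rewrite -FD !addr0.
have Fsum (J : Type) (r : seq J) (G : J -> wm M) :
    F (\sum_(s <- r) G s) = \sum_(s <- r) F (G s) by apply: (big_morph F FD F0).
have F1 (i : 'I_N.+1) t P :
    F (ev P *: (pth i (j t) *: v t)) = ev P *: (pth i (j t) *: w t).
  rewrite /F; set y := _ *: (_ *: v t).
  have yi : eW i *: y = y by rewrite path_vertex ?leq_ord // (wb_e bM).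
  rewrite (bigD1 i) //= big1 ?addr0 => [|i' ni].
    by rewrite (gh i _ (one t P)) ?g1 // hc h1.
  rewrite (gh i' _ (fun _ => 0)) // h0 hc -yi scalerA eW_ne ?scale0r ?leq_ord //.
have Fv a t : F (a *: v t) = a *: w t.
  have [Q QE] := scale_path (j := j) jN a (jN t) t.
  have /= e1 := QE _ _ (wb_e bM t); have /= e2 := QE _ _ (we t).
  rewrite pth_refl !scale1r in e1 e2; rewrite e1 e2 Fsum.
  by apply: eq_bigr => i _; rewrite F1.
have FZ a x : F (a *: x) = a *: F x.
  have [b ->] := wb_gen x; rewrite scaler_sumr !Fsum scaler_sumr.
  by apply: eq_bigr => t _; rewrite scalerA !Fv scalerA.
have Fd : forall e (x : M), gm_deg e x -> gm_deg e (F x : M').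
  apply: (deg_of_span (gm_grading M) (gm_grading M') FD) => S S0 SD S1.
  move=> x; have [a ->] := wb_gen x; apply: (big_ind S) => // t _.
  have [r [hr ->]] := grading_span (gr_grading WG) (a t : WG).
  rewrite scaler_suml big_seq; apply: (big_ind S) => // p /hr pr.
  apply: (S1 (p.1 + d t)); first exact: wscale_deg pr (wb_deg bM t).
  by rewrite Fv; exact: wscale_deg pr (wd t).
have [f fE] := gmod_hom_mk FD FZ Fd.
by exists f => t; rewrite fE -[v t]scale1r Fv scale1r.
Qed.

End Universal.

Lemma gmod_hom_ext (M M' : gmod WG) (T : finType) (v : T -> wm M) (f g : gmod_hom M M') :
  generates v -> (forall t, sval f (v t) = sval g (v t)) -> f = g.
Proof.
move=> gv fg; apply: sval_inj; apply: funext => x; have [a ->] := gv x.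
rewrite !gmod_hom_sum; apply: eq_bigr => t _.
by rewrite !gmod_homZ fg.
Qed.

(** Preimages of the generators can be chosen homogeneous and at the right vertex. *)
Lemma wb_gproj (M : gmod WG) (T : finType) (j : T -> nat) d (v : T -> wm M) :
  wbased j d v -> gproj M.
Proof.
move=> bM M1 M2 p f psurj; have [pD pdeg] := (gmod_homD p, gmod_hom_deg p).
have lift t : exists w : wm M1,
    [/\ eW (j t) *: w = w, gm_deg (d t) (w : M1) & sval p w = sval f (v t)].
  have [y py] := psurj (sval f (v t)).
  pose z : wm M1 := hcomp (gm_grading M1) (d t) y.
  have pz : sval p z = sval f (v t).
    have pdeg0 i x : gm_deg i x -> gm_deg (i + 0) (sval p x) by rewrite addr0; apply: pdeg.
    have := hcomp_hom (gm_grading M1) (gm_grading M2) pD pdeg0 (d t) y.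
    rewrite -/z => <-; rewrite addr0 py hcomp_id //.
    exact/gmod_hom_deg/(wb_deg bM).
  exists (eW (j t) *: z); split.
  - by rewrite scalerA eW_idem.
  - rewrite -[d t]add0r; apply: wscale_deg; [exact: wdeg_We | exact: hcomp_deg].
  - by rewrite gmod_homZ pz -gmod_homZ (wb_e bM).
have [w wP] := choice lift.
have [g gE] := wb_hom bM (w := w) (fun t => let: And3 h _ _ := wP t in h)
  (fun t => let: And3 _ h _ := wP t in h).
exists g; apply: (gmod_hom_ext (wb_gen bM)) => t /=.
by rewrite gE; have [] := wP t.
Qed.

Lemma generates_fin_gen (M : gmod WG) (T : finType) (v : T -> wm M) :
  generates v -> fin_gen M.
Proof.
move=> gv; exists #|T|, (fun s => v (enum_val s)) => x; have [a ->] := gv x.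
exists (fun s => a (enum_val s)); rewrite (reindex _ (onW_bij _ (enum_val_bij T))) /=.
by apply: eq_bigr => s _; rewrite wscaleE.
Qed.

Lemma wb_transport (M M' : gmod WG) (f : gmod_hom M M') (T : finType) (j : T -> nat) d
    (v : T -> wm M) : bijective (sval f) -> wbased j d v ->
  wbased j d (fun t => sval f (v t) : wm M').
Proof.
move=> [g fg gf] bM.
have fE i P : sval f (\sum_t ev (P t) *: (pth i (j t) *: v t)) =
    \sum_t ev (P t) *: (pth i (j t) *: (sval f (v t) : wm M')).
  by rewrite gmod_hom_sum; apply: eq_bigr => t _; rewrite !gmod_homZ.
split=> [t|t|t|i x iN xi|i P iN].
- exact: wb_le bM t.
- by rewrite -gmod_homZ (wb_e bM).
- exact/gmod_hom_deg/(wb_deg bM).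
- have [|P PE] := wb_span bM (x := g x) iN; last first.
    by exists P; rewrite -fE -PE gf.
  by apply: (can_inj fg); rewrite gmod_homZ gf.
- rewrite -(wb_rel bM) // -fE; split=> [e|->]; last exact: gmod_hom0.
  by apply: (can_inj fg); rewrite e gmod_hom0.
Qed.

End WBased.

(** * The functors exchange the two kinds of sums *)

Section Correspondence.
Variables (k : fieldType) (n : nat).
Local Notation N := n.+1.
Local Notation hat := (hat1 N).
Local Notation A := (invring k (set0 : {set 'I_N.-1})).
Local Notation W := (Walg k n).
Local Notation WG := (Defs.W k N).
Local Notation lo j := (@lo N.+1 j).
Local Notation hi j := (@hi N.+1 j).
Local Notation bimod := (gbimod (RI k (set0 : {set 'I_N.-1})) (RI k hat)).
Local Notation eW := (eW k n).
Local Notation pth := (pth k n).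
Local Notation gp := (gp k n).

Section PsiBased.
Variable X : bimod.
Implicit Types g : wm (psi_gmod X).

Lemma psiw_eW i g (s : 'I_N.+1) : (i <= N)%N ->
  psi_at (eW i *: g) s = if i == s :> nat then psi_at g s else 0.
Proof. by move=> iN; rewrite psiw_e -(inj_eq val_inj) /= inordK // eq_sym. Qed.

(** A path acts by multiplication by a polynomial. *)
Lemma psiw_pth i j g : (i <= N)%N -> (j <= N)%N ->
  psi_at (pth i j *: g) (inord i) = gp i j *: psi_at g (inord j).
Proof.
move=> iN jN; rewrite /pth; have [ji|ij] := leqP j i.
  rewrite /gp big_geq // scale1r -{2}(subnKC ji).
  have : (j + (i - j) <= N)%N by rewrite subnKC.
  elim: (i - j)%N => [|m IH] jm; first by rewrite addn0 scale1r.
  rewrite addnS in jm *; rewrite /= -scalerA psiw_p -hi_inord // eqxx lo_inord //.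
  exact/IH/ltnW.
rewrite -{2 3}(subnKC (ltnW ij)).
have : (i + (j - i) <= N)%N by rewrite subnKC // ltnW.
elim: (j - i)%N g => [|m IH] g im; first by rewrite addn0 scale1r gp_refl scale1r.
rewrite addnS in im *; rewrite /= -scalerA IH ?(ltnW im) // psiw_p -lo_inord //.
by rewrite lo_hi eqxx hi_inord // scalerA gp_recr // leq_addr.
Qed.

Variables (T : finType) (j : T -> nat) (d : T -> int) (v : T -> zm X).
Hypothesis bX : based j d v.

Lemma psi_gen_exists t : exists g : wm (psi_gmod X),
  forall s : 'I_N.+1, psi_at g s = if j t == s :> nat then v t else 0.
Proof.
have kill (s : 'I_N.+1) : gp 0 s *: (if j t == s :> nat then v t else 0) = 0.
  case: eqP => [es|_]; last exact: scaler0.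
  apply: (based_kill bX) => l lj; apply/eqP; rewrite evl_gp_eq0 -?es //.
  exact: based_le bX t.
by exists (psi_mk kill) => s; apply: psi_mkE.
Qed.

(** Place each [v_t] at the vertex [j_t]. An element [sum_t P_t v_t] sits at the
    vertex [i] iff each [P_t] is divisible by [prod_(i <= l < j_t) (z - x_l)], that is, iff
    it is a combination of the paths from the [v_t] to [i]. *)
Lemma psi_wbased : exists g : T -> wm (psi_gmod X),
  wbased j (fun t => d t - (N - j t)%:Z) g.
Proof.
have [g gE] := choice psi_gen_exists; exists g; have jN := based_le bX.
have ge t : eW (j t) *: g t = g t.
  by apply: psiw_ext => s; rewrite psiw_eW // gE; case: eqP.
have gv t : psi_at (g t) (inord (j t)) = v t by rewrite gE inordK ?eqxx // ltnS.
have sumE i P : (i <= N)%N ->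
    psi_at (\sum_t ev (P t) *: (pth i (j t) *: g t)) (inord i) = \sum_t (P t * gp i (j t)) *: v t.
  move=> iN; rewrite psiw_sum; apply: eq_bigr => t _.
  by rewrite psiw_ev psiw_pth // gv scalerA.
have vtx i P : (i <= N)%N ->
    eW i *: (\sum_t ev (P t) *: (pth i (j t) *: g t)) = \sum_t ev (P t) *: (pth i (j t) *: g t).
  by move=> iN; rewrite scaler_sumr; apply: eq_bigr => t _; rewrite path_vertex.
have ext i (x y : wm (psi_gmod X)) : (i <= N)%N -> eW i *: x = x -> eW i *: y = y ->
    psi_at x (inord i) = psi_at y (inord i) -> x = y.
  move=> iN xi yi xy; apply: psiw_ext => s; rewrite -xi -yi !psiw_eW //.
  by case: eqP => // es; rewrite es inord_val in xy.
have rel i P : (i <= N)%N -> \sum_t (P t * gp i (j t)) *: v t = 0 <->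
    forall t (l : 'I_N), (l < minn i (j t))%N -> evl l (P t) = 0.
  move=> iN; rewrite (based_rel bX (fun t => P t * gp i (j t))).
  split=> H t l lt.
    have := H t l; rewrite evlM => /(_ _)/eqP; rewrite mulf_eq0 evl_gp_eq0 //.
    rewrite leq_min in lt; move: lt => /andP[li lj]; rewrite lj leqNgt li orbF.
    by move=> /(_ isT) /eqP.
  apply/eqP; rewrite evlM mulf_eq0 evl_gp_eq0 // lt andbT.
  have [//|li] := leqP i l; first by rewrite orbT.
  by rewrite H ?eqxx // leq_min li.
split=> // [t s|i x iN xi|i P iN].
- rewrite gE; case: eqP => [<-|_]; first by rewrite subrK; apply: based_deg bX t.
  exact: grading0 (bm_grading X) _.
- have [P PE] := based_span bX (psi_at x (inord i)).
  have dvd t : exists q, P t = q * gp i (j t).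
    have [|q ->] := @gp_dvd k n i (j t) (P t) (jN t); last by exists q; rewrite mulrC.
    move=> l /andP[il lj]; have [+ _] := based_rel bX (fun t => gp 0 i * P t).
    move=> /(_ _ t l lj); rewrite evlM => /(_ _)/eqP.
    rewrite mulf_eq0 evl_gp_eq0 // leq0n /= ltnNge il /= => H; apply/eqP/H.
    under eq_bigr do rewrite -scalerA.
    by rewrite -scaler_sumr -PE; have := psi_kill x (inord i : 'I_N.+1); rewrite inordK.
  have [Q QE] := choice dvd; exists Q; apply: (ext i) => //; first exact: vtx.
  by rewrite sumE // PE; apply: eq_bigr => t _; rewrite QE.
- rewrite -(rel i P iN) -sumE //; split=> [->|e0]; first exact: psiw_0.
  by apply: (ext i) => //; rewrite ?vtx ?scaler0 // e0 psiw_0.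
Qed.

End PsiBased.

Section WToBimod.
Variables (M : gmod WG) (T : finType) (j : T -> nat) (d : T -> int) (v : T -> wm M).
Hypothesis bM : wbased j d v.

Let jN := wb_le bM.

Lemma toN_pth (i : 'I_N.+1) t (p : {poly A}) :
  toN k i *: (ev p *: (pth i (j t) *: v t)) =
  ev (p * gp i (j t)) *: (pth N (j t) *: v t).
Proof.
rewrite -(wb_e bM t) !scalerA; congr (_ *: _).
rewrite /toN -eW_ord -!mulrA; rewrite [eW i * _]mulrA -ev_comm.
rewrite [upW _ _ _ _ * _]mulrA [upW _ _ _ _ * (_ * _)]mulrA -ev_comm -!mulrA.
rewrite [eW i * (_ * _)]mulrA pth_e ?leq_ord // -!mulrA eW_idem.
have iN : (i + (N - i) = N)%N by rewrite subnKC // leq_ord.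
rewrite upW_pth ?iN // (minn_idPr (jN t)) rmorphM !mulrA.
by [].
Qed.

(** Both the kernel and the image of going up to the last vertex are cut out by
    the same vanishing conditions on the coefficients. *)
Lemma toN_inj (i : 'I_N.+1) (x : wm M) : eW i *: x = x -> toN k i *: x = 0 -> x = 0.
Proof.
move=> xi; have [P ->] := wb_span bM (leq_ord i) xi.
rewrite scaler_sumr (eq_bigr _ (fun t _ => toN_pth i t (P t))) => e0.
apply/(wb_rel bM _ (leq_ord i)) => t l; rewrite leq_min => /andP[li lj].
have [+ _] := wb_rel bM (fun t => P t * gp i (j t)) (leqnn N).
move=> /(_ e0 t l); rewrite (minn_idPr (jN t)) evlM => /(_ lj) /eqP.
by rewrite mulf_eq0 evl_gp_eq0 // leqNgt li orbF => /eqP.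
Qed.

Lemma toN_surj (i : 'I_N.+1) (y : wm M) : eW N *: y = y -> ev (gp 0 i) *: y = 0 ->
  exists2 x : wm M, eW i *: x = x & toN k i *: x = y.
Proof.
move=> yN; have [P ->] := wb_span bM (leqnn N) yN => e0.
have dvd t : exists q, P t = q * gp i (j t).
  have [|q ->] := @gp_dvd k n i (j t) (P t) (jN t); last by exists q; rewrite mulrC.
  move=> l /andP[il lj]; have [+ _] := wb_rel bM (fun t => gp 0 i * P t) (leqnn N).
  move=> /(_ _ t l); rewrite (minn_idPr (jN t)) evlM => /(_ _ lj)/eqP.
  rewrite mulf_eq0 evl_gp_eq0 ?leq_ord // leq0n /= ltnNge il /= => H; apply/eqP/H.
  rewrite -[RHS]e0 scaler_sumr; apply: eq_bigr => s _.
  by rewrite [RHS]scalerA -rmorphM.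
have [Q QE] := choice dvd; exists (\sum_t ev (Q t) *: (pth i (j t) *: v t)).
  rewrite scaler_sumr; apply: eq_bigr => t _.
  by rewrite path_vertex ?leq_ord // (wb_e bM).
by rewrite scaler_sumr; apply: eq_bigr => t _; rewrite toN_pth QE.
Qed.

Lemma eta_bij : bijective (sval (eta M)).
Proof.
have eta0 (x : wm M) : sval (eta M) x = 0 -> x = 0.
  move=> x0; rewrite [x]vertex_decomp big1 // => i _.
  apply: (@toN_inj i); first by rewrite scalerA eW_idem.
  by rewrite scalerA eW_ord toN_e eqxx -etaE x0 psi0E.
have surj (u : psi_gmod (phi_gbimod M)) : exists x, sval (eta M) x = u.
  have lift (i : 'I_N.+1) : exists2 x : wm M, eW i *: x = x &
      toN k i *: x = phi_val (psi_at u i : phiT M).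
    by apply: toN_surj; rewrite ?phiP // -phi_zscale psi_kill.
  have [x xP] := choice (fun i => let: ex_intro2 x h1 h2 := lift i in
    ex_intro (fun x => eW i *: x = x /\ toN k i *: x = phi_val (psi_at u i : phiT M))
      x (conj h1 h2)).
  exists (\sum_i x i); apply: psi_ext => i; apply: phi_inj; rewrite etaE scaler_sumr.
  rewrite (bigD1 i) //= (xP i).2 big1 ?addr0 // => i' ni.
  by rewrite -(xP i').1 eW_ord scalerA toN_e eq_sym (negPf ni) scale0r.
have [g gE] := choice surj; exists g => // x.
apply: subr0_eq; apply: eta0.
have := gmod_homD (eta M) (g (sval (eta M) x) - x) x.
by rewrite subrK gE => /eqP; rewrite -subr_eq subrr => /eqP <-.
Qed.

Lemma phi_based : exists v' : T -> zm (phi_gbimod M),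
  based j (fun t => d t + (N - j t)%:Z) v'.
Proof.
have vP t : pth N (j t) *: v t \in @phi_pred k n M.
  apply/eqP; rewrite -(wb_e bM t) !scalerA; congr (_ *: _).
  by rewrite -mulrA mulrA pth_e // -mulrA eW_idem.
pose v' t : zm (phi_gbimod M) := PhiT (vP t); exists v'.
have sumE (P : T -> {poly A}) : phi_val (\sum_t P t *: v' t : phiT M) =
    \sum_t ev (P t) *: (pth N (j t) *: v t).
  rewrite (big_morph (@phi_val k n M) (@phi_valD k n M) (erefl _)).
  by apply: eq_bigr => t _; rewrite phi_zscale.
split=> // [t i|t|x|P]; first by rewrite inE.
- have := wscale_deg (wdeg_pth k (leqnn N) (jN t)) (wb_deg bM t).
  by rewrite jN addrC.
- have [P PE] := wb_span bM (leqnn N) (phiP (x : phiT M)).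
  by exists P; apply: phi_inj; rewrite sumE.
- rewrite -[X in X <-> _]/(\sum_t P t *: v' t = 0 :> phiT M).
  have -> : (\sum_t P t *: v' t = 0 :> phiT M) <->
      \sum_t ev (P t) *: (pth N (j t) *: v t) = 0.
    by rewrite -sumE; split=> [->//|e0]; apply: phi_inj.
  rewrite (wb_rel bM P (leqnn N)).
  by split=> H t l; have := H t l; rewrite (minn_idPr (jN t)).
Qed.

End WToBimod.
End Correspondence.

(** * Graded projective modules *)

Section Projectives.
Variables (k : fieldType) (n : nat).
Local Notation N := n.+1.
Local Notation W := (Walg k n).
Local Notation WG := (Defs.W k N).
Local Notation eW := (eW k n).

Section Family.
Variable P : gmod WG.

(** Generators homogeneous for the grading and for the vertices; the first
    vertex carries nothing. *)
Definition hfam m (j : 'I_m -> nat) (d : 'I_m -> int) (v : 'I_m -> wm P) : Prop :=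
  [/\ forall t, (0 < j t <= N)%N, forall t, eW (j t) *: v t = v t,
      forall t, gm_deg (d t) (v t : P) & generates v].

Lemma hfam_exists : fin_gen P -> exists m j d v, @hfam m j d v.
Proof.
move=> [m [v gv]]; have [r rP] := choice (fun s => hcomp_sum (gm_grading P) (v s)).
pose comp e s : wm P := hcomp (gm_grading P) e (v s).
pose L := flatten [seq [seq (i, e, eW i *: comp e s) | i <- iota 1 N, e <- r s]
  | s <- enum 'I_m].
pose z : nat * int * wm P := (0%N, 0, 0).
have LP p : p \in L -> [/\ (0 < p.1.1 <= N)%N, eW p.1.1 *: p.2 = p.2 & gm_deg p.1.2 (p.2 : P)].
  move=> /flattenP[_ /mapP[s _ ->] /allpairsP[[i e] [iN er ->]]] /=.
  rewrite mem_iota /= in iN; split; first by lia.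
    by rewrite scalerA eW_idem.
  have := wscale_deg (wdeg_We _ (inord i)) (hcomp_deg (gm_grading P) e (v s)).
  by rewrite add0r.
exists (size L), (fun t => (nth z L t).1.1), (fun t => (nth z L t).1.2), (fun t => (nth z L t).2).
have Lt (t : 'I_(size L)) := LP _ (mem_nth z (ltn_ord t)).
split=> [t|t|t|]; try by case: (Lt t).
pose S x := exists a : 'I_(size L) -> W, x = \sum_t a t *: (nth z L t).2.
have S0 : S 0 by exists (fun _ => 0); rewrite big1 // => t _; rewrite scale0r.
have SD x y : S x -> S y -> S (x + y).
  move=> [a ->] [b ->]; exists (fun t => a t + b t); rewrite -big_split.
  by apply: eq_bigr => t _; rewrite scalerDl.
have SZ c x : S x -> S (c *: x).
  move=> [a ->]; exists (fun t => c * a t); rewrite scaler_sumr.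
  by apply: eq_bigr => t _; rewrite scalerA.
have SL p : p \in L -> S p.2.
  move=> pL; have iL : (index p L < size L)%N by rewrite index_mem.
  exists (fun t => if t == Ordinal iL then 1 else 0).
  rewrite (bigD1 (Ordinal iL)) //= eqxx scale1r nth_index // big1 ?addr0 // => t.
  by move/negPf->; rewrite scale0r.
have Sv s : S (v s).
  have [_ _ e0] := rP s; have e1 : \sum_(e <- r s) comp e s = v s := e0.
  rewrite -e1 {e0 e1} big_seq; apply: (big_ind S) => // e er.
  rewrite [comp e s]vertex_decomp; apply: (big_ind S) => // i _.
  have [->|i0] := eqVneq i ord0; first by rewrite eW_ord We0 scale0r.
  apply: (SL (i : nat, e, eW i *: comp e s)); apply/flattenP.
  exists [seq (i, e, eW i *: comp e s) | i <- iota 1 N, e <- r s].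
    by apply/mapP; exists s; rewrite ?mem_enum.
  apply/allpairsP; exists (i : nat, e); split=> //.
  rewrite mem_iota.
  by rewrite lt0n i0 add1n ltn_ord.
move=> x; have [a ea] := gv x; suff : S x by []; rewrite ea.
by apply: (big_ind S) => // s _; rewrite -wscaleE; apply: SZ.
Qed.

(** A relation with an invertible coefficient makes a generator redundant. *)
Lemma hfam_drop m (j : 'I_m -> nat) d v (s : 'I_m) (b : 'I_m -> W) (c : k) :
  hfam j d v -> c != 0 -> \sum_t b t *: v t = 0 -> b s *: v s = cst n c *: v s ->
  exists j' d' v', @hfam m.-1 j' d' v'.
Proof.
case: m => [|m] in j d v s b *; first by case: s.
move=> [jN ve vd gv] c0 b0 bs.
exists (fun t => j (lift s t)), (fun t => d (lift s t)), (fun t => v (lift s t)).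
split=> // x.
have [a ->] := gv x; move: b0; rewrite (bigD1_ord s) //= bs => b0.
have vs : v s = cst n (- c^-1) *: \sum_t b (lift s t) *: v (lift s t).
  have -> : \sum_t b (lift s t) *: v (lift s t) = - (cst n c *: v s).
    by apply/eqP; rewrite -addr_eq0 addrC b0.
  by rewrite scalerN -scaleNr scalerA -rmorphN -rmorphM opprK mulVf // rmorph1 scale1r.
exists (fun t => a s * cst n (- c^-1) * b (lift s t) + a (lift s t)).
rewrite (bigD1_ord s) //= {1}vs !scalerA scaler_sumr -big_split.
by apply: eq_bigr => t _; rewrite scalerDl scalerA.
Qed.

Lemma minimal_hfam : fin_gen P -> exists m j d v, @hfam m j d v /\
  forall m' j' d' v', @hfam m' j' d' v' -> (m <= m')%N.
Proof.
move=> /hfam_exists[m0 h0]; pose p m := `[< exists j d v, @hfam m j d v >].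
have ex : exists m, p m by exists m0; apply/asboolP.
have [m /asboolP[j [d [v h]]] mmin] := ex_minnP ex; exists m, j, d, v; split=> //.
by move=> m' j' d' v' h'; apply: mmin; apply/asboolP; exists j', d', v'.
Qed.

End Family.

(** A minimal family of homogeneous generators is a basis. It defines a
    surjection from a free module [F], split because [P] is projective. The
    complementary idempotent of [F] has coefficients of positive degree, as one
    of degree 0 would contradict minimality; so it is nilpotent, hence 0. *)
Lemma gproj_wbased (P : gmod WG) : fin_gen P -> gproj P ->
  exists m (j : 'I_m -> nat) d (v : 'I_m -> wm P),
    (forall t, (0 < j t <= N)%N) /\ wbased j d v.
Proof.
move=> fP pP; have [m [j [d [v [hv mmin]]]]] := minimal_hfam fP.
have [jN ve vd gv] := hv; exists m, j, d.
have jN' t : (j t <= N)%N by have /andP[] := jN t.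
have [X [u [bX _ _]]] := soergel_exists k (fun t => d t + (N - j t)%:Z) jN.
have [g] := psi_wbased bX; have -> : (fun t => d t + (N - j t)%:Z - (N - j t)%:Z) = d.
  by apply: funext => t; rewrite addrK.
set F := psi_gmod X in g *; move=> bF; have gF := wb_gen bF.
have [pi piE] := wb_hom bF ve vd.
have [y|sigma sE] := pP F P pi (gmod_id P).
  have [a ->] := gv y; exists (\sum_t a t *: g t).
  by rewrite gmod_hom_sum; apply: eq_bigr => t _; rewrite gmod_homZ piE.
have sK : cancel (sval sigma) (sval pi).
  by move=> y; have /(congr1 (fun h : gmod_hom _ _ => sval h y)) := sE.
pose eps (x : wm F) : wm F := x - sval sigma (sval pi x).
have epsD : {morph eps : x y / x + y}.
  by move=> x y; rewrite /eps !gmod_homD opprD addrACA.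
have epsZ (a : W) x : eps (a *: x) = a *: eps x by rewrite /eps !gmod_homZ scalerBr.
have eps0 : eps 0 = 0 by apply: (@addrI _ (eps 0)); rewrite -epsD !addr0.
have pi_eps x : sval pi (eps x) = 0 :> wm P.
  have := gmod_homD pi (eps x) (sval sigma (sval pi x)); rewrite /eps subrK sK.
  by move=> /eqP; rewrite -subr_eq subrr eq_sym => /eqP.
have eps_eps x : eps (eps x) = eps x by rewrite {1}/eps pi_eps gmod_hom0 subr0.
have eps_deg e (x : F) : gm_deg e x -> gm_deg e (eps x : F).
  by move=> ex; apply: (gradingB (gm_grading F)) => //; do 2!apply: gmod_hom_deg.
have [a aE] := choice (fun t => gF (eps (g t))).
pose b t s : W := eW (j t) * hcomp (gr_grading WG) (d t - d s) (a t s) * eW (j s).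
have bdeg t s : wdeg (d t - d s) (b t s).
  rewrite -[d t - d s]addr0 -[d t - d s]add0r; apply: wdegM; last exact: wdeg_We.
  by apply: wdegM; [exact: wdeg_We | exact: hcomp_deg].
have bE t : eps (g t) = \sum_s b t s *: g s.
  have -> : eps (g t) = eW (j t) *: (hcomp (gm_grading F) (d t) (eps (g t) : F) : wm F).
    have -> : hcomp (gm_grading F) (d t) (eps (g t) : F) = eps (g t).
      exact: hcomp_id (eps_deg _ _ (wb_deg bF t)).
    by rewrite -epsZ (wb_e bF).
  rewrite {1}aE hcomp_bigsum scaler_sumr; apply: eq_bigr => s _.
  have fD : {morph (fun c : WG => (c : W) *: g s : F) : c c' / c + c'}.
    by move=> c c'; rewrite scalerDl.
  have fdeg e (c : WG) : gr_deg e c -> gm_deg (e + d s) ((c : W) *: g s : F).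
    by move=> ce; apply: wscale_deg ce (wb_deg bF s).
  have := hcomp_hom (gr_grading WG) (gm_grading F) fD fdeg (d t - d s) (a t s).
  rewrite subrK => ->; rewrite /b -!scalerA (wb_e bF).
  by [].
have b0 t s : (d t <= d s)%R -> b t s = 0.
  move=> ds; have [neg zero] := wdeg_le0 (bdeg t s).
  have [lt|eq] : d t - d s < 0 \/ d t - d s = 0 by lia.
    exact: neg.
  have [c cE] := zero eq; pose c' := c (inord (j s)).
  have bs : b t s = cst n c' * eW (j s).
    have -> : b t s = b t s * eW (j s) by rewrite /b -!mulrA eW_idem.
    rewrite cE mulr_suml (bigD1 (inord (j s))) //= -mulrA We_idem eqxx big1 ?addr0 // => i ni.
    by rewrite -mulrA We_idem (negPf ni) mulr0.
  have [c0|c0] := eqVneq c' 0; first by rewrite bs c0 rmorph0 mul0r.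
  have rel : \sum_r b t r *: v r = 0.
    rewrite -[RHS](pi_eps (g t)) bE gmod_hom_sum; apply: eq_bigr => r _.
    by rewrite gmod_homZ piE.
  have [|j' [d' [v' /mmin]]] := hfam_drop hv c0 rel (s := s).
    by rewrite bs -scalerA ve.
  by have := ltn_ord s; lia.
have eps_g t : eps (g t) = 0.
  have [c] := ubnP #|[set s | d s < d t]|; elim: c t => // c IH t tc.
  rewrite -eps_eps [in eps _]bE (big_morph _ epsD eps0) big1 // => s _.
  rewrite epsZ; have [ds|/b0 ->] := Order.TotalTheory.ltP (d s) (d t); last by rewrite scale0r.
  rewrite IH ?scaler0 //; rewrite ltnS in tc; apply: leq_trans tc.
  apply: proper_card; apply/properP; split.
    by apply/subsetP => r; rewrite !inE => rs; lia.
  by exists s; rewrite !inE ?ds // Order.POrderTheory.ltxx.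
have spi x : sval sigma (sval pi x) = x.
  apply/esym/subr0_eq; rewrite -[_ - _]/(eps x); have [c ->] := gF x.
  by rewrite (big_morph _ epsD eps0) big1 // => t _; rewrite epsZ eps_g scaler0.
exists (fun t => sval pi (g t) : wm P); split=> //.
by apply: wb_transport bF; exists (sval sigma).
Qed.

End Projectives.

Lemma nat_iso_sym (C D : category) (F G : functor C D) : nat_iso F G -> nat_iso G F.
Proof.
move=> [e [ei en]].
have inv X : exists g : hom (G X) (F X), cmp g (e X) = idm _ /\ cmp (e X) g = idm _.
  exact: ei.
pose g X := sval (cid (inv X)).
have gP X : cmp (g X) (e X) = idm _ /\ cmp (e X) (g X) = idm _ := svalP (cid (inv X)).
exists g; split=> [X|X Y f]; first by exists (e X); have [] := gP X.
have [gX eX] := gP X; have [gY eY] := gP Y.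
rewrite -[LHS]cmpm1 -eX -[LHS]cmpA [cmp (fmap G f) _]cmpA -en.
by rewrite !cmpA gY cmp1m.
Qed.

(** * The equivalence *)

Section Equivalence.
Variables (k : fieldType) (n : nat).
Local Notation N := n.+1.
Local Notation hat := (hat1 N).
Local Notation WG := (Defs.W k N).
Local Notation bimod := (gbimod (RI k (set0 : {set 'I_N.-1})) (RI k hat)).

(** The last vertex of a sum of cyclic projectives is a sum of cyclic bimodules,
    determined up to isomorphism by its exponents and degrees, and some Soergel
    bimodule has the same ones. *)
Lemma phi_soergel (M : gmod WG) : fin_gen M /\ gproj M -> is_soergel (phi_gbimod M).
Proof.
move=> [fM pM]; have [m [j [d [v [jN bM]]]]] := gproj_wbased fM pM.
have [v' bv'] := phi_based bM.
have [X [u [bX cX sX]]] := soergel_exists k (fun t => d t + (N - j t)%:Z) jN.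
by apply: is_soergel_iso sX; apply: based_iso bv' bX (@phi_central k n M) cX.
Qed.

Lemma soergel_central (X : bimod) : is_soergel X -> central X.
Proof.
by move=> /soergel_summand[M' [T [j [d [v [_ cM' ret]]]]]]; apply: central_retract ret cM'.
Qed.

(** Functors preserve retracts. *)
Lemma psi_gpmod (X : bimod) : is_soergel X ->
  fin_gen (psi_gmod X) /\ gproj (psi_gmod X).
Proof.
move=> /soergel_summand[M' [T [j [d [v [bM' _ [i [p ip]]]]]]]].
have [g bg] := psi_wbased bM'.
have ret : gretract (psi_gmod X) (psi_gmod M').
  exists (psi_map i), (psi_map p) => x; apply: psi_ext => s.
  by rewrite !psi_mapE ip.
split; first exact: gretract_fin_gen ret (generates_fin_gen (wb_gen bg)).
exact: gretract_gproj ret (wb_gproj bg).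
Qed.

Definition phi_functor : functor (gpmod WG) (soergel_cat k (set0 : {set 'I_N.-1}) hat) :=
  @Functor (gpmod WG) (soergel_cat k (set0 : {set 'I_N.-1}) hat)
    (fun P => exist _ (phi_gbimod (sval P)) (phi_soergel (svalP P)))
    (fun P Q f => phi_map f) (fun P => phi_map_id (sval P))
    (fun P Q S g f => phi_map_cmp g f).

Definition psi_functor : functor (soergel_cat k (set0 : {set 'I_N.-1}) hat) (gpmod WG) :=
  @Functor (soergel_cat k (set0 : {set 'I_N.-1}) hat) (gpmod WG)
    (fun X => exist _ (psi_gmod (sval X)) (psi_gpmod (svalP X)))
    (fun X Y f => psi_map f) (fun X => psi_map_id (sval X))
    (fun X Y Z g f => psi_map_cmp g f).

Lemma eta_iso (M : gmod WG) : fin_gen M /\ gproj M -> bijective (sval (eta M)).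
Proof.
by move=> [fM pM]; have [m [j [d [v [_ bM]]]]] := gproj_wbased fM pM; apply: eta_bij bM.
Qed.

Lemma W_soergel_equivalent :
  equivalent (gpmod WG) (soergel_cat k (set0 : {set 'I_N.-1}) hat).
Proof.
exists phi_functor, psi_functor; split.
  apply: nat_iso_sym; exists (fun P => eta (sval P)); split.
    by move=> P; apply: bij_gmod_iso (eta_iso (svalP P)).
  by move=> P Q f; apply: eta_nat.
exists (fun X => eps (soergel_central (svalP X))); split.
  by move=> X; apply: bij_gbimod_is_iso (eps_bij _).
by move=> X Y f; apply: eps_nat.
Qed.

End Equivalence.

Theorem mainTheorem1 (k : fieldType)
  (k_infinite : forall s : seq k, exists x : k, x \notin s)
  (k_char : 2%N \notin [pchar k])
  (n : nat) (n_gt0 : (0 < n)%N) :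
  equivalent (gpmod (W k n)) (soergel_cat k set0 (hat1 n)).
Proof.
by case: n n_gt0 => // n _; apply: W_soergel_equivalent.
Qed.
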